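(* Let $\lambda\in\mathbb{N}$ be a security parameter, $\delta\in(0,1)$ be a constant, and suppose post-quantum one-way functions exist for size $2^{\lambda^\delta}$ adversaries. Then any candidate public-key untelegraphable encryption (UTPKE) scheme (satisfying correctness) cannot have a black-box proof of everlasting one-way security based on a falsifiable assumption $(\mathcal{C},c)$, unless the assumption $(\mathcal{C},c)$ is false.
   Context: $\mathrm{negl}$ denotes a negligible function. Post-quantum one-way functions for size $2^{\lambda^\delta}$ adversaries: one-way functions that quantum (non-uniform) adversaries of size $2^{\lambda^\delta}$ invert with at most negligible probability. UTPKE. QPT algorithms: $\mathsf{Gen}(1^\lambda)\to(\mathsf{pk},\mathsf{sk})$ classical; $\mathsf{Enc}(\mathsf{pk},m)$ outputs a quantum ciphertext $|\mathsf{ct}\rangle$; $\mathsf{Dec}(\mathsf{sk},|\mathsf{ct}\rangle)$ outputs a message. Correctness: $\Pr[\mathsf{Dec}(\mathsf{sk},\mathsf{Enc}(\mathsf{pk},m))=m]\ge1-\mathrm{negl}(\lambda)$ for every $m$. Everlasting one-way security game: the challenger samples $(\mathsf{pk},\mathsf{sk})$, a uniformly random message $m$, and $|\mathsf{ct}\rangle\leftarrow\mathsf{Enc}(\mathsf{pk},m)$; $\mathcal{A}$ receives $(\mathsf{pk},|\mathsf{ct}\rangle)$ and outputs a classical string $\mathsf{st}$; $\mathcal{B}$, which may run in unbounded time, receives $(\mathsf{st},\mathsf{sk})$ and outputs $m_{\mathcal{B}}$; the adversary wins iff $m_{\mathcal{B}}=m$. Everlasting one-way security: for every efficient $\mathcal{A}$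 and unbounded $\mathcal{B}$ the winning probability is negligible. Falsifiable assumption. An interactive challenger $\mathcal{C}$ and a constant $c\in[0,1)$. On security parameter $\lambda$, $\mathcal{C}(1^\lambda)$ interacts with an algorithm $\mathcal{A}(1^\lambda)$ and may output a special symbol $\mathtt{win}$, in which case $\mathcal{A}(1^\lambda)$ wins. The assumption $(\mathcal{C},c)$ says that for all efficient (possibly non-uniform) $\mathcal{A}$ there is a negligible function with $\Pr[\mathcal{A}(1^\lambda)\text{ wins }\mathcal{C}(1^\lambda)]\le c+\mathrm{negl}(\lambda)$ for all $\lambda$. A (possibly inefficient) algorithm breaks the assumption if its winning probability exceeds this bound. The purified version of a quantum algorithm $\mathcal{A}$ is denoted by the unitary $U_{\mathcal{A}}$. Black-box proof (reduction) of everlasting security of a UTPKE scheme based on $(\mathcal{C},c)$: an efficient oracle algorithm $\mathcal{R}^{(\cdot)}$ such that for every (possibly inefficient) adversary $(\mathcal{A},\mathcal{B})$ winning the everlasting UTPKE security game with non-negligible advantage, $\mathcal{R}^{U_{\mathcal{A}}}$ breaks the assumption. On a query given by an input state $|\psi\rangle=(\mathsf{pk},|\mathsf{ct}\rangle)$ (with the security parameter $1^\kappa$ of the query), the response is the output register of $U_{\mathcal{A}}|\psi\rangle$. No oracle access to $U_{\mathcal{A}}^\dagger$ is given, and no oracle access to $\mathcal{B}$ is given. *)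

(* Defs.v *)
From mathcomp Require Import all_boot all_order all_algebra.
From mathcomp Require Import complex.
From mathcomp Require Import all_classical all_reals all_analysis.

Set Implicit Arguments.
Unset Strict Implicit.
Unset Printing Implicit Defensive.

Import Order.TTheory GRing.Theory Num.Theory.

Local Open Scope ring_scope.
Local Open Scope sesquilinear_scope.

Definition negligible (R : realType) (nu : nat -> R) : Prop :=
  forall d : nat, \forall n \near \oo%classic, `|nu n| <= n%:R ^- d.

Definition poly_bounded (g : nat -> nat) : Prop :=
  exists k : nat, forall n : nat, (g n <= n ^ k + k)%N.

(* Deterministic, one tape that is infinite in both directions, alphabet
   {blank = None, 0, 1}; the head move is None (stay), Some false (left) or
   Some true (right). *)
Record turing_machine := TuringMachine {
  tm_state : finType;
  tm_start : tm_state;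
  tm_halt : pred tm_state;
  tm_delta : tm_state -> option bool -> tm_state * option bool * option bool }.

(* (state, tape left of the head in reverse order, tape from the head on);
   cells outside of the two lists are blank. *)
Definition tm_conf (M : turing_machine) : Type :=
  (tm_state M * seq (option bool) * seq (option bool))%type.

Definition tm_step (M : turing_machine) (c : tm_conf M) : tm_conf M :=
  let: (q, l, r) := c in
  if tm_halt q then c else
  let: (q', a, mv) := tm_delta q (head None r) in
  match mv with
  | None => (q', l, a :: behead r)
  | Some false => (q', behead l, head None l :: a :: behead r)
  | Some true => (q', a :: l, behead r)
  end.

Definition tm_init (M : turing_machine) (x : seq bool) : tm_conf M :=
  (tm_start M, [::], map Some x).

(* The output is the maximal blank-free word starting at the head. *)
Definition tm_output (M : turing_machine) (c : tm_conf M) : seq bool :=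
  let: (_, _, r) := c in pmap id (take (index None r) r).

Definition poly_time (f : seq bool -> seq bool) : Prop :=
  exists M : turing_machine, exists2 p : nat -> nat, poly_bounded p &
  forall x : seq bool,
    let c := iter (p (size x)) (@tm_step M) (tm_init M x) in
    tm_halt c.1.1 /\ tm_output c = f x.

Definition encode_nats (s : seq nat) : seq bool :=
  flatten [seq rcons (nseq n true) false | n <- s].

(* [F] is computed by a polynomial-time machine on input 1^lambda. *)
Definition uniform_poly_time (F : nat -> seq nat) : Prop :=
  exists2 f : seq bool -> seq bool, poly_time f &
    forall lambda : nat, f (nseq lambda true) = encode_nats (F lambda).

Definition bits (n : nat) := n.-tuple bool.

(* The first [n] bits of [s], completed with zeros when [s] is too short. *)
Definition pad (n : nat) (s : seq bool) : bits n :=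
  [tuple nth false s i | i < n].

(* Linear maps from k qubits to m qubits, in the computational basis. *)
Notation op R m k := 'M[R[i]]_(#|{: bits m}|, #|{: bits k}|).

Definition opmx (R : realType) (m k : nat) (f : bits m -> bits k -> R[i]) :
  op R m k := \matrix_(i, j) f (enum_val i) (enum_val j).

Definition ent (R : realType) (m k : nat) (A : op R m k)
  (y : bits m) (x : bits k) : R[i] := A (enum_rank y) (enum_rank x).

(* Probability of the outcome [y] when all the qubits of the state [rho] are
   measured in the computational basis. *)
Definition outcome (R : realType) (m : nat) (rho : op R m m) (y : bits m) : R :=
  complex.Re (ent rho y y).

(* Quantum channels, by Kraus operators. *)
Definition is_channel (R : realType) (n : nat) (Ks : seq (op R n n)) : Prop :=
  \sum_(K <- Ks) K^t* *m K = 1%:M.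

Definition app_channel (R : realType) (n : nat) (Ks : seq (op R n n))
  (rho : op R n n) : op R n n := \sum_(K <- Ks) K *m rho *m K^t*.

(* [A] acting on the wires [ws] of an n-qubit register. *)
Definition lift_op (R : realType) (n : nat) (ws : seq nat) (k : nat)
  (A : op R k k) : op R n n :=
  let sel (x : bits n) := pad k [seq nth false x w | w <- ws] in
  opmx (fun y x : bits n =>
    if [forall i : 'I_n, (val i \in ws) || (tnth y i == tnth x i)]
    then ent A (sel y) (sel x) else 0).

Definition wires_ok (n : nat) (ws : seq nat) : bool :=
  uniq ws && all (fun w => w < n)%N ws.

(* Purified algorithms.
   A unitary on n qubits is run on a classical string [pre], followed by a
   k-qubit quantum input and by ancillas in state 0; its output register is
   made of the first m qubits, and the other qubits are discarded. *)

(* The component where the discarded qubits are found in state [e]. *)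
Definition kraus (R : realType) (n m k : nat) (U : op R n n) (pre : seq bool)
  (e : bits (n - m)) : op R m k :=
  opmx (fun (y : bits m) (x : bits k) =>
    ent U (pad n (y ++ e)) (pad n (pre ++ x))).

Definition run_on (R : realType) (n k : nat) (m : nat) (U : op R n n)
  (pre : seq bool) (rho : op R k k) : op R m m :=
  \sum_(e : bits (n - m))
     kraus k U pre e *m rho *m (kraus k U pre e)^t*.

Definition run_classical (R : realType) (n : nat) (m : nat) (U : op R n n)
  (pre : seq bool) : op R m m := run_on m U pre (1%:M : op R 0 0).

Inductive gate : Type :=
| Hgate of nat
| Tgate of nat
| CNOTgate of nat & nat
| CCNOTgate of nat & nat & nat.

Definition gate_wires (g : gate) : seq nat :=
  match g with
  | Hgate i => [:: i]
  | Tgate i => [:: i]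
  | CNOTgate i j => [:: i; j]
  | CCNOTgate i j k => [:: i; j; k]
  end.

Definition b0 (n : nat) (x : bits n) : bool := nth false x 0.
Definition b1 (n : nat) (x : bits n) : bool := nth false x 1.
Definition b2 (n : nat) (x : bits n) : bool := nth false x 2.

Definition Hmx (R : realType) : op R 1 1 :=
  opmx (fun y x => (Num.sqrt 2%:R)^-1%:C%C * (-1) ^+ (b0 y && b0 x)).

Definition Tmx (R : realType) : op R 1 1 :=
  opmx (fun y x => if y != x then 0
    else if b0 x then (Num.sqrt 2%:R)^-1%:C%C * (1 +i* 1)%C else 1).

Definition CNOTmx (R : realType) : op R 2 2 :=
  opmx (fun y x : bits 2 => ((y : seq bool) == [:: b0 x; b0 x (+) b1 x])%:R).

Definition CCNOTmx (R : realType) : op R 3 3 :=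
  opmx (fun y x : bits 3 =>
    ((y : seq bool) == [:: b0 x; b1 x; (b0 x && b1 x) (+) b2 x])%:R).

Definition gate_mx (R : realType) (n : nat) (g : gate) : op R n n :=
  let ws := gate_wires g in
  match g with
  | Hgate _ => lift_op n ws (Hmx R)
  | Tgate _ => lift_op n ws (Tmx R)
  | CNOTgate _ _ => lift_op n ws (CNOTmx R)
  | CCNOTgate _ _ _ => lift_op n ws (CCNOTmx R)
  end.

Record circuit := Circuit { c_width : nat; c_gates : seq gate }.

Definition circuit_mx (R : realType) (c : circuit) :
  op R (c_width c) (c_width c) :=
  foldl (fun U g => gate_mx R (c_width c) g *m U) 1%:M (c_gates c).

(* [a] is the length of the input register, [b] that of the output one. *)
Definition circuit_ok (a b : nat) (c : circuit) : bool :=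
  [&& (a <= c_width c)%N, (b <= c_width c)%N
    & all (fun g => wires_ok (c_width c) (gate_wires g)) (c_gates c)].

Definition encode_gate (g : gate) : seq nat :=
  (match g with
   | Hgate _ => 0 | Tgate _ => 1 | CNOTgate _ _ => 2 | CCNOTgate _ _ _ => 3
   end)%N :: gate_wires g.

Definition encode_circuit (c : circuit) : seq nat :=
  c_width c :: flatten (map encode_gate (c_gates c)).

(* A non-uniform adversary consists, for every lambda and every length l of
   the challenge f(x), of a circuit and of the length of its output. *)
Definition inverter : Type := nat -> nat -> circuit * nat.

Definition invert_prob (R : realType) (f : seq bool -> seq bool)
  (A : inverter) (lambda : nat) : R :=
  \sum_(x : bits lambda) 2%:R ^- lambda *
    (let: (c, o) := A lambda (size (f x)) in
     \sum_(x' : bits o | f x' == f x)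
       outcome (run_classical o (circuit_mx R c) (f x)) x').

Definition pq_one_way (R : realType) (delta : R) (f : seq bool -> seq bool) :
  Prop :=
  poly_time f /\
  forall A : inverter,
    (forall lambda l : nat,
       circuit_ok l (A lambda l).2 (A lambda l).1 /\
       (size (c_gates (A lambda l).1))%:R <= 2%:R `^ (lambda%:R `^ delta)) ->
    negligible (invert_prob R f A).

Definition pq_owf_exist (R : realType) (delta : R) : Prop :=
  exists f : seq bool -> seq bool, pq_one_way delta f.

(* gen: 1^lambda |-> pk ++ sk;  enc: pk ++ m |-> ct;  dec: sk ++ ct |-> m. *)
Record utpke := UTPKE {
  pk_len : nat -> nat;
  sk_len : nat -> nat;
  msg_len : nat -> nat;
  ct_len : nat -> nat;
  gen : nat -> circuit;
  enc : nat -> circuit;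
  dec : nat -> circuit }.

Definition utpke_qpt (S : utpke) : Prop :=
  (forall l : nat,
    [/\ circuit_ok 0 (pk_len S l + sk_len S l) (gen S l),
        circuit_ok (pk_len S l + msg_len S l) (ct_len S l) (enc S l)
      & circuit_ok (sk_len S l + ct_len S l) (msg_len S l) (dec S l)]) /\
  [/\ uniform_poly_time (fun l =>
        [:: pk_len S l, sk_len S l & encode_circuit (gen S l)]),
      uniform_poly_time (fun l =>
        [:: pk_len S l, msg_len S l, ct_len S l & encode_circuit (enc S l)])
    & uniform_poly_time (fun l =>
        [:: sk_len S l, ct_len S l, msg_len S l & encode_circuit (dec S l)])].

Definition gen_prob (R : realType) (S : utpke) (l : nat)
  (pk : bits (pk_len S l)) (sk : bits (sk_len S l)) : R :=
  outcome (run_classical (pk_len S l + sk_len S l) (circuit_mx R (gen S l))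
             [::])
    [tuple of pk ++ sk].

Definition enc_state (R : realType) (S : utpke) (l : nat)
  (pk : bits (pk_len S l)) (m : bits (msg_len S l)) :
  op R (ct_len S l) (ct_len S l) :=
  run_classical (ct_len S l) (circuit_mx R (enc S l)) (pk ++ m).

Definition dec_prob (R : realType) (S : utpke) (l : nat)
  (sk : bits (sk_len S l)) (ct : op R (ct_len S l) (ct_len S l))
  (m : bits (msg_len S l)) : R :=
  outcome (run_on (msg_len S l) (circuit_mx R (dec S l)) sk ct) m.

Definition utpke_correct (R : realType) (S : utpke) : Prop :=
  exists2 nu : nat -> R, negligible nu &
  forall (l : nat) (m : bits (msg_len S l)),
    1 - nu l <=
    \sum_(pk : bits (pk_len S l)) \sum_(sk : bits (sk_len S l))
      gen_prob R pk sk * dec_prob sk (enc_state R pk m) m.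

(* A possibly inefficient first-stage adversary, in purified form: on input
   (pk, ct) the unitary [adv_U k] is applied to pk, ct and zero ancillas, and
   st is read off the first [st_len k] qubits. *)
Record adversaryA (R : realType) (S : utpke) := AdversaryA {
  st_len : nat -> nat;
  adv_width : nat -> nat;
  adv_U : forall k : nat, op R (adv_width k) (adv_width k);
  adv_unitary : forall k : nat, adv_U k \is unitarymx;
  adv_in : forall k : nat, (pk_len S k + ct_len S k <= adv_width k)%N;
  adv_out : forall k : nat, (st_len k <= adv_width k)%N }.

(* An unbounded second-stage adversary: [advB_prob st sk m] is the probability
   of the output [m] on input (st, sk). *)
Record adversaryB (R : realType) (S : utpke) (st_len : nat -> nat) :=
  AdversaryB {
  advB_prob : forall k : nat,
    bits (st_len k) -> bits (sk_len S k) -> bits (msg_len S k) -> R;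
  advB_ge0 : forall k st sk m, 0 <= @advB_prob k st sk m;
  advB_sum1 : forall k st sk, \sum_m @advB_prob k st sk m = 1 }.

Definition everlasting_ow_prob (R : realType) (S : utpke)
  (A : adversaryA R S) (B : adversaryB R S (st_len A)) (k : nat) : R :=
  \sum_(pk : bits (pk_len S k)) \sum_(sk : bits (sk_len S k))
  \sum_(m : bits (msg_len S k)) \sum_(st : bits (st_len A k))
    gen_prob R pk sk * 2%:R ^- msg_len S k *
    outcome (run_on (st_len A k) (adv_U A k) pk (enc_state R pk m)) st *
    advB_prob B st sk m.

(* [Send] hands the message register over to the challenger, which acts on it
   and gives it back.  [Query k ws] calls the oracle at security parameter 1^k
   on the wires [ws]. *)
Inductive instr : Type :=
| Gate of gate
| Send
| Query of nat & seq nat.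

Record algo := Algo { a_width : nat; a_code : seq instr }.

Definition instr_cost (c : instr) : nat :=
  match c with
  | Gate _ => 1
  | Send => 1
  | Query k ws => (k + size ws).+1
  end.

Definition algo_size (A : algo) : nat :=
  \sum_(c <- a_code A) instr_cost c.

(* The message register is made of the first [msg] wires; [ar k] is the number
   of wires of the oracle at security parameter k. *)
Definition algo_ok (msg : nat) (ar : nat -> nat) (A : algo) : bool :=
  (msg <= a_width A)%N &&
  all (fun c => match c with
       | Gate g => wires_ok (a_width A) (gate_wires g)
       | Send => true
       | Query k ws => (size ws == ar k) && wires_ok (a_width A) ws
       end) (a_code A).

Definition oracle_free (A : algo) : bool :=
  all (fun c => if c is Query _ _ then false else true) (a_code A).

(* On security parameter l the challenger has [ch_msg l] message qubits and
   [ch_priv l] private ones; [ch_act l i] is the channel it applies to both the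
   (i+1)-st time that it is activated.  At the end of the interaction its
   private register is measured, and [ch_win l] says which outcomes stand for
   the symbol win. *)
Record challenger (R : realType) := Challenger {
  ch_msg : nat -> nat;
  ch_priv : nat -> nat;
  ch_act : forall l : nat, nat ->
    seq (op R (ch_msg l + ch_priv l) (ch_msg l + ch_priv l));
  ch_channel : forall l i : nat, is_channel (ch_act l i);
  ch_win : forall l : nat, pred (bits (ch_priv l)) }.

Definition oracle (R : realType) (ar : nat -> nat) : Type :=
  forall k : nat, seq (op R (ar k) (ar k)).

(* Global states (qubits of the algorithm, then private qubits of the
   challenger), with the number of past activations of the challenger. *)
Definition exec_instr (R : realType) (Ch : challenger R) (l : nat)
  (ar : nat -> nat) (O : oracle R ar) (N : nat)
  (s : op R (N + ch_priv Ch l) (N + ch_priv Ch l) * nat) (c : instr) :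
  op R (N + ch_priv Ch l) (N + ch_priv Ch l) * nat :=
  let n := (N + ch_priv Ch l)%N in
  match c with
  | Gate g => (app_channel [:: gate_mx R n g] s.1, s.2)
  | Send =>
      let ws := iota 0 (ch_msg Ch l) ++ iota N (ch_priv Ch l) in
      (app_channel [seq lift_op n ws K | K <- ch_act Ch l s.2] s.1, s.2.+1)
  | Query k ws => (app_channel [seq lift_op n ws K | K <- O k] s.1, s.2)
  end.

Definition win_prob (R : realType) (Ch : challenger R) (ar : nat -> nat)
  (O : oracle R ar) (l : nat) (A : algo) : R :=
  let N := a_width A in
  let n := (N + ch_priv Ch l)%N in
  let rho0 : op R n n :=
    opmx (fun y x => ((y == pad n [::]) && (x == pad n [::]))%:R) in
  let rho := (foldl (exec_instr O (N := N)) (rho0, 0) (a_code A)).1 in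
  \sum_(x : bits n | ch_win (pad (ch_priv Ch l) (drop N x))) outcome rho x.

Definition within_bound (R : realType) (c : R) (p : nat -> R) : Prop :=
  exists2 nu : nat -> R, negligible nu & forall l : nat, p l <= c + nu l.

Definition no_oracle (R : realType) : oracle R (fun=> 0) := fun=> [::].

Definition assumption_holds (R : realType) (Ch : challenger R) (c : R) : Prop :=
  forall A : nat -> algo,
    (forall l : nat, algo_ok (ch_msg Ch l) (fun=> 0) (A l) && oracle_free (A l)) ->
    poly_bounded (fun l => algo_size (A l)) ->
    within_bound c (fun l => win_prob Ch (no_oracle R) l (A l)).

(* The oracle wires are an input register for (pk, ct) followed by a response
   register of [st_len A k] qubits. *)
Definition oracle_arity (S : utpke) (st : nat -> nat) (k : nat) : nat :=
  (pk_len S k + ct_len S k + st k)%N.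

(* The oracle consumes its input register (which is reset to 0), and replaces
   the content of the response register (which is discarded, with value [g] in
   the Kraus operator below) by the output register of U_A, which is not
   measured.  The other qubits of U_A (with value [e]) are never given back. *)
Definition purified_oracle (R : realType) (S : utpke) (A : adversaryA R S) :
  oracle R (oracle_arity S (st_len A)) :=
  fun k =>
  let a := (pk_len S k + ct_len S k)%N in
  let s := st_len A k in
  [seq opmx (fun y x =>
     if (take a y == nseq a false) && (drop a x == ge.1 :> seq bool)
     then ent (kraus a (adv_U A k) [::] ge.2) (pad s (drop a y)) (pad a x)
     else 0) | ge : bits s * bits (adv_width A k - s)].

(* A non-uniform oracle algorithm.  Its program at security parameter l may
   depend on the format of the oracle, that is, on the lengths of its
   responses. *)
Definition reduction : Type := (nat -> nat) -> nat -> algo.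

Definition efficient_reduction (R : realType) (S : utpke) (Ch : challenger R)
  (Red : reduction) : Prop :=
  forall st : nat -> nat,
    (forall l : nat, algo_ok (ch_msg Ch l) (oracle_arity S st) (Red st l)) /\
    (poly_bounded st -> poly_bounded (fun l => algo_size (Red st l))).

Definition black_box_proof (R : realType) (S : utpke) (Ch : challenger R)
  (c : R) (Red : reduction) : Prop :=
  efficient_reduction S Ch Red /\
  forall (A : adversaryA R S) (B : adversaryB R S (st_len A)),
    ~ negligible (everlasting_ow_prob B) ->
    ~ within_bound c
        (fun l => win_prob Ch (purified_oracle A) l (Red (st_len A) l)).

(* Main.v *)
Require Import Defs.
From mathcomp Require Import all_boot all_order all_algebra.
From mathcomp Require Import complex.
From mathcomp Require Import all_classical all_reals all_analysis.
From mathcomp Require Import zify ring lra.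

(** A first-stage adversary need not be efficient, so it can hold, for every
    [kappa], a table of the best secret key for each public key and a secret
    function F_kappa.  It decrypts the ciphertext to m and outputs
    (r, m + F_kappa(r)) for a random string r of kappa * w(kappa) bits; the
    second stage, which knows F_kappa, recovers m.  A polynomial number of
    queries cannot tell this from a uniformly random output: F_kappa is a
    tabulation hash (the XOR of kappa table lookups, indexed by the blocks of
    w(kappa) bits of r), so the masks of q random strings are jointly uniform
    unless some string shares each of its blocks with another one, which has
    probability at most q (q / 2^w)^kappa.  Two independent executions give the
    second moment of the distinguishing advantage over the tables; by Chebyshev
    and a union bound, one choice of tables is good for all the finitely many
    security parameters [l] of the reduction with l^K < 2^w(kappa).  The tables
    are chosen recursively in [kappa].  When 2^w(kappa) <= l^K, the adversary
    with its tables is a circuit of size polynomial in [l].  Hence the reduction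
    wins with nearly the same probability without any oracle, and a black-box
    proof makes the assumption false.  The tables replace the pseudorandom
    functions that one-way functions would give. *)

(** A plain random table would not do. The oracle-free algorithm must carry the tables of the
    parameters with 2^w <= l^K, and the error at all others must be negligible in l. One table on w
    bits has about 2^w entries and a collision error of about q^2 / 2^w: both are then powers of l,
    whatever the threshold. With kappa blocks there are kappa 2^w entries, while the error decays
    like 2^(-w kappa) up to lower order factors, and past the threshold kappa tends to infinity with
    l.

    The choice of the tables is not circular: the program of the reduction depends on the oracle
    only through the response lengths, which are fixed before any table. The hybrids treat the
    parameters in increasing order, so the tables at kappa are chosen against tables already fixed
    below kappa and uniform answers from kappa on.

    Queries are quantum and responses are not measured by the oracle. The adversary therefore copies
    its output onto qubits that it never returns. This makes its channel a mixture of fixed channels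
    indexed by r and by the mask, so that counting tuples of keys applies to queries in
    superposition. *)

Set Implicit Arguments.
Unset Strict Implicit.
Unset Printing Implicit Defensive.

Import Order.TTheory GRing.Theory Num.Theory.
Local Open Scope ring_scope.
Local Open Scope sesquilinear_scope.

(** * Bit strings and wires *)

Lemma nth_pad n s i : nth false (pad n s) i = (i < n)%N && nth false s i.
Proof.
case: ltnP => h; last by rewrite nth_default // size_tuple.
by rewrite -[i in LHS]/(val (Ordinal h)) -tnth_nth tnth_mktuple.
Qed.

Lemma bits_eqP n (x y : bits n) :
  (forall i, (i < n)%N -> nth false x i = nth false y i) -> x = y.
Proof. by move=> h; apply: eq_from_tnth => i; rewrite !(tnth_nth false) h. Qed.

Lemma nth_bits_ge n (x : bits n) i : (n <= i)%N -> nth false x i = false.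
Proof. by move=> h; rewrite nth_default // size_tuple. Qed.

Lemma size_take_tuple m k T (x : (m + k).-tuple T) : size (take m x) = m.
Proof. by rewrite size_takel // size_tuple leq_addr. Qed.

Lemma size_drop_tuple m k T (x : (m + k).-tuple T) : size (drop m x) = k.
Proof. by rewrite size_drop size_tuple addKn. Qed.

(** [sel] and [agree] are the two ingredients of the body of [lift_op], so [ent_lift] holds by
    unfolding. Together with [put] they split a basis state into its content on [ws] and the
    rest. *)
Definition sel n (ws : seq nat) k (x : bits n) : bits k :=
  pad k [seq nth false x w | w <- ws].

Definition agree n (ws : seq nat) (y x : bits n) : bool :=
  [forall i : 'I_n, (val i \in ws) || (tnth y i == tnth x i)].

Definition put n (ws : seq nat) (x : bits n) k (u : bits k) : bits n :=
  [tuple if val i \in ws then nth false u (index (val i) ws) else tnth x i | i < n].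

Lemma agreeP n ws (y x : bits n) :
  reflect (forall i, i \notin ws -> nth false y i = nth false x i) (agree ws y x).
Proof.
apply: (iffP forallP) => h i.
  move=> iw; case: (ltnP i n) => hi; last by rewrite !nth_bits_ge.
  have := h (Ordinal hi); rewrite /= (negbTE iw) /= => /eqP.
  by rewrite !(tnth_nth false).
apply/orP; case: (boolP (val i \in ws)) => iw; [by left|right].
by rewrite !(tnth_nth false) h.
Qed.

Lemma nth_put n ws (x : bits n) k (u : bits k) i :
  nth false (put ws x u) i =
  (i < n)%N && (if i \in ws then nth false u (index i ws) else nth false x i).
Proof.
case: ltnP => h; last by rewrite nth_bits_ge.
by rewrite -[i in LHS]/(val (Ordinal h)) -tnth_nth tnth_mktuple (tnth_nth false).
Qed.

Lemma nth_sel n ws k (x : bits n) i : size ws = k ->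
  nth false (sel ws k x) i = (i < k)%N && nth false x (nth 0%N ws i).
Proof.
by move=> sz; rewrite nth_pad; case: ltnP => //= h; rewrite (nth_map 0%N) ?sz.
Qed.

Lemma wires_lt n ws w : wires_ok n ws -> w \in ws -> (w < n)%N.
Proof. by case/andP => _ /allP h /h. Qed.

Lemma wires_uniq n ws : wires_ok n ws -> uniq ws.
Proof. by case/andP. Qed.

Section SelPut.
Variables (n : nat) (ws : seq nat) (k : nat).
Hypotheses (ok : wires_ok n ws) (sz : size ws = k).

Lemma sel_put (x : bits n) (u : bits k) : sel ws k (put ws x u) = u.
Proof.
apply: bits_eqP => i hi; rewrite nth_sel // hi /= nth_put.
rewrite (wires_lt ok) ?mem_nth ?sz //=.
by rewrite index_uniq ?sz ?(wires_uniq ok).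
Qed.

Lemma put_sel (x : bits n) : put ws x (sel ws k x) = x.
Proof.
apply: bits_eqP => i hi; rewrite nth_put hi /=; case: ifP => // iw.
by rewrite nth_sel // -sz index_mem iw /= nth_index.
Qed.

Lemma put_put (x : bits n) (u v : bits k) : put ws (put ws x u) v = put ws x v.
Proof.
by apply: bits_eqP => i hi; rewrite !nth_put hi /=; case: (i \in ws).
Qed.

Lemma agree_put (x : bits n) (u : bits k) : agree ws (put ws x u) x.
Proof.
apply/agreeP => i iw; rewrite nth_put (negbTE iw).
by case: ltnP => //= h; rewrite nth_bits_ge.
Qed.

Lemma agree_refl (x : bits n) : agree ws x x.
Proof. by apply/agreeP. Qed.

Lemma agree_sym (x y : bits n) : agree ws x y = agree ws y x.
Proof. by apply/agreeP/agreeP => h i iw; rewrite h. Qed.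

Lemma agree_trans (y x z : bits n) : agree ws x y -> agree ws y z -> agree ws x z.
Proof. by move=> /agreeP h1 /agreeP h2; apply/agreeP => i iw; rewrite h1 ?h2. Qed.

Lemma agree_putE (y x : bits n) : agree ws y x -> put ws x (sel ws k y) = y.
Proof.
move=> /agreeP h; apply: bits_eqP => i hi; rewrite nth_put hi /=.
case: ifP => iw; last by rewrite h ?iw.
by rewrite nth_sel // -sz index_mem iw /= nth_index.
Qed.

Lemma agree_sel_eq (y x : bits n) : agree ws y x -> sel ws k y = sel ws k x -> y = x.
Proof. by move=> /agree_putE e s; rewrite -e s put_sel. Qed.

Lemma sum_agree (V : nmodType) (x : bits n) (f : bits n -> V) :
  \sum_(y | agree ws y x) f y = \sum_(u : bits k) f (put ws x u).
Proof.
rewrite (reindex_onto (fun u : bits k => put ws x u) (sel ws k)) /=.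
  by apply: eq_bigl => u; rewrite agree_put sel_put eqxx.
by move=> y /agree_putE.
Qed.

(** Overwriting [ws] is a bijection between two fibres of [sel]. This re-indexes a partial trace
    when the content of the kept wires changes. *)
Lemma sum_sel (V : nmodType) (f : bits n -> V) (u v : bits k) :
  \sum_(z | sel ws k z == u) f z =
  \sum_(z | sel ws k z == v) f (put ws z u).
Proof.
rewrite (reindex_onto (fun z : bits n => put ws z u) (fun z => put ws z v)) /=.
  apply: eq_bigl => z; rewrite sel_put eqxx /= put_put.
  by apply/eqP/eqP => [<-|<-]; rewrite ?sel_put // put_sel.
by move=> z /eqP <-; rewrite put_put put_sel.
Qed.

End SelPut.

Lemma sel_comp n ws k vs j (x : bits n) : size ws = k -> size vs = j ->
  all (fun v => (v < k)%N) vs ->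
  sel vs j (sel ws k x) = sel [seq nth 0%N ws v | v <- vs] j x.
Proof.
move=> sw sv /allP vk; apply: bits_eqP => i hi.
rewrite !nth_sel ?size_map // hi /= (nth_map 0%N) ?sv //.
by rewrite vk // mem_nth ?sv.
Qed.

Lemma wires_ok_comp n ws k vs : wires_ok n ws -> size ws = k -> wires_ok k vs ->
  wires_ok n [seq nth 0%N ws v | v <- vs].
Proof.
move=> ow sw ov; apply/andP; split.
  rewrite map_inj_in_uniq ?(wires_uniq ov) // => i j /(wires_lt ov) hi /(wires_lt ov) hj.
  by move/eqP; rewrite nth_uniq ?sw ?(wires_uniq ow) // => /eqP.
apply/allP => w /mapP[v vv ->].
by apply: (wires_lt ow); rewrite mem_nth // sw (wires_lt ov).
Qed.

Lemma agree_comp n ws k vs (y x : bits n) : wires_ok n ws -> size ws = k ->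
  wires_ok k vs ->
  agree [seq nth 0%N ws v | v <- vs] y x =
  agree ws y x && agree vs (sel ws k y) (sel ws k x).
Proof.
move=> ow sw ov; apply/agreeP/andP => [h|[/agreeP h1 /agreeP h2] i iv].
  split; apply/agreeP => i iw.
    apply: h; apply: contraNN iw => /mapP[v vv ->].
    by rewrite mem_nth // sw (wires_lt ov).
  rewrite !nth_sel //; case: ltnP => //= ik; apply: h.
  apply: contraNN iw => /mapP[v vv].
  move/eqP; rewrite nth_uniq ?sw ?(wires_uniq ow) ?(wires_lt ov vv) //.
  by move/eqP ->.
case: (boolP (i \in ws)) => iw; last exact: h1.
have ik : (index i ws < k)%N by rewrite -sw index_mem.
have := h2 (index i ws); rewrite !nth_sel // ik /= nth_index //; apply.
by apply: contraNN iv => hv; apply/mapP; exists (index i ws); rewrite ?nth_index.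
Qed.

(** * Entries of operators *)

Section Entries.
Variable R : realType.
Implicit Types (m k n : nat).
Local Notation C := R[i].

Lemma Re_sum (I : Type) (r : seq I) (P : pred I) (F : I -> C) :
  complex.Re (\sum_(i <- r | P i) F i) = \sum_(i <- r | P i) complex.Re (F i).
Proof.
by rewrite (big_morph (@complex.Re R) (id1 := 0) (op1 := +%R)) // => [[? ?] [? ?]].
Qed.

Lemma Re_natVM n (z : C) : complex.Re (n%:R^-1 * z) = n%:R^-1 * complex.Re z.
Proof.
have -> : (n%:R^-1 : C) = (n%:R^-1 : R)%:C%C by rewrite fmorphV rmorph_nat.
by case: z => u v; rewrite /= mul0r subr0.
Qed.

Lemma ent_opmx m k (f : bits m -> bits k -> C) y x : ent (opmx f) y x = f y x.
Proof. by rewrite /ent mxE !enum_rankK. Qed.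

Lemma ent_eqP m k (A B : op R m k) : (forall y x, ent A y x = ent B y x) -> A = B.
Proof.
move=> h; apply/matrixP => i j.
by have := h (enum_val i) (enum_val j); rewrite /ent !enum_valK.
Qed.

Lemma ent_mul m k n (A : op R m k) (B : op R k n) y x :
  ent (A *m B) y x = \sum_(z : bits k) ent A y z * ent B z x.
Proof.
rewrite /ent mxE (reindex (@enum_rank _)) //=.
by exists enum_val => i _; rewrite ?enum_rankK ?enum_valK.
Qed.

Lemma ent1 n (y x : bits n) : ent (1%:M : op R n n) y x = (y == x)%:R.
Proof. by rewrite /ent mxE (inj_eq enum_rank_inj). Qed.

Lemma ent_adj m k (A : op R m k) y x : ent (A^t*) y x = (ent A x y)^*.
Proof. by rewrite /ent !mxE. Qed.

Lemma ent_sum m k (I : Type) (r : seq I) (P : pred I) (F : I -> op R m k) y x :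
  ent (\sum_(i <- r | P i) F i) y x = \sum_(i <- r | P i) ent (F i) y x.
Proof. by rewrite /ent summxE. Qed.

(** The Choi matrix: it determines the channel and forgets the choice of Kraus operators
    ([ent_channel]). All comparisons of oracles below go through it. *)
Definition choi n (Ks : seq (op R n n)) (y x y' x' : bits n) : C :=
  \sum_(K <- Ks) ent K y x * (ent K y' x')^*.

Lemma ent_channel n (Ks : seq (op R n n)) (rho : op R n n) y y' :
  ent (app_channel Ks rho) y y' =
  \sum_(x : bits n) \sum_(x' : bits n) choi Ks y x y' x' * ent rho x x'.
Proof.
rewrite /app_channel ent_sum.
under eq_bigr => K _.
  rewrite ent_mul.
  under eq_bigr => z _ do rewrite ent_mul ent_adj mulr_suml.
  rewrite exchange_big /=.
  over.
rewrite exchange_big /=; apply: eq_bigr => x _.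
rewrite exchange_big /=; apply: eq_bigr => x' _.
rewrite /choi mulr_suml; apply: eq_bigr => K _.
by rewrite mulrAC.
Qed.

Lemma is_channelP n (Ks : seq (op R n n)) :
  is_channel Ks <-> forall x x', \sum_(y : bits n) choi Ks y x y x' = (x == x')%:R.
Proof.
have e x x' : ent (\sum_(K <- Ks) K^t* *m K) x' x = \sum_(y : bits n) choi Ks y x y x'.
  rewrite ent_sum exchange_big /=; apply: eq_bigr => K _.
  by rewrite ent_mul; apply: eq_bigr => z _; rewrite ent_adj mulrC.
split=> [h x x'|h]; first by rewrite -e h ent1 eq_sym.
by apply: ent_eqP => y x; rewrite e h ent1 eq_sym.
Qed.

Lemma ent_lift n ws k (A : op R k k) (y x : bits n) :
  ent (lift_op n ws A) y x =
  if agree ws y x then ent A (sel ws k y) (sel ws k x) else 0.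
Proof. by rewrite ent_opmx. Qed.

Section Lift.
Variables (n : nat) (ws : seq nat) (k : nat).
Hypotheses (ok : wires_ok n ws) (sz : size ws = k).

Lemma lift_mul (A B : op R k k) : lift_op n ws (A *m B) = lift_op n ws A *m lift_op n ws B.
Proof.
apply: ent_eqP => y x; rewrite ent_mul ent_lift.
under eq_bigr => z _ do rewrite !ent_lift.
case: ifP => yx; last first.
  rewrite big1 // => z _; case: ifP => yz; rewrite ?mul0r //.
  by case: ifP => zx; [rewrite (agree_trans yz zx) in yx|rewrite mulr0].
transitivity (\sum_(z | agree ws z x) ent A (sel ws k y) (sel ws k z) *
    ent B (sel ws k z) (sel ws k x)).
  rewrite (sum_agree ok sz) ent_mul.
  by apply: eq_bigr => u _; rewrite !sel_put.
rewrite big_mkcond /=; apply: eq_bigr => z _.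
case: ifP => zx; last by rewrite mulr0.
by rewrite (agree_trans yx) // agree_sym.
Qed.

Lemma lift_adj (A : op R k k) : (lift_op n ws A)^t* = lift_op n ws (A^t*).
Proof.
apply: ent_eqP => y x; rewrite ent_adj !ent_lift agree_sym ent_adj.
by case: ifP => //; rewrite conjC0.
Qed.

Lemma lift_1 : lift_op n ws (1%:M : op R k k) = 1%:M.
Proof.
apply: ent_eqP => y x; rewrite ent_lift !ent1.
case: ifP => h; last by case: eqP => // e; rewrite e agree_refl in h.
congr (_%:R); congr nat_of_bool.
by apply/eqP/eqP => [|->//]; exact: agree_sel_eq.
Qed.

Lemma lift_sum (I : Type) (r : seq I) (P : pred I) (F : I -> op R k k) :
  lift_op n ws (\sum_(i <- r | P i) F i) = \sum_(i <- r | P i) lift_op n ws (F i).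
Proof.
apply: ent_eqP => y x; rewrite ent_lift !ent_sum.
under [in RHS]eq_bigr => i _ do rewrite ent_lift.
by case: ifP => // _; rewrite big1.
Qed.

Lemma lift_channel (Ks : seq (op R k k)) : is_channel Ks ->
  is_channel [seq lift_op n ws K | K <- Ks].
Proof.
move=> h; rewrite /is_channel big_map -lift_1 -h lift_sum.
by apply: eq_bigr => K _; rewrite lift_adj lift_mul.
Qed.

Lemma lift_unitary (A : op R k k) : A \is unitarymx -> lift_op n ws A \is unitarymx.
Proof. by move/unitarymxP => h; apply/unitarymxP; rewrite lift_adj -lift_mul h lift_1. Qed.

Lemma lift_lift vs j (A : op R j j) : wires_ok k vs -> size vs = j ->
  lift_op n ws (lift_op k vs A) = lift_op n [seq nth 0%N ws v | v <- vs] A.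
Proof.
move=> ov sv; apply: ent_eqP => y x; rewrite !ent_lift (agree_comp _ _ ok sz ov).
have vk : all (fun v => v < k)%N vs by case/andP: ov.
by case: ifP => //= _; rewrite !(sel_comp _ sz sv).
Qed.

End Lift.

Lemma choi_lift n ws k (Ks : seq (op R k k)) (y x y' x' : bits n) :
  choi [seq lift_op n ws K | K <- Ks] y x y' x' =
  if agree ws y x && agree ws y' x'
  then choi Ks (sel ws k y) (sel ws k x) (sel ws k y') (sel ws k x') else 0.
Proof.
rewrite /choi big_map; under eq_bigr => K _ do rewrite !ent_lift.
case: ifP => [/andP[-> ->] //|].
by case: agree => //= h; rewrite ?h; rewrite big1 // => K _; rewrite ?mul0r // conjC0 mulr0.
Qed.

End Entries.

(** * Gates *)

Definition relabel (ws : seq nat) (g : gate) : gate :=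
  match g with
  | Hgate i => Hgate (nth 0%N ws i)
  | Tgate i => Tgate (nth 0%N ws i)
  | CNOTgate i j => CNOTgate (nth 0%N ws i) (nth 0%N ws j)
  | CCNOTgate i j k => CCNOTgate (nth 0%N ws i) (nth 0%N ws j) (nth 0%N ws k)
  end.

Definition gates_ok n (gs : seq gate) := all (fun g => wires_ok n (gate_wires g)) gs.

Lemma gate_wires_relabel ws g :
  gate_wires (relabel ws g) = [seq nth 0%N ws v | v <- gate_wires g].
Proof. by case: g. Qed.

Lemma gates_ok_relabel n ws k gs : wires_ok n ws -> size ws = k -> gates_ok k gs ->
  gates_ok n (map (relabel ws) gs).
Proof.
move=> ow sw; rewrite /gates_ok all_map; apply: sub_all => g og /=.
rewrite gate_wires_relabel; exact: wires_ok_comp og.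
Qed.

Definition is_classical (g : gate) : bool :=
  match g with CNOTgate _ _ | CCNOTgate _ _ _ => true | _ => false end.

(** Assignments are total on [nat], so that wire computations carry no width. The value on [Hgate]
    and [Tgate] is a placeholder: the link with matrices, [ent_classical], assumes
    [is_classical]. *)
Definition cfun (g : gate) (x : nat -> bool) : nat -> bool :=
  match g with
  | CNOTgate i j => fun w => if w == j then x i (+) x j else x w
  | CCNOTgate i j k => fun w => if w == k then (x i && x j) (+) x k else x w
  | _ => x
  end.

Definition cact (gs : seq gate) (x : nat -> bool) : nat -> bool :=
  foldl (fun x g => cfun g x) x gs.

Definition bact n (gs : seq gate) (x : bits n) : bits n :=
  [tuple cact gs (nth false x) i | i < n].

Arguments bact : simpl never.

Lemma cact_cat s1 s2 x : cact (s1 ++ s2) x = cact s2 (cact s1 x).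
Proof. by rewrite /cact foldl_cat. Qed.

Lemma cfun_ext g x x' : x =1 x' -> cfun g x =1 cfun g x'.
Proof. by move=> e; case: g => //= *; move=> w; rewrite !e. Qed.

Lemma cact_ext gs x x' : x =1 x' -> cact gs x =1 cact gs x'.
Proof.
by elim: gs x x' => [|g gs IH] x x' e //=; apply: IH; apply: cfun_ext.
Qed.

Lemma cact_out gs x w :
  all (fun g => w \notin gate_wires g) gs -> cact gs x w = x w.
Proof.
elim: gs x => [|g gs IH] x //= /andP[h hs]; rewrite IH //.
by case: g h => [i|i|i j|i j k] //=; case: eqP => // ->; rewrite !inE eqxx ?orbT.
Qed.

Lemma nth_bact n gs (x : bits n) i : gates_ok n gs ->
  nth false (bact gs x) i = cact gs (nth false x) i.
Proof.
move=> ok; case: (ltnP i n) => h.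
  by rewrite -[i in LHS]/(val (Ordinal h)) -tnth_nth tnth_mktuple.
rewrite nth_bits_ge // cact_out ?nth_bits_ge //.
apply: sub_all ok => g og.
by apply: contraTN h => /(wires_lt og); rewrite ltnNge.
Qed.

Lemma cfunK n g x : wires_ok n (gate_wires g) -> cfun g (cfun g x) =1 x.
Proof.
case: g => //= [i j|i j k]; rewrite /wires_ok /= !inE => /andP[h _] w.
  by case: eqP => // ->; rewrite eqxx; move: h; case: eqP => //= _ _; case: (x i); case: (x j).
move: h; rewrite negb_or => /and3P[/andP[ij ik] jk _].
case: eqP => // ->; rewrite eqxx (negbTE ik) (negbTE jk).
by case: (x i); case: (x j); case: (x k).
Qed.

(** Every classical gate is an involution, so the reversed list undoes the circuit; this is what
    makes [bact] injective. *)
Lemma cact_revK n gs x : gates_ok n gs -> cact (rev gs) (cact gs x) =1 x.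
Proof.
elim: gs x => [|g gs IH] x //= /andP[og ogs] w.
rewrite rev_cons -cats1 cact_cat /=.
by rewrite (cfun_ext _ (IH _ ogs)) (cfunK _ og).
Qed.

Lemma bact_inj n gs : gates_ok n gs -> injective (@bact n gs).
Proof.
move=> ok x y e; apply: bits_eqP => i hi.
rewrite -(cact_revK _ ok) -[RHS](cact_revK _ ok).
by apply: cact_ext => w; rewrite -!nth_bact // e.
Qed.

Section GateMatrices.
Variable R : realType.
Local Notation C := R[i].

Definition gates_mx n (gs : seq gate) : op R n n :=
  foldl (fun U g => gate_mx R n g *m U) 1%:M gs.

Lemma gates_mx_cons n g gs : gates_mx n (g :: gs) = gates_mx n gs *m gate_mx R n g.
Proof.
rewrite /gates_mx /= mulmx1.
suff h (U V : op R n n) : foldl (fun U g => gate_mx R n g *m U) (U *m V) gs =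
  foldl (fun U g => gate_mx R n g *m U) U gs *m V by rewrite -[X in foldl _ X _]mul1mx h.
by elim: gs U V => [|g' gs IH] U V //=; rewrite mulmxA IH.
Qed.

Lemma gates_mx_cat n s1 s2 : gates_mx n (s1 ++ s2) = gates_mx n s2 *m gates_mx n s1.
Proof.
elim: s1 => [|g s1 IH]; first by rewrite mulmx1.
by rewrite cat_cons !gates_mx_cons IH mulmxA.
Qed.

Lemma gate_mx_relabel n ws k g : wires_ok n ws -> size ws = k ->
  wires_ok k (gate_wires g) ->
  gate_mx R n (relabel ws g) = lift_op n ws (gate_mx R k g).
Proof. by move=> ow sw; case: g => *; rewrite /gate_mx (lift_lift ow sw). Qed.

Lemma gates_mx_relabel n ws k gs : wires_ok n ws -> size ws = k ->
  gates_ok k gs ->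
  gates_mx n (map (relabel ws) gs) = lift_op n ws (gates_mx k gs).
Proof.
move=> ow sw; elim: gs => [|g gs IH] /=; first by rewrite lift_1.
move=> /andP[og ogs].
by rewrite !gates_mx_cons IH // (gate_mx_relabel ow sw og) (lift_mul ow sw).
Qed.

Lemma sum_permutation n (f : bits n -> bits n) (g : bits n -> C) (y : bits n) :
  \sum_(z : bits n) (z == f y)%:R * g z = g (f y).
Proof.
rewrite (bigD1 (f y)) //= eqxx mul1r big1 ?addr0 // => z /negbTE ->.
by rewrite mul0r.
Qed.

Lemma permutation_unitary n (A : op R n n) (f : bits n -> bits n) :
  injective f -> (forall y x, ent A y x = (y == f x)%:R) -> A \is unitarymx.
Proof.
move=> fi e; rewrite -trmxC_unitary; apply/unitarymxP; rewrite trmxCK.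
apply: ent_eqP => y x; rewrite ent_mul ent1.
under eq_bigr => z _ do rewrite ent_adj !e conjC_nat.
by rewrite sum_permutation (inj_eq fi).
Qed.

Lemma ent_classical_gate n g y x : wires_ok n (gate_wires g) -> is_classical g ->
  ent (gate_mx R n g) y x = (y == bact [:: g] x)%:R.
Proof.
move=> ok cl; have okl : gates_ok n [:: g] by rewrite /gates_ok /= ok.
(* One argument for both gates: a local permutation [f] lifts to the permutation [bact] of the
   register as soon as [bact] restricts to [f] on the wires of the gate. *)
have key k (A : op R k k) (f : bits k -> seq bool) : size (gate_wires g) = k ->
    (forall y x, ent A y x = ((y : seq bool) == f x)%:R) ->
    (forall x : bits n, (sel (gate_wires g) k (bact [:: g] x) : seq bool) =
       f (sel (gate_wires g) k x)) ->
    ent (lift_op n (gate_wires g) A) y x = (y == bact [:: g] x)%:R.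
  move=> sz eA ef; rewrite ent_lift eA -ef.
  have ag : agree (gate_wires g) (bact [:: g] x) x.
    apply/agreeP => i hi; by rewrite nth_bact // cact_out //= hi.
  case: ifP => h; last first.
    by case: eqP => // e; rewrite e ag in h.
  congr (_%:R); congr nat_of_bool; apply/eqP/eqP => [/val_inj e|-> //].
  by apply: (agree_sel_eq sz _ e); apply: agree_trans h _; rewrite agree_sym.
case: g ok cl okl key => // [i j|i j k] ok _ okl key.
  apply: (key 2%N _ (fun x => [:: b0 x; b0 x (+) b1 x])) => //.
    by move=> *; rewrite ent_opmx.
  move=> z; apply: (@eq_from_nth _ false); rewrite ?size_tuple // => w hw.
  rewrite nth_sel // hw andTb nth_bact //= /b0 /b1 !nth_sel //=.
  move: ok; rewrite /wires_ok /= !inE => /andP[/andP[ij _] _].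
  by case: w hw => [|[|w]] //= _; rewrite ?(negbTE ij) ?eqxx.
apply: (key 3%N _ (fun x => [:: b0 x; b1 x; (b0 x && b1 x) (+) b2 x])) => //.
  by move=> *; rewrite ent_opmx.
move=> z; apply: (@eq_from_nth _ false); rewrite ?size_tuple // => w hw.
rewrite nth_sel // hw andTb nth_bact //= /b0 /b1 /b2 !nth_sel //=.
move: ok; rewrite /wires_ok /= !inE negb_or => /andP[/and3P[/andP[ij ik] jk _] _].
by case: w hw => [|[|[|w]]] //= _; rewrite ?(negbTE ik) ?(negbTE jk) ?eqxx.
Qed.

Lemma ent_classical n gs y x : gates_ok n gs -> all is_classical gs ->
  ent (gates_mx n gs) y x = (y == bact gs x)%:R.
Proof.
elim: gs y x => [|g gs IH] y x /=.
  move=> _ _; rewrite ent1; congr (_ == _)%:R.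
  by apply: bits_eqP => i hi; rewrite nth_bact.
move=> /andP[og ogs] /andP[cg cgs]; rewrite gates_mx_cons ent_mul.
under eq_bigr => z _ do rewrite IH // ent_classical_gate // mulrC.
rewrite (sum_permutation _ (fun z => (y == bact gs z)%:R)).
congr (_ == _)%:R; apply: bits_eqP => i hi; rewrite !nth_bact //; last by apply/andP.
by apply: cact_ext => w; rewrite nth_bact //; apply/andP.
Qed.

Lemma bits1E (x : bits 1) : x = [tuple b0 x].
Proof. by apply: bits_eqP => -[|i]. Qed.

Lemma sel1E n i (z : bits n) : sel [:: i] 1 z = [tuple nth false z i] :> bits 1.
Proof. by apply: bits_eqP => -[|j] // _; rewrite nth_sel. Qed.

Lemma sum_bits1 (V : nmodType) (f : bits 1 -> V) :
  \sum_(x : bits 1) f x = f [tuple false] + f [tuple true].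
Proof.
rewrite (reindex (fun b : bool => [tuple b] : bits 1)) /=.
  by rewrite big_bool /= addrC.
by exists (@b0 1) => x _ //; rewrite -bits1E.
Qed.

Lemma sqrt2_sqr : ((Num.sqrt 2%:R)^-1%:C%C : C) * (Num.sqrt 2%:R)^-1%:C%C = 2%:R^-1.
Proof.
rewrite -rmorphM /= -invfM -expr2 sqr_sqrtr ?ler0n //.
by rewrite fmorphV rmorph_nat.
Qed.

Lemma conj_sqrt2 : ((Num.sqrt 2%:R)^-1%:C%C : C)^* = (Num.sqrt 2%:R)^-1%:C%C.
Proof. exact: conjc_real. Qed.

Definition phase_mx (t : C) : op R 1 1 :=
  opmx (fun y x => if y != x then 0 else if b0 x then t else 1).

Lemma phase_mul t u : phase_mx t *m phase_mx u = phase_mx (t * u).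
Proof.
apply: ent_eqP => y x; rewrite ent_mul sum_bits1 !ent_opmx.
rewrite (bits1E y) (bits1E x).
by case: (b0 y); case: (b0 x) => /=; rewrite ?(mulr0, mul0r, addr0, add0r, mulr1).
Qed.

Lemma Tmx_phase : Tmx R = phase_mx ((Num.sqrt 2%:R)^-1%:C%C * (1 +i* 1)%C).
Proof. by []. Qed.

Lemma tphase4 : let t := (Num.sqrt 2%:R)^-1%:C%C * (1 +i* 1)%C : C in
  t * t * t * t = -1.
Proof.
set s : C := (Num.sqrt 2%:R)^-1%:C%C; move=> /=.
have e : (s * (1 +i* 1)%C) * (s * (1 +i* 1)%C) = 'i%C.
  rewrite mulrACA sqrt2_sqr.
  have -> : (1 +i* 1)%C * (1 +i* 1)%C = 2%:R * 'i%C :> C.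
    rewrite mulr_natl mulr2n; apply/eqP; rewrite eq_complex /=.
    by rewrite !mulr1 subrr addr0 !eqxx.
  by rewrite mulrA mulVf ?mul1r // pnatr_eq0.
by rewrite e -[_ * _ * _]mulrA e -expr2 sqr_i.
Qed.

Lemma ent_phase t (y x : bits 1) :
  ent (phase_mx t) y x = if y != x then 0 else if b0 x then t else 1.
Proof. exact: ent_opmx. Qed.

Lemma ent_Hmx (y x : bits 1) :
  ent (Hmx R) y x = (Num.sqrt 2%:R)^-1%:C%C * (-1) ^+ (b0 y && b0 x).
Proof. exact: ent_opmx. Qed.

Lemma half_sum : (2%:R^-1 : C) + 2%:R^-1 = 1.
Proof. by rewrite -[LHS]mulr2n -[LHS]mulr_natl mulfV // pnatr_eq0. Qed.

Lemma Hmx_unitary : Hmx R \is unitarymx.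
Proof.
apply/unitarymxP; apply: ent_eqP => y x.
have e2 (a b : C) : (Num.sqrt 2%:R)^-1%:C%C * a * ((Num.sqrt 2%:R)^-1%:C%C * b) = 2%:R^-1 * (a * b).
  by rewrite mulrACA sqrt2_sqr.
rewrite ent_mul sum_bits1 !ent_adj !ent_Hmx ent1 !rmorphM /= conj_sqrt2 !e2.
rewrite (bits1E y) (bits1E x) /= -mulrDr !rmorphXn !rmorphN1.
by case: (b0 y); case: (b0 x) => /=;
  rewrite ?(expr0, expr1, mulr1, mul1r, mulrN1, opprK, subrr, addNr, mulr0, mulrDr, half_sum).
Qed.

Lemma phase_unitary t : t * t^* = 1 -> phase_mx t \is unitarymx.
Proof.
move=> h; apply/unitarymxP; apply: ent_eqP => y x.
rewrite ent_mul sum_bits1 !ent_adj !ent_phase ent1.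
rewrite (bits1E y) (bits1E x).
by case: (b0 y); case: (b0 x) => /=; rewrite ?(conjC0, conjC1, mulr0, mul0r, addr0, add0r, mulr1, h).
Qed.

Lemma Tmx_unitary : Tmx R \is unitarymx.
Proof.
rewrite Tmx_phase; apply: phase_unitary.
rewrite rmorphM /= conj_sqrt2 mulrACA sqrt2_sqr.
have -> : (1 +i* 1)%C * ((1 +i* 1)%C)^* = 2%:R :> C.
  rewrite -[(_^*)]/((1 -i* 1)%C) mulr2n; apply/eqP; rewrite eq_complex /=.
  by rewrite !mulr1 mulrN1 opprK addNr !addr0 !eqxx.
by rewrite mulVf // pnatr_eq0.
Qed.

Lemma gate_unitary n g : wires_ok n (gate_wires g) -> gate_mx R n g \is unitarymx.
Proof.
move=> ok; have [cl|] := boolP (is_classical g).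
  apply: (@permutation_unitary n _ (@bact n [:: g])).
    by apply: bact_inj; rewrite /gates_ok /= ok.
  by move=> y x; apply: ent_classical_gate.
by case: g ok => // i ok _; apply: lift_unitary => //; [exact: Hmx_unitary|exact: Tmx_unitary].
Qed.

Lemma gates_unitary n gs : gates_ok n gs -> gates_mx n gs \is unitarymx.
Proof.
elim: gs => [|g gs IH] /=; first by move=> _; apply/unitarymxP; apply: ent_eqP => y x; rewrite mul1mx ent_adj !ent1 conjC_nat eq_sym.
move=> /andP[og ogs]; rewrite gates_mx_cons.
by apply: mul_unitarymx; [exact: IH|exact: gate_unitary].
Qed.

(** A NOT gate: the fourth power of T is Z, and H Z H = X. The classical gates fix the all-zero
    string, so this is the source of the constant 1 that controls the table lookups. *)
Definition xgates i : seq gate := [:: Hgate i; Tgate i; Tgate i; Tgate i; Tgate i; Hgate i].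

Lemma ent_xgates n i (y x : bits n) : (i < n)%N ->
  ent (gates_mx n (xgates i)) y x =
  (agree [:: i] y x && (nth false y i == ~~ nth false x i))%:R.
Proof.
move=> hi; have ok : wires_ok n [:: i] by rewrite /wires_ok /= hi.
rewrite !gates_mx_cons /gates_mx /= mul1mx -!(lift_mul ok) //.
rewrite -!(mulmxA (Hmx R)) Tmx_phase !phase_mul tphase4 ent_lift.
case: ifP => //= _.
rewrite !sel1E ent_mul; under eq_bigr => z _ do rewrite ent_mul.
rewrite !sum_bits1 !ent_Hmx !ent_phase /=.
have := @half_sum; have := sqrt2_sqr.
set s := _%:C%C => es eh.
case: (nth false y i); case: (nth false x i) => /=;
rewrite ?(expr0, expr1, mulr1, mul1r, mulr0, mul0r, addr0, add0r, mulrN1, mulN1r, mulrN, mulNr, opprK, es, eh, subrr, addNr) //.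
Qed.

Definition hgates (rr : seq nat) : seq gate := map Hgate rr.

(** The wires start at 0, so all the signs of the Hadamard matrices are positive and the amplitude
    is uniform. *)
Lemma ent_hgates n rr (y x : bits n) : wires_ok n rr ->
  all (fun w => ~~ nth false x w) rr ->
  ent (gates_mx n (hgates rr)) y x =
  (agree rr y x)%:R * (Num.sqrt 2%:R)^-1%:C%C ^+ size rr.
Proof.
elim: rr y x => [|i rr IH] y x /=.
  move=> _ _; rewrite ent1 mulr1; congr (_%:R); congr nat_of_bool.
  apply/eqP/agreeP => [-> //|h]; apply: bits_eqP => w _; exact: h.
rewrite /wires_ok /= => /andP[/andP[ir ur] /andP[hi hr]] /andP[xi xr].
have ok1 : wires_ok n [:: i] by rewrite /wires_ok /= hi.
have okr : wires_ok n rr by rewrite /wires_ok ur.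
rewrite gates_mx_cons ent_mul.
under eq_bigr => z _ do rewrite ent_lift mulrC.
rewrite (eq_bigr (fun z => if agree [:: i] z x then
    ent (Hmx R) (sel [:: i] 1 z) (sel [:: i] 1 x) * ent (gates_mx n (hgates rr)) y z else 0));
  last by move=> z _; case: ifP; rewrite ?mul0r.
rewrite -big_mkcond /= (@sum_agree n [:: i] 1 ok1 erefl _ x).
have xr' u : all (fun w => ~~ nth false (put [:: i] x (u : bits 1)) w) rr.
  apply/allP => w wr; rewrite nth_put inE.
  have -> : (w == i) = false by apply: contraNF ir => /eqP <-.
  by rewrite negb_and (allP xr _ wr) orbT.
under eq_bigr => u _ do rewrite IH // sel_put // ent_Hmx sel1E /b0 /= (negbTE xi) andbF expr0 mulr1.
rewrite -mulr_sumr -mulr_suml mulrCA -exprS; congr (_ * _).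
rewrite sum_bits1.
have ag (b : bool) : agree rr y (put [:: i] x ([tuple b] : bits 1)) =
    agree (i :: rr) y x && (nth false y i == b).
  apply/agreeP/andP => [h|[/agreeP h /eqP hb] w wr].
    split; last by rewrite h // nth_put hi !inE eqxx /= eqxx.
    apply/agreeP => w; rewrite inE negb_or => /andP[wi wr].
    rewrite h // nth_put !inE (negbTE wi).
    by case: ltnP => //= hw; rewrite nth_bits_ge.
  rewrite nth_put !inE; case: (w =P i) => [->|/eqP wi].
    by rewrite hi /= eqxx.
  rewrite h ?inE ?negb_or ?wi //; by case: ltnP => //= hw; rewrite nth_bits_ge.
rewrite !ag; case: agree; rewrite /= ?addr0 //.
by case: (nth false y i); rewrite /= ?addr0 ?add0r.
Qed.

End GateMatrices.

(** * Classical reversible circuits *)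

Definition swap i j : seq gate := [:: CNOTgate i j; CNOTgate j i; CNOTgate i j].

Fixpoint swaps (A B : seq nat) : seq gate :=
  match A, B with
  | a :: A', b :: B' => swap a b ++ swaps A' B'
  | _, _ => [::]
  end.

Fixpoint copies (A B : seq nat) : seq gate :=
  match A, B with
  | a :: A', b :: B' => CNOTgate a b :: copies A' B'
  | _, _ => [::]
  end.

Lemma cact_swap i j x w : i != j ->
  cact (swap i j) x w = if w == i then x j else if w == j then x i else x w.
Proof.
move=> ij; have ji : (j == i) = false by rewrite eq_sym (negbTE ij).
rewrite /cact /= !eqxx (negbTE ij) ji /=.
case: (w =P i) => [->|wi]; first by rewrite (negbTE ij); case: (x i); case: (x j).
by case: (w =P j) => // _; case: (x i); case: (x j).
Qed.

Lemma mem_nth_index (A B : seq nat) w : size A = size B -> w \in A ->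
  nth 0%N B (index w A) \in B.
Proof. by move=> sz wA; rewrite mem_nth // -sz index_mem. Qed.

Lemma cact_swaps A B x w : size A = size B -> uniq (A ++ B) ->
  cact (swaps A B) x w =
  if w \in A then x (nth 0%N B (index w A))
  else if w \in B then x (nth 0%N A (index w B)) else x w.
Proof.
elim: A B x => [|a A IH] [|b B] x // [sz].
have -> : cact (swaps (a :: A) (b :: B)) x = cact (swaps A B) (cact (swap a b) x) by [].
set y := cact (swap a b) x.
rewrite /= mem_cat inE !negb_or cat_uniq /= negb_or.
move=> /andP[/and3P[aA ab aB] /and3P[uA /andP[bA AB] /andP[bB uB]]].
have uAB : uniq (A ++ B) by rewrite cat_uniq uA AB.
have yE v : y v = _ := cact_swap x v ab.
clearbody y.
rewrite IH // !inE [a == w]eq_sym [b == w]eq_sym.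
case: (w =P a) => [->|/eqP wa] /=.
  by rewrite (negbTE aA) (negbTE aB) yE eqxx.
case: (boolP (w \in A)) => wA /=.
  have h := mem_nth_index sz wA.
  by rewrite yE (negbTE (memPn aB _ h)) (negbTE (memPn bB _ h)).
case: (w =P b) => [->|/eqP wb] /=.
  by rewrite (negbTE bB) yE eqxx eq_sym (negbTE ab).
case: (boolP (w \in B)) => wB /=; last by rewrite yE (negbTE wa) (negbTE wb).
have h := mem_nth_index (esym sz) wB.
by rewrite yE (negbTE (memPn aA _ h)) (negbTE (memPn bA _ h)).
Qed.

Lemma cact_copies A B x w : size A = size B -> uniq B ->
  (forall i, i \in A -> i \notin B) ->
  cact (copies A B) x w =
  if w \in B then x (nth 0%N A (index w B)) (+) x w else x w.
Proof.
elim: A B x => [|a A IH] [|b B] x //= [sz] /andP[bB uB] AB.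
have aB : a \notin B by have := AB a; rewrite !inE eqxx /= negb_or => /(_ isT)/andP[].
have AB' i : i \in A -> i \notin B.
  by move=> iA; have := AB i; rewrite !inE iA orbT /= negb_or => /(_ isT)/andP[].
have bA : b \notin A by apply/negP => bA; have := AB b; rewrite !inE bA orbT eqxx => /(_ isT).
rewrite IH // !inE [b == w]eq_sym.
case: (w =P b) => [->|/eqP wb] /=; first by rewrite (negbTE bB).
case: (boolP (w \in B)) => wB //.
by rewrite (negbTE (memPn bA _ (mem_nth_index (esym sz) wB))).
Qed.

Lemma swaps_classical A B : all is_classical (swaps A B).
Proof. by elim: A B => [|a A IH] [|b B] //=. Qed.

Lemma copies_classical A B : all is_classical (copies A B).
Proof. by elim: A B => [|a A IH] [|b B] //=. Qed.

Lemma size_swaps A B : (size (swaps A B) <= 3 * size A)%N.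
Proof. by elim: A B => [|a A IH] [|b B] //=; have := IH B; lia. Qed.

Lemma size_copies A B : (size (copies A B) <= size A)%N.
Proof. by elim: A B => [|a A IH] [|b B] //=; have := IH B; lia. Qed.

Lemma gates_ok_swaps n A B : size A = size B -> wires_ok n (A ++ B) ->
  gates_ok n (swaps A B).
Proof.
elim: A B => [|a A IH] [|b B] //= [sz].
rewrite /wires_ok /= mem_cat inE !negb_or cat_uniq /= negb_or all_cat /=.
move=> /andP[/andP[/and3P[aA ab aB] /and3P[uA /andP[bA AB] /andP[bB uB]]] /and4P[ha hA hb hB]].
have -> : gates_ok n (swaps A B).
  by apply: IH => //; rewrite /wires_ok cat_uniq all_cat uA AB uB hA.
by rewrite ha hb (eq_sym b a) ab.
Qed.

Lemma gates_ok_copies n A B : size A = size B -> all (fun w => w < n)%N A ->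
  all (fun w => w < n)%N B -> (forall i, i \in A -> i \notin B) ->
  gates_ok n (copies A B).
Proof.
elim: A B => [|a A IH] [|b B] //= [sz] /andP[ha hA] /andP[hb hB] AB.
have := AB a; rewrite !inE eqxx /= negb_or => /(_ isT)/andP[ab _].
rewrite /wires_ok /= !inE ab ha hb /=; apply: IH => // i iA.
by have := AB i; rewrite !inE iA orbT /= negb_or => /(_ isT)/andP[].
Qed.

(* XORs [f] of the bits on the wires [xs] to the wires [ts], when the control
   [c] is set: f(b, v) = f(0, v) xor b (f(0, v) xor f(1, v)).  The wires [ds]
   are ancillas. *)
Fixpoint table (f : seq bool -> nat -> bool) (c : nat) (xs ts ds : seq nat) :
  seq gate :=
  match xs, ds with
  | x :: xs', d :: ds' =>
      table (fun v => f (false :: v)) c xs' ts ds' ++ CCNOTgate c x d ::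
      table (fun v i => f (false :: v) i (+) f (true :: v) i) d xs' ts ds' ++
      [:: CCNOTgate c x d]
  | _, _ => [seq CNOTgate c (nth 0%N ts i) | i <- iota 0 (size ts) & f [::] i]
  end.

Lemma table_classical f c xs ts ds : all is_classical (table f c xs ts ds).
Proof.
elim: xs f c ds => [|x xs IH] f c [|d ds] /=; try by rewrite all_map; apply/allP.
by rewrite !all_cat /= !all_cat /= !IH.
Qed.

(** Each address bit turns a size t into 2 t + 2, that is, it doubles t + 2; hence the form of the
    bound. *)
Lemma size_table f c xs ts ds :
  (size (table f c xs ts ds) + 2 <= 2 ^ size xs * (size ts + 2))%N.
Proof.
have base g : (size [seq CNOTgate c (nth 0%N ts i) | i <- iota 0 (size ts) & g i]
    <= size ts)%N.
  by rewrite size_map size_filter (leq_trans (count_size _ _)) ?size_iota.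
elim: xs f c ds base => [|x xs IH] f c [|d ds] base /=.
- by rewrite expn0 mul1n; have := base (f [::]); lia.
- by rewrite expn0 mul1n; have := base (f [::]); lia.
- have := base (f [::]); have : (0 < 2 ^ (size xs).+1)%N by rewrite expn_gt0.
  nia.
rewrite !size_cat /= size_cat /= expnS.
have b1 c' g : (size [seq CNOTgate c' (nth 0%N ts i) | i <- iota 0 (size ts) & g i]
    <= size ts)%N by have := base g; rewrite !size_map.
have h1 := IH (fun v => f (false :: v)) c ds (b1 c).
have h2 := IH (fun v i => f (false :: v) i (+) f (true :: v) i) d ds (b1 d).
lia.
Qed.

(** The first recursive lookup acts as if the leading address bit were 0; the second adds the
    difference of the two branches when that bit is set. The ancilla [d] holds the conjunction of
    control and bit, and the second Toffoli gate clears it, which restores the hypothesis on [ds]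
    for later lookups. *)
Lemma cact_table f c xs ts ds (x : nat -> bool) w :
  (size xs <= size ds)%N -> uniq ts -> uniq ds ->
  (forall i, i \in ds -> [/\ i \notin c :: xs, i \notin ts & x i = false]) ->
  (forall i, i \in c :: xs -> i \notin ts) ->
  cact (table f c xs ts ds) x w =
  if w \in ts then x w (+) (x c && f (map x xs) (index w ts)) else x w.
Proof.
have base g c' y v : c' \notin ts -> uniq ts ->
    cact [seq CNOTgate c' (nth 0%N ts i) | i <- iota 0 (size ts) & g i] y v =
    if v \in ts then y v (+) (y c' && g (index v ts)) else y v.
  move=> cts uts.
  (* The induction needs an arbitrary duplicate-free list of output positions in place of
     [iota 0 (size ts)]. *)
  have gen (r : seq nat) : uniq r -> all (fun i => i < size ts)%N r ->
    cact [seq CNOTgate c' (nth 0%N ts i) | i <- r & g i] y v =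
    if (v \in ts) && (index v ts \in r) then y v (+) (y c' && g (index v ts)) else y v.
    elim: r y => [|i r IH] y /=; first by rewrite andbF.
    move=> /andP[ir ur] /andP[hi hr].
    have ic : (c' == nth 0%N ts i) = false.
      by apply/negP => /eqP e; rewrite e mem_nth in cts.
    case: ifP => gi /=; rewrite IH //= ?ic ?inE.
      case: (v =P nth 0%N ts i) => [->|/eqP vi].
        by rewrite mem_nth // index_uniq // eqxx (negbTE ir) /= gi andbT addbC.
      case: (boolP (v \in ts)) => //= vts.
      suff -> : (index v ts == i) = false by [].
      by apply: contraNF vi => /eqP <-; rewrite nth_index.
    case: (index v ts =P i) => [->|_] //; rewrite gi andbF addbF.
    by rewrite !if_same.
  rewrite gen ?iota_uniq //; last by apply/allP => i; rewrite mem_iota.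
  by case: (boolP (v \in ts)) => //= vts; rewrite mem_iota /= index_mem vts.
elim: xs f c ds x w => [|b xs IH] f c [|d ds] x w //= sz uts.
- by move=> _ _ /(_ c) h; rewrite base // h // inE eqxx.
- by move=> _ _ /(_ c) h; rewrite base // h // inE eqxx.
move=> /andP[dds uds] hds hts.
have [] := hds d; first by rewrite inE eqxx.
rewrite !inE !negb_or => /and3P[dc db dxs] dts xd.
have cts : c \notin ts by apply: hts; rewrite inE eqxx.
have bts : b \notin ts by apply: hts; rewrite !inE eqxx orbT.
have hd i : i \in ds -> [/\ i != d, i \notin c :: b :: xs, i \notin ts & x i = false].
  move=> ids; have [|h1 h2 h3] := hds i; first by rewrite inE ids orbT.
  by split => //; apply: contraNneq dds => <-.
rewrite cact_cat /= cact_cat /=.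
set y1 := cact (table _ c _ _ _) x.
have e1 v : y1 v = if v \in ts then x v (+) (x c && f (false :: map x xs) (index v ts)) else x v.
  rewrite /y1 IH // => i.
    move=> /hd[id]; rewrite !inE !negb_or => /and3P[-> _ ->] -> ->; split => //.
  rewrite inE => h; apply: hts; rewrite !inE; case/orP: h => ->; by rewrite ?orbT.
have y1m v : v \notin ts -> y1 v = x v by rewrite e1 => /negbTE ->.
set y2 := fun v => if v == d then (y1 c && y1 b) (+) y1 d else y1 v.
have y2d : y2 d = x c && x b.
  by rewrite /y2 eqxx !y1m // xd addbF.
set y3 := cact (table _ d _ _ _) y2.
have e3 v : y3 v = if v \in ts then y2 v (+) (y2 d &&
    (f (false :: map y2 xs) (index v ts) (+) f (true :: map y2 xs) (index v ts))) else y2 v.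
  rewrite /y3 IH // => i.
    move=> /hd[id]; rewrite !inE !negb_or => /and3P[ic _ ixs] its xi; split => //.
      by rewrite id.
    by rewrite /y2 (negbTE id) y1m.
  rewrite inE => /orP[/eqP -> //|h]; apply: hts; by rewrite !inE h !orbT.
have mxs : map y2 xs = map x xs.
  apply/eq_in_map => i ixs; rewrite /y2.
  have -> : (i == d) = false by apply: contraNF dxs => /eqP <-.
  by rewrite y1m // hts // !inE ixs !orbT.
have y3m v : v \notin ts -> v != d -> y3 v = x v.
  by move=> vt vd; rewrite e3 (negbTE vt) /y2 (negbTE vd) y1m.
have y3d : y3 d = x c && x b by rewrite e3 (negbTE dts).
case: (w =P d) => [->|/eqP wd].
  rewrite (negbTE dts) xd y3d !y3m //; first by rewrite addbb.
    by rewrite eq_sym.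
  by rewrite eq_sym.
rewrite e3 y2d mxs /y2 (negbTE wd) e1.
case: (w \in ts) => //; case: (x c); case: (x b); rewrite /= ?addbF //.
by rewrite -addbA addKb.
Qed.

Lemma gates_ok_table n f c xs ts ds : (size xs <= size ds)%N -> uniq ds ->
  all (fun w => w < n)%N (c :: xs ++ ts ++ ds) ->
  (forall i, i \in ds -> i \notin c :: xs /\ i \notin ts) ->
  (forall i, i \in c :: xs -> i \notin ts) -> uniq (c :: xs) ->
  gates_ok n (table f c xs ts ds).
Proof.
have base g c' : all (fun w => w < n)%N (c' :: ts) -> c' \notin ts ->
    gates_ok n [seq CNOTgate c' (nth 0%N ts i) | i <- iota 0 (size ts) & g i].
  move=> /= /andP[hc /allP ht] cts; rewrite /gates_ok all_map all_filter.
  apply/allP => i; rewrite mem_iota /= => hi; apply/implyP => _.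
  rewrite /wires_ok /= !inE hc ht ?mem_nth // !andbT.
  by apply: contraNneq cts => ->; rewrite mem_nth.
elim: xs f c ds => [|b xs IH] f c [|d ds] //= sz.
- by rewrite cats0 => _ /andP[hc ht] _ /(_ c) h _; apply: base; rewrite /= ?hc // h // inE eqxx.
- rewrite all_cat => _ /andP[hc /andP[ht _]] _ /(_ c) h _.
  by apply: base; rewrite /= ?hc // h // inE eqxx.
rewrite !all_cat /= => /andP[dds uds] /and5P[hc hb hxs hts /andP[hd hds]] hD hT.
rewrite inE negb_or => /andP[/andP[cb cxs] /andP[bxs uxs]].
have [] := hD d; first by rewrite inE eqxx.
rewrite !inE !negb_or => /and3P[dc db dxs] dts.
have g0 : wires_ok n [:: c; b; d].
  by rewrite /wires_ok /= !inE negb_or cb hc hb hd (eq_sym c) (eq_sym b) dc db.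
have hDs i : i \in ds -> [/\ i != d, i \notin c :: b :: xs & i \notin ts].
  move=> ids; have [|h1 h2] := hD i; first by rewrite inE ids orbT.
  by split => //; apply: contraNneq dds => <-.
rewrite /gates_ok all_cat /= all_cat /= g0 /= andbT.
apply/andP; split; apply: IH => //=; rewrite ?all_cat ?hc ?hd ?hxs ?hts ?hds ?cxs ?dxs //.
- by move=> i /hDs[_]; rewrite !inE !negb_or => /and3P[-> _ ->] ->.
- move=> i h; apply: hT; move: h; rewrite !inE => /orP[->//|->]; by rewrite !orbT.
- by move=> i /hDs[id]; rewrite !inE !negb_or id => /and3P[_ _ ->] ->.
- move=> i; rewrite inE => /orP[/eqP -> //|h]; apply: hT; by rewrite !inE h !orbT.
Qed.

Lemma table_wires f c xs ts ds j : j \notin c :: xs ++ ts ++ ds ->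
  all (fun g => j \notin gate_wires g) (table f c xs ts ds).
Proof.
have base g c' : j != c' -> j \notin ts ->
    all (fun g => j \notin gate_wires g)
      [seq CNOTgate c' (nth 0%N ts i) | i <- iota 0 (size ts) & g i].
  move=> jc jt; rewrite all_map all_filter; apply/allP => i; rewrite mem_iota /= => hi.
  apply/implyP => _; rewrite !inE negb_or jc /=.
  by apply: contraNneq jt => ->; rewrite mem_nth.
elim: xs f c ds => [|x xs IH] f c [|d ds] /=; rewrite !inE ?mem_cat !inE !negb_or.
- by move=> /and3P[? ? _]; exact: base.
- by move=> /and4P[? ? _ _]; exact: base.
- by move=> /andP[? /and4P[_ _ ? _]]; exact: base.
move=> /andP[jc /and5P[jx jxs jt jd jds]].
by rewrite !all_cat /= !all_cat /= !inE !negb_or jc jx jd /= !IH // !inE !mem_cat !negb_or ?jc ?jd jxs jt jds.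
Qed.

(** * Output registers of purified algorithms *)

Section Output.
Variable R : realType.
Local Notation C := R[i].

Lemma index_iotaE j k i : (j <= i < j + k)%N -> index i (iota j k) = (i - j)%N.
Proof.
move=> h; have hk : (i - j < k)%N by lia.
rewrite -{1}(subnKC (_ : j <= i)%N); last by lia.
by rewrite -(nth_iota 0%N j hk) index_uniq ?iota_uniq // size_iota.
Qed.

(** The Choi entry of applying [U] and keeping the first [s] qubits: the [put] forces both output
    strings to coincide on the discarded qubits. Unlike sums over [kraus], it is indexed by full
    basis states, to which wire computations apply. *)
Definition out_choi n s (U : op R n n) (y : bits s) (x : bits n) (y' : bits s) (x' : bits n) : C :=
  \sum_(Y : bits n | sel (iota 0 s) s Y == y)
    ent U Y x * (ent U (put (iota 0 s) Y y') x')^*.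

Lemma wires_ok_iota n i k : (i + k <= n)%N -> wires_ok n (iota i k).
Proof.
move=> h; rewrite /wires_ok iota_uniq; apply/allP => w; rewrite mem_iota; lia.
Qed.

Lemma nth_sel_iota n i k (x : bits n) j : (j < k)%N ->
  nth false (sel (iota i k) k x) j = nth false x (i + j).
Proof. by move=> hj; rewrite nth_sel ?size_iota // hj nth_iota. Qed.

Lemma kraus_choi n s k (U : op R n n) (pre : seq bool) y (x : bits k) y' (x' : bits k) :
  (s <= n)%N ->
  \sum_(e : bits (n - s)) ent (kraus k U pre e) y x * (ent (kraus k U pre e) y' x')^* =
  out_choi U y (pad n (pre ++ x)) (y' : bits s) (pad n (pre ++ x')).
Proof.
move=> sn; rewrite /out_choi.
rewrite (reindex_onto (fun e : bits (n - s) => pad n (y ++ e)) (fun Y : bits n => pad (n - s) (drop s Y))) /=.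
  have sl (e : bits (n - s)) : sel (iota 0 s) s (pad n (y ++ e)) = y.
    apply: bits_eqP => i hi; rewrite nth_sel_iota // add0n nth_pad nth_cat size_tuple hi.
    by rewrite (leq_trans hi sn).
  apply: eq_big => [e|e _].
    rewrite sl eqxx /=; apply/esym/eqP/bits_eqP => i hi.
    rewrite nth_pad hi /= nth_drop nth_pad nth_cat size_tuple addKn.
    have -> : (s + i < s)%N = false by lia.
    by have -> : (s + i < n)%N by lia.
  rewrite !ent_opmx; congr (_ * (ent U _ _)^*); apply: bits_eqP => i hi.
  rewrite nth_put nth_pad hi /= mem_iota /= add0n nth_cat size_tuple.
  case: ltnP => his; first by rewrite index_iotaE // subn0.
  by rewrite nth_pad hi nth_cat size_tuple ltnNge his.
move=> Y /eqP <-; apply: bits_eqP => i hi.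
rewrite nth_pad hi nth_cat size_tuple /=.
case: ltnP => his; first by rewrite nth_sel_iota.
by rewrite nth_pad nth_drop subnKC // ltn_sub2r // (leq_ltn_trans his).
Qed.

Lemma ent_perm_mul n gs (A : op R n n) y x : gates_ok n gs -> all is_classical gs ->
  ent (gates_mx R n gs *m A) y x = \sum_z (y == bact gs z)%:R * ent A z x.
Proof.
by move=> og cl; rewrite ent_mul; apply: eq_bigr => z _; rewrite ent_classical.
Qed.

Lemma ent_mul_perm n gs (A : op R n n) y x : gates_ok n gs -> all is_classical gs ->
  ent (A *m gates_mx R n gs) y x = ent A y (bact gs x).
Proof.
move=> og cl; rewrite ent_mul; under eq_bigr => z _ do rewrite ent_classical // mulrC.
exact: (sum_permutation _ (fun z => ent A y z)).
Qed.

Lemma sum_delta (T : finType) (V : pzRingType) (a : T) (f : T -> V) :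
  \sum_z (a == z)%:R * f z = f a.
Proof.
rewrite (bigD1 a) //= eqxx mul1r big1 ?addr0 // => z /negbTE h.
by rewrite eq_sym h mul0r.
Qed.

(** * Deferred measurement of an output register *)

Section Measure.
Variables (n s : nat) (o cp : seq nat) (Mid : op R n n).
Hypotheses (so : size o = s) (scp : size cp = s) (okc : wires_ok n (iota 0 s ++ cp)).
Hypotheses (oko : wires_ok n o) (ocp : forall i, i \in o -> i \notin cp).

(** The output [o] is copied onto the zero wires [cp], and the copy is moved to the front, where the
    output register is read. The originals stay among the discarded qubits, which amounts to a
    measurement. *)
Definition measure_gates := copies o cp ++ swaps (iota 0 s) cp.

Let okg : gates_ok n measure_gates.
Proof.
move: okc => /andP[_]; rewrite all_cat => /andP[_ hcp].
rewrite /measure_gates /gates_ok all_cat; apply/andP; split.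
  by apply: gates_ok_copies; rewrite ?so // (andP oko).2.
by apply: gates_ok_swaps; rewrite ?size_iota.
Qed.

Let clg : all is_classical measure_gates.
Proof. by rewrite all_cat copies_classical swaps_classical. Qed.

Let ucp : uniq cp.
Proof. by move: okc => /andP[]; rewrite cat_uniq => /and3P[]. Qed.

Let dcp i : i \in cp -> (i < s)%N = false.
Proof.
move: okc => /andP[]; rewrite cat_uniq => /and3P[_ /hasPn h _] _ /h.
by rewrite /= mem_iota /= add0n => /negbTE.
Qed.

Let actE (Z : bits n) (i : nat) : (forall j, j \in cp -> nth false Z j = false) ->
  nth false (bact measure_gates Z) i =
  if (i < s)%N then nth false Z (nth 0%N o i)
  else if i \in cp then nth false Z (index i cp) else nth false Z i.
Proof.
move=> hZ; rewrite nth_bact // cact_cat.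
rewrite cact_swaps ?size_iota //; last by case/andP: okc.
rewrite mem_iota /= add0n.
have cE := cact_copies (nth false Z) _ (etrans so (esym scp)) ucp ocp.
case: ifP => his.
  rewrite index_iotaE // subn0 cE mem_nth ?scp // index_uniq ?scp //.
  by rewrite (hZ (nth 0%N cp i)) ?addbF // mem_nth ?scp.
case: ifP => hic; last by rewrite cE hic.
have hx : (index i cp < s)%N by rewrite -scp index_mem.
rewrite cE nth_iota // add0n.
by case: ifP => // /dcp; rewrite hx.
Qed.

(** The discarded qubits still contain the output, so no coherence between different outputs
    survives: hence the factor [y == y']. The two hypotheses say that [cp] is still zero when the
    copy is made. *)
Lemma measure_out (y : bits s) (x : bits n) (y' : bits s) (x' : bits n) :
  (forall (Y : bits n) j, j \in cp -> nth false Y j -> ent Mid Y x = 0) ->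
  (forall (Y : bits n) j, j \in cp -> nth false Y j -> ent Mid Y x' = 0) ->
  out_choi (gates_mx R n measure_gates *m Mid) y x y' x' =
  (y == y')%:R * \sum_(Y | sel o s Y == y) ent Mid Y x * (ent Mid Y x')^*.
Proof.
move=> hx hx'.
have ok0 : wires_ok n (iota 0 s).
  move: okc => /andP[]; rewrite cat_uniq all_cat => /andP[u _] /andP[h _].
  by rewrite /wires_ok u.
have supp (Z X : bits n) : (forall (Y : bits n) j, j \in cp -> nth false Y j -> ent Mid Y X = 0) ->
    ent Mid Z X = 0 \/ forall j, j \in cp -> nth false Z j = false.
  move=> h; have [/hasP[j jc Zj]|/hasPn hn] := boolP (has (nth false Z) cp).
    by left; apply: h Zj.
  by right => j /hn /negbTE.
have selo (Z : bits n) : (forall j, j \in cp -> nth false Z j = false) ->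
    sel (iota 0 s) s (bact measure_gates Z) = sel o s Z.
  move=> hZ; apply: bits_eqP => i hi.
  by rewrite nth_sel_iota // nth_sel // hi actE // add0n hi.
(* The discarded qubits determine all of [Z]: its first [s] bits have been swapped into [cp], and
   [cp] itself held zeros. Cross terms between distinct [Z] and [Z'] therefore vanish. *)
have agz (Z Z' : bits n) : (forall j, j \in cp -> nth false Z j = false) ->
    (forall j, j \in cp -> nth false Z' j = false) ->
    agree (iota 0 s) (bact measure_gates Z) (bact measure_gates Z') -> Z = Z'.
  move=> hZ hZ' /agreeP h; apply: bits_eqP => i hi.
  have [his|his] := ltnP i s.
    have /h : nth 0%N cp i \notin iota 0 s.
      by rewrite mem_iota /= add0n dcp // mem_nth ?scp.
    by rewrite !actE // dcp ?mem_nth ?scp // index_uniq ?scp.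
  case: (boolP (i \in cp)) => ic; first by rewrite hZ ?hZ'.
  have := h i; rewrite mem_iota /= add0n !actE // ltnNge his /= (negbTE ic).
  by apply.
rewrite /out_choi.
(* The kernel [G] turns the single sum of [out_choi] into one over independent [Y] and [Y'], so that
   the permutation can be undone in each variable separately. *)
pose G (Y Y' : bits n) : C := (sel (iota 0 s) s Y == y)%:R * ((sel (iota 0 s) s Y' == y')%:R *
  (agree (iota 0 s) Y Y')%:R).
transitivity (\sum_(Z : bits n) \sum_(Z' : bits n) G (bact measure_gates Z) (bact measure_gates Z') *
    (ent Mid Z x * (ent Mid Z' x')^*)).
  transitivity (\sum_(Y : bits n) \sum_(Y' : bits n) G Y Y' * (ent (gates_mx R n measure_gates *m Mid) Y x *
      (ent (gates_mx R n measure_gates *m Mid) Y' x')^*)).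
    rewrite big_mkcond /=; apply: eq_bigr => Y _; rewrite /G.
    case: eqP => hY; last by rewrite big1 // => Y' _; rewrite !mul0r.
    rewrite (bigD1 (put (iota 0 s) Y y')) //= big1 ?addr0.
      by rewrite (@sel_put _ _ s) ?size_iota // eqxx agree_sym agree_put !mul1r.
    move=> Y' nY'; case: eqP => hY'; last by rewrite mul0r mulr0 mul0r.
    case: (boolP (agree _ _ _)) => ag; last by rewrite !mulr0 mul0r.
    move: nY'; rewrite -hY' agree_putE ?size_iota ?eqxx //.
    by rewrite agree_sym.
  transitivity (\sum_(Y : bits n) \sum_(Y' : bits n) \sum_(Z : bits n) \sum_(Z' : bits n) (Y == bact measure_gates Z)%:R *
      ((Y' == bact measure_gates Z')%:R * (G Y Y' * (ent Mid Z x * (ent Mid Z' x')^*)))).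
    apply: eq_bigr => Y _; apply: eq_bigr => Y' _.
    rewrite !ent_perm_mul // rmorph_sum /= big_distrlr /= mulr_sumr.
    apply: eq_bigr => Z _; rewrite mulr_sumr; apply: eq_bigr => Z' _.
    rewrite rmorphM /= conjC_nat; ring.
  under eq_bigr => Y _ do rewrite exchange_big /=.
  rewrite exchange_big /=; apply: eq_bigr => Z _.
  under eq_bigr => Y _ do (rewrite exchange_big /=; under eq_bigr => Z' _ do rewrite -mulr_sumr sum_permutation).
  by rewrite exchange_big /=; apply: eq_bigr => Z' _; rewrite sum_permutation.
transitivity (\sum_(Z : bits n) ((sel o s Z == y) && (y == y'))%:R * (ent Mid Z x * (ent Mid Z x')^*)); last first.
  rewrite mulr_sumr [RHS]big_mkcond /=; apply: eq_bigr => Z _.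
  by case: eqP => _; rewrite /= ?mul0r.
apply: eq_bigr => Z _; have [->|hZ] := supp Z x hx.
  by rewrite mul0r mulr0 big1 // => Z' _; rewrite mul0r mulr0.
rewrite (bigD1 Z) //= big1 ?addr0.
  rewrite /G agree_refl selo // mulr1 -natrM mulnb; congr (_%:R * _).
  by case: eqP => // ->.
move=> Z' nZ; have [->|hZ'] := supp Z' x' hx'; first by rewrite conjC0 !mulr0.
rewrite /G; case: (boolP (agree _ _ _)) => ag; last by rewrite !mulr0 mul0r.
by rewrite (agz _ _ hZ hZ' ag) eqxx in nZ.
Qed.

End Measure.

(* The instrument with operators [k e], in the format of an oracle. *)
Definition oracle_ops (a s : nat) (E : finType) (k : E -> op R s a) :
  seq (op R (a + s) (a + s)) :=
  [seq opmx (fun y x =>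
     if (take a y == nseq a false) && (drop a x == ge.1 :> seq bool)
     then ent (k ge.2) (pad s (drop a y)) (pad a x)
     else 0) | ge : bits s * E].

(** Summing over the discarded content [ge.1] of the response register leaves only the terms where
    [x] and [x'] carry the same content there. *)
Lemma choi_oracle_ops a s (E : finType) (k : E -> op R s a) y x y' x' :
  choi (oracle_ops k) y x y' x' =
  if [&& take a y == nseq a false, take a y' == nseq a false
       & drop a x == drop a x' :> seq bool]
  then \sum_(e : E) ent (k e) (pad s (drop a y)) (pad a x) *
         (ent (k e) (pad s (drop a y')) (pad a x'))^*
  else 0.
Proof.
rewrite /choi /oracle_ops big_map big_enum /=.
under eq_bigr => ge _ do rewrite !ent_opmx.
have sd (z : bits (a + s)) : size (drop a z) == s by rewrite size_drop_tuple.
case: ifP => [/and3P[-> -> /eqP dx]|h].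
  rewrite (eq_bigr (fun ge : bits s * E => ((Tuple (sd x)) == ge.1)%:R *
    (ent (k ge.2) (pad s (drop a y)) (pad a x) * (ent (k ge.2) (pad s (drop a y')) (pad a x'))^*))).
    rewrite -(pair_big predT predT (fun (g : bits s) e => (Tuple (sd x) == g)%:R *
      (ent (k e) (pad s (drop a y)) (pad a x) * (ent (k e) (pad s (drop a y')) (pad a x'))^*))) /=.
    under eq_bigr => g _ do rewrite -mulr_sumr.
    by rewrite sum_delta.
  move=> [g e] _ /=; rewrite -dx -(inj_eq val_inj) /=.
  by case: eqP => _; rewrite ?mul1r ?mul0r.
rewrite big1 // => [[g e]] _ /=.
case: (take a y == _) h => /= h; last by rewrite mul0r.
case: (take a y' == _) h => /= h; last by rewrite conjC0 mulr0.
case: (drop a x =P _) => [gx|_]; last by rewrite mul0r.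
case: (drop a x' =P _) => [gx'|_]; last by rewrite conjC0 mulr0.
by rewrite gx gx' eqxx in h.
Qed.

Lemma oracle_ops_channel a s (E : finType) (k : E -> op R s a) :
  (forall x x', \sum_(y : bits s) \sum_(e : E) ent (k e) y x * (ent (k e) y x')^* = (x == x')%:R) ->
  is_channel (oracle_ops k).
Proof.
move=> h; apply/is_channelP => x x'.
under eq_bigr => y _ do rewrite choi_oracle_ops.
pose cat0 (v : bits s) : bits (a + s) := [tuple of nseq a false ++ v].
have dc v : drop a (cat0 v) = v by rewrite /= drop_size_cat ?size_nseq.
have tc v : take a (cat0 v) = nseq a false by rewrite /= take_size_cat ?size_nseq.
have pv (v : bits s) : pad s v = v by apply: bits_eqP => i hi; rewrite nth_pad hi.
have -> : (x == x') = (pad a x == pad a x') && (drop a x == drop a x' :> seq bool).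
  apply/eqP/andP => [-> //|[/eqP e1 /eqP e2]]; apply: bits_eqP => i hi.
  have [hia|hia] := ltnP i a.
    by have := congr1 (fun t : bits a => nth false t i) e1; rewrite !nth_pad hia.
  by rewrite -(subnKC hia) -!nth_drop e2.
case: (boolP (drop a x == drop a x' :> seq bool)) => dx; last first.
  by rewrite big1 ?andbF // => y _; rewrite !andbF.
rewrite andbT -h -big_mkcond /=.
rewrite (reindex_onto cat0 (fun y : bits (a + s) => pad s (drop a y))) /=.
  apply: eq_big => [v|v _]; first by rewrite take_size_cat ?size_nseq // eqxx dc pv eqxx.
  by rewrite drop_size_cat ?size_nseq // pv.
move=> y /andP[/eqP ty _]; apply: bits_eqP => i hi.
rewrite /= -ty nth_cat size_take_tuple.
case: ltnP => hia; first by rewrite nth_take.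
rewrite nth_pad nth_drop subnKC //; case: ltnP => //; lia.
Qed.

Lemma conj_sum_unitary n (U : op R n n) x x' : U \is unitarymx ->
  \sum_(z : bits n) ent U z x * (ent U z x')^* = (x == x')%:R.
Proof.
rewrite -trmxC_unitary => /unitarymxP; rewrite trmxCK => h.
rewrite eq_sym -ent1 -h ent_mul; apply: eq_bigr => z _.
by rewrite ent_adj mulrC.
Qed.

Lemma pad_inj k n (x x' : bits k) : (k <= n)%N -> pad n x = pad n x' -> x = x'.
Proof.
move=> kn e; apply: bits_eqP => i hi.
have := congr1 (fun t : bits n => nth false t i) e.
by rewrite !nth_pad (leq_trans hi kn).
Qed.

Lemma kraus_oracle_channel n a s (U : op R n n) : U \is unitarymx ->
  (a <= n)%N -> (s <= n)%N ->
  is_channel (oracle_ops (fun e : bits (n - s) => kraus a U [::] e : op R s a)).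
Proof.
move=> uU an sn; apply: oracle_ops_channel => x x'.
have ok0 : wires_ok n (iota 0 s) by apply: wires_ok_iota.
under eq_bigr => y _ do rewrite kraus_choi //.
have -> : (x == x') = (pad n x == pad n x').
  by apply/eqP/eqP => [-> //|/(pad_inj an)].
rewrite -(conj_sum_unitary _ _ uU).
rewrite [RHS](partition_big (sel (iota 0 s) s) predT) //=.
apply: eq_bigr => y _; apply: eq_bigr => Y /eqP <-.
by rewrite put_sel // size_iota.
Qed.

End Output.

(** * The adversaries *)

Section UniformCircuit.
Variable R : realType.
Local Notation C := R[i].

(** Hadamard gates on zero wires followed by a measurement: [s] coin flips, while the input is
    thrown away. The copy register starts at [a + s] to be disjoint from both the input and the
    output wires. *)
Definition uniform_circuit (a s : nat) : circuit :=
  Circuit (a + s + s + s)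
    (hgates (iota (a + s + s) s) ++
     measure_gates s (iota (a + s + s) s) (iota (a + s) s)).

Lemma measure_ok n s o cp : size o = s -> size cp = s ->
  wires_ok n (iota 0 s ++ cp) -> wires_ok n o -> (forall i, i \in o -> i \notin cp) ->
  gates_ok n (measure_gates s o cp).
Proof.
move=> so scp okc oko ocp.
move: (okc) => /andP[_]; rewrite all_cat => /andP[_ hcp].
rewrite /measure_gates /gates_ok all_cat; apply/andP; split.
  by apply: gates_ok_copies; rewrite ?so // (andP oko).2.
by apply: gates_ok_swaps; rewrite ?size_iota.
Qed.

Lemma size_measure s o cp : size o = s -> (size (measure_gates s o cp) <= 4 * s)%N.
Proof.
move=> so; rewrite size_cat; have := size_copies o cp; have := size_swaps (iota 0 s) cp.
rewrite size_iota so; lia.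
Qed.

Lemma gates_ok_hgates n rr : wires_ok n rr -> gates_ok n (hgates rr).
Proof.
rewrite /wires_ok /gates_ok /hgates all_map => /andP[_]; apply: sub_all => i hi /=.
by rewrite /wires_ok /= hi.
Qed.

Lemma wires_ok_cat_iota n i k j l : (i + k <= j)%N -> (j + l <= n)%N ->
  wires_ok n (iota i k ++ iota j l).
Proof.
move=> h1 h2; rewrite /wires_ok cat_uniq !iota_uniq /= andbT all_cat.
apply/and3P; split.
- by apply/hasPn => w /=; rewrite !mem_iota; lia.
- by apply/allP => w; rewrite mem_iota; lia.
- by apply/allP => w; rewrite mem_iota; lia.
Qed.

Lemma uniform_circuit_ok a s : circuit_ok a s (uniform_circuit a s).
Proof.
apply/and3P; split => /=; [lia|lia|].
rewrite all_cat; apply/andP; split; first exact/gates_ok_hgates/wires_ok_iota.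
apply: measure_ok; rewrite ?size_iota //.
- by apply: wires_ok_cat_iota; lia.
- by apply: wires_ok_iota.
- by move=> i; rewrite !mem_iota; lia.
Qed.

Lemma size_uniform_circuit a s : (size (c_gates (uniform_circuit a s)) <= 5 * s)%N.
Proof.
rewrite /= size_cat size_map size_iota.
have := @size_measure s (iota (a + s + s) s) (iota (a + s) s); rewrite size_iota => /(_ erefl).
lia.
Qed.

Lemma sqrt2X_sqr k : ((Num.sqrt 2%:R)^-1%:C%C : C) ^+ k * (((Num.sqrt 2%:R)^-1%:C%C : C) ^+ k)^* = 2%:R ^- k.
Proof. by rewrite rmorphXn /= conj_sqrt2 -exprMn sqrt2_sqr exprVn. Qed.

Lemma uniform_choi a s (y : bits s) (x : bits a) (y' : bits s) (x' : bits a) :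
  let c := uniform_circuit a s in
  out_choi (circuit_mx R c) y (pad (c_width c) x) y' (pad (c_width c) x') =
  (y == y')%:R * (x == x')%:R * 2%:R ^- s.
Proof.
rewrite /=; set n := (a + s + s + s)%N.
have okr : wires_ok n (iota (a + s + s) s) by apply: wires_ok_iota.
have xz (z : bits a) : all (fun w => ~~ nth false (pad n z) w) (iota (a + s + s) s).
  apply/allP => w; rewrite mem_iota => hw; rewrite nth_pad nth_bits_ge ?andbF //; lia.
have mid (z : bits a) (Y : bits n) j : j \in iota (a + s) s -> nth false Y j ->
    ent (gates_mx R n (hgates (iota (a + s + s) s))) Y (pad n z) = 0.
  move=> jc Yj; rewrite ent_hgates //; case: agreeP => h; last by rewrite mul0r.
  move: jc Yj; rewrite !mem_iota => jc; rewrite h ?mem_iota; last lia.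
  rewrite nth_pad nth_bits_ge ?andbF //; lia.
rewrite -[circuit_mx _ _]/(gates_mx R n (hgates _ ++ _)) gates_mx_cat measure_out ?size_iota //;
  first last.
- exact: mid.
- exact: mid.
- by move=> i; rewrite !mem_iota; lia.
- by apply: wires_ok_cat_iota; lia.
rewrite -mulrA; congr (_ * _).
under eq_bigr => Y _ do rewrite !ent_hgates // rmorphM /= conjC_nat mulrACA sqrt2X_sqr -natrM mulnb.
rewrite size_iota -mulr_suml; congr (_ * _).
rewrite (bigD1 (put (iota (a + s + s) s) (pad n x) y)) /=; last first.
  by rewrite (sel_put okr) ?size_iota.
rewrite big1 ?addr0.
  congr (_%:R); rewrite agree_put //=; congr nat_of_bool.
  apply/agreeP/eqP => [h|->].
    apply: bits_eqP => i hi.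
    have := h i; rewrite nth_put !nth_pad mem_iota.
    have -> : ((a + s + s <= i) && (i < a + s + s + s))%N = false by lia.
    have -> : (i < n)%N by rewrite /n; lia.
    by apply.
  by move=> i hi; rewrite nth_put (negbTE hi); case: ltnP => // hn; rewrite nth_bits_ge.
move=> Y /andP[/eqP sY nY]; case: (boolP (agree _ Y (pad n x))) => //= ag.
by rewrite -sY agree_putE ?size_iota ?eqxx // in nY.
Qed.

End UniformCircuit.

Ltac clia :=
  repeat match goal with
  | H : forall _, _ |- _ => clear H
  | H : is_true (wires_ok _ _) |- _ => clear H
  | H : is_true (gates_ok _ _) |- _ => clear H
  end; lia.

(** Once the output is measured only diagonal terms remain, and a final permutation merely moves the
    event [P]. *)
Lemma sum_classical_mul (R : realType) n gs (A : op R n n) (P : pred (bits n)) x x' :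
  gates_ok n gs -> all is_classical gs ->
  \sum_(Y | P Y) ent (gates_mx R n gs *m A) Y x * (ent (gates_mx R n gs *m A) Y x')^* =
  \sum_(Z | P (bact gs Z)) ent A Z x * (ent A Z x')^*.
Proof.
move=> og cl; rewrite (reindex_inj (bact_inj og)) /=.
have e Z u : ent (gates_mx R n gs *m A) (bact gs Z) u = ent A Z u.
  rewrite ent_perm_mul //; under eq_bigr => Z' _ do rewrite (inj_eq (bact_inj og)).
  exact: sum_delta.
by apply: eq_bigr => Z _; rewrite !e.
Qed.

(** * The circuit of the first-stage adversary *)

Section EncryptingCircuit.
Variable R : realType.
Local Notation C := R[i].
Variables (pk ct sk msg B w : nat) (cd : circuit).
Variables (f : seq bool -> nat -> bool) (T : nat -> seq bool -> nat -> bool).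
(** Wires: the input (pk, ct) from 0, the copy register [cp] from [a + s], the looked-up key from
    [o1] and the ancillas of the decryption after it, the random string r from [o2], the constant
    [one], and the lookup ancillas [tanc]. The list [dw] presents key, ciphertext and ancillas in
    the order that [cd] expects, and [mw] is where [cd] leaves the message. *)
Let Wd := c_width cd.
Let a := (pk + ct)%N.
Let rn := (B * w)%N.
Let s := (rn + msg)%N.
Let o1 := (a + s + s)%N.
Let o2 := (o1 + sk + (Wd - (sk + ct)))%N.
Let one := (o2 + rn)%N.
Let tn := (maxn pk w).
Let n := (one + 1 + tn)%N.
Let cp := iota (a + s) s.
Let skw := iota o1 sk.
Let rr := iota o2 rn.
Let tanc := iota (one + 1) tn.
Let dw := skw ++ iota pk ct ++ iota (o1 + sk) (Wd - (sk + ct)).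
Let mw := take msg dw.
Let o := rr ++ mw.

Definition sk_gates := table f one (iota 0 pk) skw tanc.
Local Notation mask_table b := (table (T b) one (iota (o2 + b * w) w) mw tanc).

Definition mask_gates :=
  flatten [seq mask_table b | b <- iota 0 B].

Definition encrypting_circuit : circuit :=
  Circuit n (((((xgates one ++ hgates rr) ++ sk_gates) ++ map (relabel dw) (c_gates cd)) ++
    mask_gates) ++ measure_gates s o cp).

Definition mask_bits (r : seq bool) : bits msg :=
  [tuple \big[addb/false]_(b <- iota 0 B) T b [seq nth false r i | i <- iota (b * w) w] i | i < msg].

Definition masked (r : bits rn) (v : bits msg) (z : bits Wd) : bits s :=
  pad s (r ++ [seq nth false z i (+) nth false v i | i <- iota 0 msg]).

Definition dec_input (x : bits a) : bits Wd :=
  pad Wd ([seq f (take pk x) i | i <- iota 0 sk] ++ drop pk x).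

Local Notation dec_pair z x x' :=
  (ent (circuit_mx R cd) z (dec_input x) * (ent (circuit_mx R cd) z (dec_input x'))^*).

(* The measurement of [pk], followed by the decryption of [ct] with the
   tabulated secret key and by the output of the result masked with [v]. *)
Definition enc_kraus (r : bits rn) (v : bits msg) (e : bits pk * bits Wd) : op R s a :=
  opmx (fun y x => if (y == masked r v e.2) && (take pk x == e.1)
                   then ent (circuit_mx R cd) e.2 (dec_input x) else 0).

Hypothesis cd_ok : circuit_ok (sk + ct) msg cd.

Let hWd : (sk + ct <= Wd)%N. Proof. by case/and3P: cd_ok. Qed.
Let hmsg : (msg <= Wd)%N. Proof. by case/and3P: cd_ok. Qed.
Let hgd : gates_ok Wd (c_gates cd). Proof. by case/and3P: cd_ok. Qed.

Let sdw : size dw = Wd.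
Proof. by rewrite !size_cat !size_iota; have := hWd; clia. Qed.

Let mem_dw i : (i \in dw) = [|| (o1 <= i < o1 + sk)%N, (pk <= i < a)%N | (o1 + sk <= i < o2)%N].
Proof. by rewrite !mem_cat !mem_iota. Qed.

Let okdw : wires_ok n dw.
Proof.
apply/andP; split; last by apply/allP => i; rewrite mem_dw /n /one; clia.
rewrite !cat_uniq !iota_uniq /= andbT; apply/andP; split.
  by apply/hasPn => i /=; rewrite mem_cat !mem_iota /a /o1; clia.
by apply/hasPn => i /=; rewrite !mem_iota /o1 /a; clia.
Qed.

Let smw : size mw = msg. Proof. by rewrite size_takel ?sdw. Qed.
Let mw_dw i : i \in mw -> i \in dw. Proof. exact: mem_take. Qed.
Let umw : uniq mw. Proof. by apply: take_uniq; case/andP: okdw. Qed.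

Let not_dw i : (i < pk)%N || (a <= i < o1)%N || (o2 <= i)%N -> i \notin dw.
Proof. by rewrite mem_dw /o2 /o1 /a; clia. Qed.

Let not_mw i : (i < pk)%N || (a <= i < o1)%N || (o2 <= i)%N -> i \notin mw.
Proof. by move=> h; apply: contraNN (not_dw h); exact: mw_dw. Qed.

Let okrr : wires_ok n rr.
Proof. by apply: wires_ok_iota; rewrite /n /one; clia. Qed.

Let oko : wires_ok n o.
Proof.
rewrite /wires_ok /o cat_uniq umw iota_uniq all_cat /= andbT; apply/and3P; split.
- by apply/hasPn => i; apply: contraTN => /=; rewrite mem_iota => h; apply: not_mw; clia.
- by case/andP: okrr.
- by apply/allP => i /mw_dw; apply: (wires_lt okdw).
Qed.

Let one_lt : (one < n)%N. Proof. by rewrite /n; clia. Qed.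

Let block_in b : (b < B)%N -> (b * w + w <= rn)%N.
Proof. by move=> h; rewrite /rn -mulSnr leq_mul2r h orbT. Qed.

Lemma sk_gates_ok : gates_ok n sk_gates.
Proof.
apply: gates_ok_table; rewrite ?size_iota ?leq_maxl ?iota_uniq //.
- apply/allP => i; rewrite inE !mem_cat !mem_iota /n /one /o2 /o1 /a; clia.
- move=> i; rewrite inE !mem_iota /one /o2 /o1 /a => h; split; clia.
- move=> i; rewrite inE !mem_iota /one /o2 /o1 /a; clia.
- rewrite /= iota_uniq mem_iota /one /o2 /o1 /a andbT; clia.
Qed.

Lemma mask_table_ok b : (b < B)%N ->
  gates_ok n (mask_table b).
Proof.
move=> hb; have := block_in hb => hbw.
apply: gates_ok_table; rewrite ?size_iota ?leq_maxr ?iota_uniq //.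
- rewrite /= !all_cat one_lt /=; apply/and3P; split.
  + apply/allP => i; rewrite mem_iota /n /one; clia.
  + apply/allP => i /mw_dw; apply: (wires_lt okdw).
  + apply/allP => i; rewrite mem_iota /n; clia.
- move=> i; rewrite mem_iota => hi; split; first by rewrite inE !mem_iota /one; clia.
  by apply: not_mw; move: hi; rewrite /one; clia.
- by move=> i; rewrite inE !mem_iota => hi; apply: not_mw; move: hi; rewrite /one; clia.
- rewrite /= iota_uniq mem_iota /one andbT; clia.
Qed.

Lemma mask_gates_ok : gates_ok n mask_gates.
Proof.
rewrite /mask_gates.
have : all (fun b => b < B)%N (iota 0 B) by apply/allP => b; rewrite mem_iota.
elim: (iota 0 B) => //= b bs IH /andP[hb hbs].
by rewrite /gates_ok all_cat; apply/andP; split; [exact: mask_table_ok|exact: IH].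
Qed.

Lemma mask_gates_classical : all is_classical mask_gates.
Proof.
rewrite /mask_gates; elim: (iota 0 B) => //= b bs IH.
by rewrite all_cat table_classical.
Qed.

Let ocp i : i \in o -> i \notin cp.
Proof.
rewrite mem_cat /cp => /orP[|/mw_dw]; rewrite ?mem_dw !mem_iota /o2 /o1 /a; clia.
Qed.

Let okcp : wires_ok n (iota 0 s ++ cp).
Proof. by apply: wires_ok_cat_iota; rewrite /n /one /o2 /o1; clia. Qed.

Let scp : size cp = s. Proof. exact: size_iota. Qed.
Let so : size o = s. Proof. by rewrite size_cat size_iota smw. Qed.

Lemma encrypting_circuit_ok : circuit_ok a s encrypting_circuit.
Proof.
have gcat s1 s2 : gates_ok n s1 -> gates_ok n s2 -> gates_ok n (s1 ++ s2).
  by rewrite /gates_ok all_cat => -> ->.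
apply/and3P; split; rewrite -[c_width _]/n; try by rewrite /n /one /o2 /o1; clia.
have ox : gates_ok n (xgates one) by rewrite /gates_ok /= /wires_ok /= one_lt.
apply: (gcat ((((xgates one ++ hgates rr) ++ sk_gates) ++ map (relabel dw) (c_gates cd)) ++
  mask_gates) (measure_gates s o cp)); last exact: measure_ok.
apply: (gcat _ _); last exact: mask_gates_ok.
apply: (gcat _ _); last exact: gates_ok_relabel okdw sdw hgd.
apply: (gcat _ _); last exact: sk_gates_ok.
by apply: (gcat _ _); last exact: gates_ok_hgates okrr.
Qed.

(** The basis state just before decryption, in the branch where the random wires hold [r]. The last
    case sets the wire [one] and leaves every other wire at 0. *)
Let state (x : bits a) (r : bits rn) : bits n :=
  [tuple if (i < a)%N then nth false x i
         else if (o1 <= i < o1 + sk)%N then f (take pk x) (i - o1)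
         else if (o2 <= i < one)%N then nth false r (i - o2)
         else val i == one | i < n].

Let nth_state x r i : nth false (state x r) i =
  if (i < a)%N then nth false x i
  else if (o1 <= i < o1 + sk)%N then f (take pk x) (i - o1)
  else if (o2 <= i < one)%N then nth false r (i - o2)
  else i == one.
Proof.
have [h|h] := ltnP i n.
  by rewrite -[i in LHS]/(val (Ordinal h)) -tnth_nth tnth_mktuple.
rewrite nth_bits_ge //.
have := h; have := one_lt; rewrite /n /one /o2 /o1 => h1 h2.
have -> : (i < a)%N = false by clia.
have -> : (a + s + s <= i < a + s + s + sk)%N = false by clia.
have -> : (a + s + s + sk + (Wd - (sk + ct)) <= i < a + s + s + sk + (Wd - (sk + ct)) + rn)%N = false by clia.
by apply/esym/negbTE; clia.
Qed.

Let sel_rr_state x r : sel rr rn (state x r) = r.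
Proof.
apply: bits_eqP => i hi; rewrite nth_sel_iota // nth_state.
have -> : (o2 + i < a)%N = false by rewrite /o2 /o1; clia.
have -> : (o1 <= o2 + i < o1 + sk)%N = false by rewrite /o2 /o1; clia.
have -> : (o2 <= o2 + i < one)%N by rewrite /one; clia.
by rewrite addKn.
Qed.

Let sel_dw_state x r : sel dw Wd (state x r) = dec_input x.
Proof.
apply: bits_eqP => i hi; rewrite nth_sel // hi /dec_input nth_pad hi !andTb.
rewrite /dw !nth_cat !size_map !size_iota.
case: ltnP => h1.
  rewrite !nth_iota // nth_state.
  have -> : (o1 + i < a)%N = false by rewrite /o1; clia.
  have -> : (o1 <= o1 + i < o1 + sk)%N by clia.
  by rewrite addKn (nth_map 0%N) ?size_iota // nth_iota.
rewrite nth_drop; case: ltnP => h2.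
  by rewrite nth_iota // nth_state /a ltn_add2l h2.
rewrite nth_iota; last by clia.
rewrite nth_state.
rewrite [RHS]nth_bits_ge; last by rewrite /a; clia.
have -> : (o1 + sk + (i - sk - ct) < a)%N = false by rewrite /o1; clia.
have -> : (o1 <= o1 + sk + (i - sk - ct) < o1 + sk)%N = false by clia.
have -> : (o2 <= o1 + sk + (i - sk - ct) < one)%N = false by rewrite /one /o2; clia.
by apply/negbTE; rewrite /one /o2; clia.
Qed.

Let agree_state x x' r : agree dw (state x r) (state x' r) = (take pk x == take pk x').
Proof.
apply/agreeP/eqP => [h|h i hi].
  apply: (@eq_from_nth _ false); first by rewrite !size_take_tuple.
  move=> i; rewrite size_take_tuple => hi.
  have := h i; rewrite !nth_state !nth_take //.
  have -> : (i < a)%N by rewrite /a; clia.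
  by apply; apply: not_dw; rewrite hi.
rewrite !nth_state h.
case: ifP => // ia; case: (ltnP i pk) => hp.
  by rewrite -(nth_take false hp x) h nth_take.
by case/negP: hi; rewrite mem_dw hp ia orbT.
Qed.

Let start (x : bits a) : bits n := put [:: one] (pad n x) ([tuple true] : bits 1).

Let nth_start x i : nth false (start x) i = if i == one then true else nth false x i.
Proof.
rewrite nth_put inE nth_pad; case: eqP => [->|_]; first by rewrite one_lt /= eqxx.
case: ltnP => //= h; rewrite nth_default // size_tuple; apply: leq_trans h.
rewrite /n /one /o2 /o1; clia.
Qed.

Let ent_prepare (x : bits a) Z :
  ent (gates_mx R n (xgates one ++ hgates rr)) Z (pad n x) =
  (agree rr Z (start x))%:R * (Num.sqrt 2%:R)^-1%:C%C ^+ rn.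
Proof.
rewrite gates_mx_cat ent_mul.
have ok1 : wires_ok n [:: one] by rewrite /wires_ok /= one_lt.
have padz : nth false (pad n x) one = false.
  rewrite nth_pad nth_bits_ge ?andbF // /one /o2 /o1; clia.
rewrite (bigD1 (start x)) //= big1 ?addr0.
  rewrite ent_xgates // agree_put // nth_start eqxx padz eqxx mulr1 ent_hgates ?size_iota //.
  apply/allP => i; rewrite mem_iota => hi; rewrite nth_start.
  have -> : (i == one) = false by apply/negbTE; rewrite /one; clia.
  rewrite nth_bits_ge //; move: hi; rewrite /o2 /o1; clia.
move=> V nV; rewrite ent_xgates // padz; case: (boolP (agree _ _ _)) => ag; last by rewrite mulr0.
case: eqP => h; last by rewrite mulr0.
case/eqP: nV; rewrite /start -(@agree_putE _ [:: one] 1 erefl _ _ ag); congr (put _ _ _).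
by apply: bits_eqP => -[|j] // _; rewrite nth_sel.
Qed.

Let sk_state x (r : bits rn) : bact sk_gates (put rr (start x) r) = state x r.
Proof.
apply: bits_eqP => i hi; rewrite nth_bact ?sk_gates_ok //.
have nrr j : nth false (put rr (start x) r) j =
    if (o2 <= j < one)%N then nth false r (j - o2) else if j == one then true else nth false x j.
  rewrite nth_put nth_start mem_iota -/one.
  case: ltnP => hj /=.
    by case: ifP => // h; rewrite index_iotaE.
  have -> : (o2 <= j < one)%N = false by have := one_lt; clia.
  have -> : (j == one) = false by have := one_lt; clia.
  rewrite nth_bits_ge //; move: hj; rewrite /n /one /o2 /o1; clia.
rewrite cact_table ?size_iota ?leq_maxl ?iota_uniq //; first last.
- move=> j; rewrite inE !mem_iota /one /o2 /o1 /a; clia.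
- move=> j; rewrite inE !mem_iota => hj; split; try by move: hj; rewrite /one /o2 /o1 /a; clia.
  rewrite nrr.
  have -> : (o2 <= j < one)%N = false by clia.
  have -> : (j == one) = false by clia.
  rewrite nth_bits_ge //; move: hj; rewrite /one /o2 /o1; clia.
have mt : [seq nth false (put rr (start x) r) j | j <- iota 0 pk] = take pk x.
  apply: (@eq_from_nth _ false); rewrite size_map size_iota.
    by rewrite size_take_tuple.
  move=> j hj; rewrite (nth_map 0%N) ?size_iota // nth_iota // add0n nrr nth_take //.
  have -> : (o2 <= j < one)%N = false by move: hj; rewrite /o2 /o1 /a; clia.
  by have -> : (j == one) = false by move: hj; rewrite /one /o2 /o1 /a; clia.
rewrite mt nth_state mem_iota !nrr eqxx.
have -> : (o2 <= one < one)%N = false by clia.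
case: ifP => h1.
  rewrite index_iotaE //.
  have -> : (o2 <= i < one)%N = false by move: h1; rewrite /o2; clia.
  have -> : (i == one) = false by move: h1; rewrite /one /o2; clia.
  rewrite nth_bits_ge; last by move: h1; rewrite /o1; clia.
  by have -> : (i < a)%N = false by move: h1; rewrite /o1; clia.
case: (ltnP i a) => h2.
  have -> : (o2 <= i < one)%N = false by rewrite /o2 /o1; clia.
  by have -> : (i == one) = false by rewrite /one /o2 /o1; clia.
by case: ifP => // _; case: eqP => // _; rewrite nth_bits_ge.
Qed.

Let mid0 := gates_mx R n (((xgates one ++ hgates rr) ++ sk_gates) ++ map (relabel dw) (c_gates cd)).

(** The decryption does not touch the random wires, so only the branch whose [r] can be read off [Y]
    contributes. *)
Let ent_mid0 Y (x : bits a) : ent mid0 Y (pad n x) =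
  (Num.sqrt 2%:R)^-1%:C%C ^+ rn *
  ent (lift_op n dw (circuit_mx R cd)) Y (state x (sel rr rn Y)).
Proof.
rewrite /mid0 gates_mx_cat (gates_mx_relabel _ okdw sdw hgd) -[gates_mx _ _ (c_gates cd)]/(circuit_mx R cd).
rewrite gates_mx_cat mulmxA ent_mul.
under eq_bigr => Z _ do rewrite ent_mul_perm ?sk_gates_ok ?table_classical // ent_prepare mulrA [_ * _ * _]mulrC.
rewrite -mulr_sumr; congr (_ * _).
transitivity (\sum_(Z | agree rr Z (start x)) ent (lift_op n dw (circuit_mx R cd)) Y (bact sk_gates Z)).
  rewrite [RHS]big_mkcond /=; apply: eq_bigr => Z _.
  by case: ifP => _; rewrite ?mulr1 ?mulr0.
rewrite (sum_agree okrr (size_iota _ _)).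
under eq_bigr => r _ do rewrite sk_state.
rewrite (bigD1 (sel rr rn Y)) //= big1 ?addr0 // => r nr.
rewrite ent_lift; case: ifP => // /agreeP ag; case/eqP: nr.
rewrite -(sel_rr_state x r); apply: bits_eqP => i hi.
by rewrite !nth_sel_iota // ag // not_dw // leq_addr !orbT.
Qed.

(** A table lookup is correct only with clean ancillas and with [one] set; the nonzero amplitude
    guarantees both. *)
Let mask_act (Z : bits n) (x : bits a) : ent mid0 Z (pad n x) != 0 ->
  sel o s (bact mask_gates Z) = masked (sel rr rn Z) (mask_bits (sel rr rn Z)) (sel dw Wd Z).
Proof.
rewrite ent_mid0 mulf_eq0 negb_or => /andP[_]; rewrite ent_lift.
case: ifP => [/agreeP ag _|]; last by rewrite eqxx.
have zone : nth false Z one.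
  rewrite ag; last by apply: not_dw; rewrite /one leq_addr !orbT.
  rewrite nth_state eqxx ltnn andbF.
  have -> : (one < a)%N = false by rewrite /one /o2 /o1; clia.
  by have -> : (o1 <= one < o1 + sk)%N = false by rewrite /one /o2 /o1; clia.
have ztan i : i \in tanc -> nth false Z i = false.
  rewrite mem_iota => hi; rewrite ag; last by apply: not_dw; move: hi; rewrite /one; clia.
  rewrite nth_state.
  have -> : (i < a)%N = false by move: hi; rewrite /one /o2 /o1; clia.
  have -> : (o1 <= i < o1 + sk)%N = false by move: hi; rewrite /one /o2 /o1; clia.
  have -> : (o2 <= i < one)%N = false by clia.
  by apply/negbTE; clia.
have zr b : (b < B)%N -> [seq nth false Z i | i <- iota (o2 + b * w) w] =
    [seq nth false (sel rr rn Z) i | i <- iota (b * w) w].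
  move=> hb; have := block_in hb => hbw.
  rewrite iotaDl -map_comp; apply/eq_in_map => i; rewrite mem_iota => hi /=.
  by rewrite nth_sel_iota //; clia.
have main (y : nat -> bool) (bs : seq nat) : all (fun b => b < B)%N bs ->
    (forall i, i \notin mw -> y i = nth false Z i) -> forall i,
    cact (flatten [seq mask_table b | b <- bs]) y i =
    if i \in mw then y i (+) \big[addb/false]_(b <- bs)
       T b [seq nth false (sel rr rn Z) i | i <- iota (b * w) w] (index i mw) else y i.
  elim: bs y => [|b bs IH] y /=.
    by move=> _ _ i; rewrite big_nil addbF if_same.
  move=> /andP[hb hbs] hy i; have := block_in hb => hbw.
  have yone : y one by rewrite hy // not_mw // /one leq_addr !orbT.
  have E j : cact (mask_table b) y j =
      if j \in mw then y j (+) T b [seq nth false (sel rr rn Z) i | i <- iota (b * w) w] (index j mw)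
      else y j.
    rewrite cact_table ?size_iota ?leq_maxr ?iota_uniq //; first last.
    - by move=> k; rewrite inE !mem_iota => hk; apply: not_mw; move: hk; rewrite /one; clia.
    - move=> k hk; have hk' := hk; rewrite mem_iota in hk'.
      have km : k \notin mw by apply: not_mw; move: hk'; rewrite /one; clia.
      split => //; last by rewrite hy // ztan.
      by rewrite inE !mem_iota; move: hk'; rewrite /one; clia.
    rewrite yone -zr //; congr (if _ then _ (+) T b _ _ else _).
    apply/eq_in_map => k; rewrite mem_iota => hk; rewrite hy //.
    by apply: not_mw; clia.
  rewrite cact_cat IH //; last by move=> j hj; rewrite E (negbTE hj) hy.
  by rewrite E big_cons; case: (i \in mw) => //; rewrite addbA.
apply: bits_eqP => i hi; rewrite nth_sel // hi andTb nth_bact ?mask_gates_ok //.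
rewrite main //; last by apply/allP => b; rewrite mem_iota.
rewrite nth_pad hi andTb /o !nth_cat size_tuple size_iota.
case: ltnP => hr.
  rewrite nth_iota // (negbTE (not_mw _)); last by rewrite leq_addr !orbT.
  by rewrite nth_sel_iota.
have him : (i - rn < msg)%N by move: hi; rewrite /s; clia.
rewrite mem_nth ?smw // index_uniq ?smw // (nth_map 0%N) ?size_iota // nth_iota // add0n.
rewrite /mw nth_take // nth_sel //.
have -> : (i - rn < Wd)%N by have := hmsg; clia.
congr (_ (+) _).
by rewrite -[(i - rn)%N in RHS]/(val (Ordinal him)) -tnth_nth tnth_mktuple.
Qed.

Lemma enc_kraus_choi (r : bits rn) (v : bits msg) (y : bits s) (x : bits a) (y' : bits s) (x' : bits a) :
  \sum_e ent (enc_kraus r v e) y x * (ent (enc_kraus r v e) y' x')^* =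
  (y == y')%:R * \sum_(z : bits Wd) (y == masked r v z)%:R * ((take pk x == take pk x')%:R *
    dec_pair z x x').
Proof.
apply/esym.
rewrite mulr_sumr -(pair_big predT predT (fun p z => ent (enc_kraus r v (p, z)) y x *
  (ent (enc_kraus r v (p, z)) y' x')^*)) /= exchange_big /=.
apply: eq_bigr => z _.
have st (u : bits a) : size (take pk u) == pk by rewrite size_take_tuple.
transitivity (\sum_(p : bits pk) (Tuple (st x) == p)%:R * ((y == y')%:R * ((y == masked r v z)%:R *
  ((Tuple (st x') == p)%:R *
   dec_pair z x x')))).
  by rewrite sum_delta -(inj_eq val_inj) /= [take pk x == _]eq_sym.
have tp u p : (Tuple (st u) == p) = (take pk u == p) by rewrite -(inj_eq val_inj).
apply: eq_bigr => p _; rewrite !ent_opmx !tp -[(p, z).2]/z -[(p, z).1]/p.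
move: (masked _ _ _) => mz.
have [->|nyy'] := eqVneq y y'.
  case: (y' =P _) => [_|_] /=; last by rewrite !mul0r !mulr0.
  case: (take pk x == p) => /=; last by rewrite !mul0r.
  case: (take pk x' == p) => /=; last by rewrite mul0r conjC0 !mulr0.
  by rewrite !mul1r.
rewrite !mul0r !mulr0.
case: (y =P _) => [e|_] /=; last by rewrite mul0r.
by case: (y' =P _) => [e'|_] /=; [rewrite e e' eqxx in nyy'|rewrite conjC0 mulr0].
Qed.

(** The measured output contains [r], so the channel is a uniform mixture over [r] of fixed
    instruments. The decryption leaves the wires of pk alone and they are never returned, so pk is
    measured too; this accounts for the component [e.1] of [enc_kraus]. *)
Lemma encrypting_choi (y : bits s) (x : bits a) (y' : bits s) (x' : bits a) :
  out_choi (circuit_mx R encrypting_circuit) y (pad n x) y' (pad n x') =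
  2%:R ^- rn * \sum_(r : bits rn) \sum_e
    ent (enc_kraus r (mask_bits r) e) y x * (ent (enc_kraus r (mask_bits r) e) y' x')^*.
Proof.
rewrite -[circuit_mx _ _]/(gates_mx R n (_ ++ measure_gates s o cp)) gates_mx_cat.
(* No gate before the final measurement acts on the copy register, as [measure_out] requires. *)
have mid_cp (Y : bits n) (z : bits a) j : j \in cp -> nth false Y j ->
    ent (gates_mx R n ((((xgates one ++ hgates rr) ++ sk_gates) ++ map (relabel dw) (c_gates cd)) ++
    mask_gates)) Y (pad n z) = 0.
  move=> jc Yj; rewrite gates_mx_cat ent_perm_mul ?mask_gates_ok ?mask_gates_classical //.
  rewrite big1 // => Z _; case: eqP => hY; last by rewrite mul0r.
  rewrite mul1r -/mid0 ent_mid0 ent_lift; case: ifP => [/agreeP ag|_]; last by rewrite mulr0.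
  have jm : all (fun g => j \notin gate_wires g) mask_gates.
    rewrite mem_iota in jc.
    rewrite /mask_gates.
    have : all (fun b => b < B)%N (iota 0 B) by apply/allP => b; rewrite mem_iota.
    elim: (iota 0 B) => //= b bs IH /andP[hb hbs]; have := block_in hb => hbw.
    rewrite all_cat IH // andbT table_wires // inE !mem_cat !mem_iota !negb_or.
    rewrite not_mw; last by move: jc; rewrite /o1; clia.
    by move: jc; rewrite /one /o2 /o1; clia.
  move: Yj; rewrite hY nth_bact ?mask_gates_ok // cact_out //.
  move: jc; rewrite mem_iota => jc.
  rewrite ag; last by apply: not_dw; move: jc; rewrite /o1; clia.
  rewrite nth_state.
  have -> : (j < a)%N = false by clia.
  have -> : (o1 <= j < o1 + sk)%N = false by rewrite /o1; clia.
  have -> : (o2 <= j < one)%N = false by rewrite /o2 /o1; clia.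
  by move/eqP => e; move: jc; rewrite e /one /o2 /o1; clia.
rewrite measure_out //; last first.
- by move=> Y j; apply: mid_cp.
- by move=> Y j; apply: mid_cp.
transitivity ((y == y')%:R * (2%:R ^- rn * \sum_(r : bits rn) \sum_(z : bits Wd)
  (y == masked r (mask_bits r) z)%:R * ((take pk x == take pk x')%:R *
    dec_pair z x x'))).
  congr (_ * _); rewrite (gates_mx_cat R n _ mask_gates).
  rewrite (@sum_classical_mul R n mask_gates _ (fun Y => sel o s Y == y)) ?mask_gates_ok ?mask_gates_classical // -/mid0.
  transitivity (\sum_(Z : bits n) \sum_(r : bits rn) 2%:R ^- rn *
     (if agree dw Z (state x r) then
     (y == masked r (mask_bits r) (sel dw Wd Z))%:R * ((take pk x == take pk x')%:R *
      (ent (circuit_mx R cd) (sel dw Wd Z) (dec_input x) *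
       (ent (circuit_mx R cd) (sel dw Wd Z) (dec_input x'))^*)) else 0)).
    rewrite big_mkcond /=; apply: eq_bigr => Z _.
    set r0 := sel rr rn Z.
    have hag r : agree dw Z (state x r) -> r = r0.
      move=> /agreeP ag; rewrite -(sel_rr_state x r); apply: bits_eqP => i hi.
      by rewrite /r0 !nth_sel_iota // ag // not_dw // leq_addr !orbT.
    rewrite (bigD1 r0) //= [X in _ + X]big1 ?addr0; last first.
      move=> r nr; case: ifP => [/hag e|_]; last by rewrite mulr0.
      by rewrite e eqxx in nr.
    have [z0|nz] := eqVneq (ent mid0 Z (pad n x)) 0.
      rewrite z0 mul0r if_same; move/eqP: z0.
      rewrite ent_mid0 ent_lift -/r0 sel_dw_state; case: ifP => _; last by rewrite !mulr0.
      rewrite mulf_eq0 expf_eq0; case/orP => [/andP[_ /eqP h]|/eqP ->]; last first.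
        by rewrite mul0r !mulr0.
      by have /eqP := @sqrt2_sqr R; rewrite h mul0r eq_sym invr_eq0 pnatr_eq0.
    rewrite (mask_act nz) -/r0; move: nz.
    rewrite !ent_mid0 !ent_lift -/r0 !sel_dw_state; case: ifP => [ag _|]; last by rewrite mulr0 eqxx.
    have -> : agree dw Z (state x' r0) = (take pk x == take pk x').
      rewrite -(agree_state x x' r0); apply/idP/idP => [h|h].
        by apply: agree_trans h; rewrite agree_sym.
      exact: agree_trans h.
    rewrite eq_sym rmorphM /= mulrACA sqrt2X_sqr.
    case: (y == _); last by rewrite mul0r mulr0.
    rewrite mul1r; congr (_ * _).
    by case: (take pk x == _); rewrite ?mul1r // conjC0 mulr0 mul0r.
  rewrite exchange_big mulr_sumr /=; apply: eq_bigr => r _.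
  rewrite -mulr_sumr -big_mkcond /=; congr (_ * _).
  rewrite (sum_agree okdw sdw); apply: eq_bigr => z _.
  by rewrite (sel_put okdw sdw).
rewrite mulrCA; congr (_ * _); rewrite mulr_sumr; apply: eq_bigr => r _.
by rewrite enc_kraus_choi.
Qed.

Let dec_unitary : circuit_mx R cd \is unitarymx.
Proof. exact: (@gates_unitary R _ (c_gates cd) hgd). Qed.

Let sum_dec (x x' : bits a) : \sum_(z : bits Wd) (take pk x == take pk x')%:R *
    dec_pair z x x' =
  (x == x')%:R.
Proof.
rewrite -mulr_sumr conj_sum_unitary // -natrM mulnb; congr (_%:R); congr nat_of_bool.
apply/andP/eqP => [[/eqP e1 /eqP e2]|-> //].
apply: bits_eqP => i hi; case: (ltnP i pk) => h.
  by rewrite -(nth_take false h x) e1 nth_take.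
have := congr1 (fun t : bits Wd => nth false t (sk + (i - pk))) e2.
rewrite !nth_pad !nth_cat !size_map !size_iota.
have -> : (sk + (i - pk) < Wd)%N by have := hWd; move: hi; rewrite /a; clia.
have -> : (sk + (i - pk) < sk)%N = false by clia.
by rewrite addKn !nth_drop subnKC.
Qed.

Lemma enc_kraus_channel r v (x x' : bits a) :
  \sum_(y : bits s) \sum_e ent (enc_kraus r v e) y x * (ent (enc_kraus r v e) y x')^* =
  (x == x')%:R.
Proof.
under eq_bigr => y _ do rewrite enc_kraus_choi eqxx mul1r.
rewrite exchange_big /= -sum_dec; apply: eq_bigr => z _.
by rewrite -mulr_suml (eq_bigr (fun y => (masked r v z == y)%:R * 1)) ?sum_delta ?mul1r // => y _;
  rewrite mulr1 eq_sym.
Qed.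

(** One-time pad: for a given [z], exactly one pair of a string [r] and a mask [v] produces the
    output [y]. *)
Let sum_masked (y : bits s) (z : bits Wd) :
  \sum_(r : bits rn) \sum_(v : bits msg) (y == masked r v z)%:R = 1 :> C.
Proof.
rewrite pair_big /=.
pose v0 : bits msg := [tuple nth false z i (+) nth false y (rn + i) | i < msg].
have nv0 i : (i < msg)%N -> nth false v0 i = nth false z i (+) nth false y (rn + i).
  by move=> hi; rewrite -[i in LHS]/(val (Ordinal hi)) -tnth_nth tnth_mktuple.
have nm r v i : (i < s)%N -> nth false (masked r v z) i =
    if (i < rn)%N then nth false r i else nth false z (i - rn) (+) nth false v (i - rn).
  move=> hi; rewrite nth_pad hi /= nth_cat size_tuple; case: ltnP => // h.
  have hm : (i - rn < msg)%N by move: hi; rewrite /s; clia.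
  by rewrite (nth_map 0%N) ?size_iota // nth_iota.
rewrite (bigD1 (pad rn y, v0)) //= big1 ?addr0.
  have -> : y == masked (pad rn y) v0 z; last by [].
  apply/eqP/bits_eqP => i hi; rewrite nm //; case: ltnP => h; first by rewrite nth_pad h.
  rewrite nv0; last by move: hi; rewrite /s; clia.
  by rewrite addKb subnKC.
move=> [r v] /= nrv; case: eqP => // e; case/eqP: nrv; congr (_, _); apply: bits_eqP => i hi.
  rewrite nth_pad hi e nm ?hi //; by rewrite /s; clia.
rewrite nv0 // e nm; last by rewrite /s; clia.
have -> : (rn + i < rn)%N = false by clia.
by rewrite addKn addKb.
Qed.

(** By [sum_masked] an independent mask makes the output carry no information on [z]; the sum over
    [z] is then free and unitarity of the decryption traces the input out. Up to normalization this
    is the channel of [uniform_choi]. *)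
Lemma enc_kraus_average (y : bits s) (x : bits a) (y' : bits s) (x' : bits a) :
  \sum_(r : bits rn) \sum_(v : bits msg)
    \sum_e ent (enc_kraus r v e) y x * (ent (enc_kraus r v e) y' x')^* =
  (y == y')%:R * (x == x')%:R.
Proof.
under eq_bigr => r _ do under eq_bigr => v _ do rewrite enc_kraus_choi.
under eq_bigr => r _ do rewrite -mulr_sumr exchange_big /=.
rewrite -mulr_sumr exchange_big /= -sum_dec; congr (_ * _); apply: eq_bigr => z _.
under eq_bigr => r _ do rewrite -mulr_suml.
by rewrite -mulr_suml sum_masked mul1r.
Qed.

Lemma size_encrypting_circuit :
  (size (c_gates encrypting_circuit) <=
   6 + rn + 2 ^ pk * (sk + 2) + size (c_gates cd) + B * (2 ^ w * (msg + 2)) + 4 * s)%N.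
Proof.
rewrite /= !size_cat !size_map size_iota.
have h1 : (size sk_gates <= 2 ^ pk * (sk + 2))%N.
  rewrite /sk_gates; have := size_table f one (iota 0 pk) skw tanc; rewrite /skw !size_iota.
  set u := (_ * _)%N; clia.
have h2 : (size mask_gates <= B * (2 ^ w * (msg + 2)))%N.
  rewrite /mask_gates -[in X in (_ <= X)%N](size_iota 0 B); elim: (iota 0 B) => //= b bs IH.
  rewrite size_cat mulSn; apply: leq_add => //.
  have := size_table (T b) one (iota (o2 + b * w) w) mw tanc; rewrite !size_iota smw; clia.
have := @size_measure s o cp so; rewrite /measure_gates size_cat; clia.
Qed.

End EncryptingCircuit.

(** * Implementing an oracle by gates *)

Section Elimination.
Variable R : realType.
Local Notation C := R[i].

Lemma ent_channel_lift n ws k (Ks : seq (op R k k)) (rho : op R n n) z z' :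
  wires_ok n ws -> size ws = k ->
  ent (app_channel [seq lift_op n ws K | K <- Ks] rho) z z' =
  \sum_(x : bits k) \sum_(x' : bits k)
    choi Ks (sel ws k z) x (sel ws k z') x' * ent rho (put ws z x) (put ws z' x').
Proof.
move=> ok sz; rewrite ent_channel.
transitivity (\sum_(x | agree ws x z) \sum_(x' | agree ws x' z')
   choi Ks (sel ws k z) (sel ws k x) (sel ws k z') (sel ws k x') * ent rho x x').
  rewrite [RHS]big_mkcond /=; apply: eq_bigr => x _.
  case: ifP => ax.
    rewrite [RHS]big_mkcond /=; apply: eq_bigr => x' _.
    rewrite choi_lift agree_sym ax /= agree_sym; case: ifP => //; by rewrite mul0r.
  by rewrite big1 // => x' _; rewrite choi_lift agree_sym ax mul0r.
rewrite (sum_agree ok sz); apply: eq_bigr => x _.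
rewrite (sum_agree ok sz); apply: eq_bigr => x' _.
by rewrite !(sel_put ok sz).
Qed.

Lemma put_comp n ws k vs j (z : bits n) (y : bits k) (x : bits j) :
  wires_ok n ws -> size ws = k -> wires_ok k vs -> size vs = j ->
  put ws z (put vs y x) = put [seq nth 0%N ws v | v <- vs] (put ws z y) x.
Proof.
move=> ow sw ov sv; apply: bits_eqP => i hi; rewrite !nth_put hi /=.
case: ifP => iw; last first.
  have -> // : (i \in [seq nth 0%N ws v | v <- vs]) = false.
  apply: contraFF iw => /mapP[v vv ->].
  by rewrite mem_nth // sw (wires_lt ov vv).
have ik : (index i ws < k)%N by rewrite -sw index_mem.
rewrite ik /=.
have -> : (i \in [seq nth 0%N ws v | v <- vs]) = (index i ws \in vs).
  apply/mapP/idP => [[v vv ->]|h]; last by exists (index i ws); rewrite ?nth_index.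
  by rewrite index_uniq ?(wires_uniq ow) // sw (wires_lt ov vv).
case: ifP => // iv; congr (nth false x _).
have e : nth 0%N [seq nth 0%N ws v | v <- vs] (index (index i ws) vs) = i.
  by rewrite (nth_map 0%N) ?index_mem // !nth_index.
rewrite -[in RHS]e index_uniq ?size_map ?index_mem //.
exact: wires_uniq (wires_ok_comp ow sw ov).
Qed.

(** * Partial traces and Stinespring dilations *)

Section Trace.
Variables (n n' : nat) (sys : seq nat).
Hypotheses (oks : wires_ok n' sys) (szs : size sys = n).

Definition ptrace (rho : op R n' n') : op R n n :=
  opmx (fun y y' => \sum_(z : bits n' | sel sys n z == y) ent rho z (put sys z y')).

Lemma ptrace_sys (Ks : seq (op R n n)) rho :
  ptrace (app_channel [seq lift_op n' sys K | K <- Ks] rho) = app_channel Ks (ptrace rho).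
Proof.
apply: ent_eqP => y y'; rewrite ent_opmx ent_channel.
transitivity (\sum_(z : bits n' | sel sys n z == y) \sum_(x : bits n) \sum_(x' : bits n)
  choi Ks y x y' x' * ent rho (put sys z x) (put sys z x')).
  apply: eq_bigr => z /eqP hz; rewrite ent_channel_lift //.
  apply: eq_bigr => x _; apply: eq_bigr => x' _.
  by rewrite hz (sel_put oks szs) put_put.
rewrite exchange_big /=; apply: eq_bigr => x _.
rewrite exchange_big /=; apply: eq_bigr => x' _.
rewrite -mulr_sumr; congr (_ * _); rewrite ent_opmx (sum_sel oks szs _ x y).
by apply: eq_bigr => z _; rewrite put_put.
Qed.

(** The wires in [P] are in state 0, uncorrelated with the rest: this is how ancillas still to be
    used are described. *)
Definition zero_on (P : pred nat) (rho : op R n' n') : Prop :=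
  forall (z z' : bits n') j, P j -> nth false z j || nth false z' j -> ent rho z z' = 0.

Lemma zero_on_channel (P : pred nat) ws k (Ks : seq (op R k k)) rho :
  wires_ok n' ws -> size ws = k -> (forall j, P j -> j \notin ws) ->
  zero_on P rho -> zero_on P (app_channel [seq lift_op n' ws K | K <- Ks] rho).
Proof.
move=> ow sw hP h z z' j Pj hj; rewrite ent_channel_lift //.
rewrite big1 // => x _; rewrite big1 // => x' _.
rewrite (h _ _ j) ?mulr0 // !nth_put (negbTE (hP j Pj)).
by case: ltnP => // hn; rewrite !nth_bits_ge in hj.
Qed.

Section Dilation.
Variables (ws fr : seq nat) (k w : nat) (V : op R (k + w) (k + w)) (Ks : seq (op R k k)).
Hypotheses (okw : wires_ok n ws) (szw : size ws = k) (szf : size fr = w).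
Let qs := [seq nth 0%N sys v | v <- ws].
Hypotheses (okq : wires_ok n' (qs ++ fr)) (sysfr : forall j, j \in fr -> j \notin sys).
Hypothesis dilation : forall y x y' x',
  out_choi V y (pad (k + w) (x : bits k)) y' (pad (k + w) (x' : bits k)) = choi Ks y x y' x'.

Let szq : size qs = k. Proof. by rewrite size_map. Qed.
Let szqf : size (qs ++ fr) = (k + w)%N. Proof. by rewrite size_cat szq szf. Qed.
Let okf : wires_ok n' fr.
Proof.
move: okq => /andP[]; rewrite cat_uniq all_cat => /and3P[_ _ uf] /andP[_ hf].
by rewrite /wires_ok uf.
Qed.

Let frq j : j \in fr -> j \notin qs.
Proof.
move=> jf; move: okq => /andP[]; rewrite cat_uniq => /and3P[_ /hasPn h _] _.
exact: h.
Qed.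

Let zfr : bits w := pad w [::].

Let nth_fr (z : bits n') i : sel fr w z = zfr -> i \in fr -> nth false z i = false.
Proof.
move=> e hi; have hw : (index i fr < w)%N by rewrite -szf index_mem.
have := congr1 (fun t : bits w => nth false t (index i fr)) e.
by rewrite nth_sel // hw nth_index // nth_pad hw nth_nil.
Qed.

Let put_all (z : bits n') e x : sel fr w z = zfr ->
  put (qs ++ fr) (put fr z (e : bits w)) (pad (k + w) (x : bits k)) = put qs z x.
Proof.
move=> hz; apply: bits_eqP => i hi; rewrite !nth_put hi /= mem_cat index_cat.
case: (boolP (i \in qs)) => iq /=.
  rewrite nth_pad; have -> // : (index i qs < k + w)%N.
  by rewrite ltn_addr // -szq index_mem.
case: (boolP (i \in fr)) => // jf.
by rewrite nth_pad [nth false x _]nth_bits_ge ?andbF ?(nth_fr hz) // szq leq_addr.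
Qed.

Local Notation joint z e := (sel (qs ++ fr) (k + w) (put fr z e)).

(** Stinespring: acting with [V] on the query wires and on fresh zero wires, and then ignoring the
    latter, is the channel [Ks]. The fresh wires lie outside [sys], so [ptrace] already discards
    them. *)
Lemma ptrace_dilation rho : zero_on (mem fr) rho ->
  ptrace (app_channel [:: lift_op n' (qs ++ fr) V] rho) =
  app_channel [seq lift_op n ws K | K <- Ks] (ptrace rho).
Proof.
move=> hrho; apply: ent_eqP => y y'; rewrite ent_opmx ent_channel_lift //.
have ze (z z' : bits n') : (sel fr w z != zfr) || (sel fr w z' != zfr) -> ent rho z z' = 0.
  have aux (u : bits n') : sel fr w u != zfr -> exists2 j, j \in fr & nth false u j.
    case: (boolP (has (nth false u) fr)) => [/hasP[j jf uj] _|/hasPn h]; first by exists j.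
    case/eqP; apply: bits_eqP => i hi; rewrite nth_sel // hi nth_pad hi nth_nil /=.
    by apply/negbTE/h; rewrite mem_nth ?szf.
  by case/orP => /aux[j jf uj]; apply: (hrho _ _ j jf); rewrite uj ?orbT.
transitivity (\sum_(x : bits k) \sum_(x' : bits k) choi Ks (sel ws k y) x (sel ws k y') x' *
  \sum_(z : bits n' | (sel sys n z == y) && (sel fr w z == zfr))
    ent rho (put qs z x) (put qs (put sys z y') x')); last first.
  apply: eq_bigr => x _; apply: eq_bigr => x' _; congr (_ * _).
  rewrite ent_opmx (sum_sel oks szs _ _ y) big_mkcondr /=.
  apply: eq_bigr => z /eqP hz.
  rewrite put_put (put_comp _ _ _ oks szs okw szw) -/qs -{1}hz (put_sel szs).
  rewrite (put_comp _ _ _ oks szs okw szw) -/qs.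
  case: eqP => // /eqP nz; rewrite ze //.
  have -> : sel fr w (put qs z x) = sel fr w z; last by rewrite nz.
  apply: bits_eqP => i hi; rewrite !nth_sel // nth_put.
  rewrite (negbTE (frq _)) ?mem_nth ?szf //.
  by rewrite (wires_lt okf) // mem_nth ?szf.
have inv (z : bits n') (e : bits w) : sel sys n (put fr z e) = sel sys n z.
  apply: bits_eqP => i hi; rewrite !nth_sel // nth_put.
  have hin : nth 0%N sys i \in sys by rewrite mem_nth ?szs.
  rewrite (wires_lt oks hin) (_ : (_ \in fr) = false) //.
  by apply/negbTE; apply: contraL hin; exact: sysfr.
(* The traced-out content is split into the content [e] of the fresh wires, which is the environment
   of the dilation, and the rest, represented by the [z] that vanish on [fr]. *)
transitivity (\sum_(z : bits n' | (sel sys n z == y) && (sel fr w z == zfr))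
  \sum_(e : bits w) ent (app_channel [:: lift_op n' (qs ++ fr) V] rho) (put fr z e)
     (put sys (put fr z e) y')).
  rewrite (partition_big (fun z : bits n' => put fr z zfr)
    (fun z => (sel sys n z == y) && (sel fr w z == zfr))) /=; last first.
    by move=> z /eqP hz; rewrite inv hz (sel_put okf szf) !eqxx.
  apply: eq_bigr => z /andP[/eqP hz /eqP hf].
  rewrite (reindex_onto (fun e : bits w => put fr z e) (sel fr w)) /=; last first.
    by move=> u /andP[_ /eqP <-]; rewrite put_put (put_sel szf).
  apply: eq_bigl => e; rewrite inv hz (sel_put okf szf) put_put -hf (put_sel szf) !eqxx.
  by [].
have part (z : bits n') (e : bits w) : sel sys n z = y -> sel fr w z = zfr ->
  ent (app_channel [:: lift_op n' (qs ++ fr) V] rho) (put fr z e) (put sys (put fr z e) y') =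
  \sum_(x : bits k) \sum_(x' : bits k)
   ent V (joint z e) (pad (k + w) x) *
   (ent V (put (iota 0 k) (joint z e) (sel ws k y')) (pad (k + w) x'))^* *
   ent rho (put qs z x) (put qs (put sys z y') x').
  move=> hz hf; rewrite -[[:: lift_op _ _ _]]/(map _ [:: V]) ent_channel_lift //.
  have -> : sel (qs ++ fr) (k + w) (put sys (put fr z e) y') =
      put (iota 0 k) (joint z e) (sel ws k y').
    apply: bits_eqP => i hi; rewrite nth_put hi mem_iota /= add0n.
    rewrite !nth_sel // hi /= nth_put nth_cat szq.
    case: (ltnP i k) => hik.
      rewrite index_iotaE // subn0 hik /=.
      rewrite /qs (nth_map 0%N) ?szw //.
      have hwi : nth 0%N ws i \in ws by rewrite mem_nth ?szw.
      have hn := wires_lt okw hwi.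
      rewrite mem_nth ?szs // index_uniq ?szs ?(wires_uniq oks) //.
      by rewrite (wires_lt oks) // mem_nth ?szs.
    have hfi : nth 0%N fr (i - k) \in fr by rewrite mem_nth // szf; lia.
    rewrite (negbTE (sysfr hfi)) nth_put (wires_lt okf hfi) hfi /=.
    by [].
  (* An input of [V] contributes only if its ancilla part is zero, that is, if it is a padded string
     of [k] bits; otherwise the entry of [rho] vanishes. *)
  have cf (z0 : bits n') x : sel fr w (put (qs ++ fr) z0 x) != zfr \/
      exists x1 : bits k, x = pad (k + w) x1.
    have [hx|hx] := eqVneq x (pad (k + w) (pad k x)); first by right; exists (pad k x).
    left; apply: contraNneq hx => hx; apply/eqP/bits_eqP => i hi.
    rewrite nth_pad hi nth_pad /=; case: ltnP => //= hik.
    have hfi : nth 0%N fr (i - k) \in fr by rewrite mem_nth // szf; lia.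
    have hq : nth 0%N fr (i - k) \notin qs by apply: frq.
    have := nth_fr hx hfi; rewrite nth_put (wires_lt okf hfi) mem_cat hfi orbT /=.
    rewrite index_cat (negbTE hq) index_uniq ?(wires_uniq okf) ?szf //; last lia.
    by rewrite szq subnKC.
  pose Fz x x' := choi [:: V] (joint z e) x
    (put (iota 0 k) (joint z e) (sel ws k y')) x' *
    ent rho (put (qs ++ fr) (put fr z e) x) (put (qs ++ fr) (put sys (put fr z e) y') x').
  have red (G : bits (k + w) -> C) : (forall x, (forall x1 : bits k, x != pad (k + w) x1) -> G x = 0) ->
      \sum_x G x = \sum_(x1 : bits k) G (pad (k + w) x1).
    move=> hG; transitivity (\sum_(x : bits (k + w) | x == pad (k + w) (pad k x)) G x).
      rewrite [RHS]big_mkcond; apply: eq_bigr => x _; case: eqP => // /eqP hx.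
      apply: hG => x1; apply: contraNneq hx => ->.
      apply/eqP; apply: bits_eqP => i hi; rewrite !nth_pad hi.
      by case: ltnP => // h1; rewrite nth_bits_ge.
    rewrite (reindex_onto (fun x1 : bits k => pad (k + w) x1) (fun x => pad k x)); last first.
      by move=> x /eqP /esym.
    apply: eq_bigl => x1.
    have -> : pad k (pad (k + w) x1) = x1.
      by apply: bits_eqP => i hi; rewrite !nth_pad hi ltn_addr.
    by rewrite !eqxx.
  rewrite red; last first.
    move=> x nx; rewrite big1 // => x' _; case: (cf (put fr z e) x) => [h|[x1 e1]].
      by rewrite (ze _ _ (_ : _ || _)) ?mulr0 // h.
    by move: (nx x1); rewrite e1 eqxx.
  apply: eq_bigr => x _; rewrite red; last first.
    move=> x' nx; case: (cf (put sys (put fr z e) y') x') => [h|[x1 e1]].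
      by rewrite (ze _ _ (_ : _ || _)) ?mulr0 // h orbT.
    by move: (nx x1); rewrite e1 eqxx.
  apply: eq_bigr => x' _; rewrite /choi big_seq1 put_all //; congr (_ * ent rho _ _).
  have -> : put sys (put fr z e) y' = put fr (put sys z y') e.
    apply: bits_eqP => i hi; rewrite !nth_put hi /=.
    case: (boolP (i \in fr)) => jf; first by rewrite (negbTE (sysfr jf)).
    by case: ifP.
  rewrite put_all //; apply: bits_eqP => i hi; rewrite -hf !nth_sel // hi /= nth_put.
  have hfi : nth 0%N fr i \in fr by rewrite mem_nth // szf.
  by rewrite (negbTE (sysfr hfi)) (wires_lt okf hfi).
under eq_bigr => z /andP[/eqP hz /eqP hf] do under eq_bigr => e _ do rewrite part //.
under eq_bigr => z _ do rewrite exchange_big /=.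
rewrite exchange_big /=; apply: eq_bigr => x _.
under eq_bigr => z _ do rewrite exchange_big /=.
rewrite exchange_big /=; apply: eq_bigr => x' _.
rewrite mulr_sumr; apply: eq_bigr => z /andP[/eqP hz /eqP hf].
rewrite -mulr_suml; congr (_ * _); rewrite -dilation /out_choi.
have hq (u : bits n') i : (i < k)%N -> nth false (sel (qs ++ fr) (k + w) u) i = nth false (sel ws k (sel sys n u)) i.
  move=> hi; have hwi : nth 0%N ws i \in ws by rewrite mem_nth ?szw.
  rewrite !nth_sel // hi ltn_addr // (wires_lt okw hwi) nth_cat szq hi.
  by rewrite (nth_map 0%N) ?szw.
have hfr (u : bits n') i : (k <= i < k + w)%N -> nth false (sel (qs ++ fr) (k + w) u) i = nth false (sel fr w u) (i - k).
  move=> /andP[h1 h2]; rewrite !nth_sel // h2 nth_cat szq ltnNge h1 /=.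
  by have -> : (i - k < w)%N by lia.
(* With the kept wires fixed to [y], the strings summed over in [out_choi] correspond to the
   contents [e] of the fresh wires. *)
rewrite [RHS](reindex_onto (fun e : bits w => joint z e)
   (fun Y => sel (iota k w) w Y)) /=; last first.
  move=> Y /eqP hY; apply: bits_eqP => i hi; have [h|h] := ltnP i k.
    by rewrite hq // inv hz -hY nth_sel_iota.
  rewrite hfr ?h // (sel_put okf szf) nth_sel_iota; last by lia.
  by rewrite subnKC.
apply: eq_bigl => e; apply/esym/andP; split; apply/eqP; apply: bits_eqP => i hi.
  by rewrite nth_sel_iota // hq // inv hz.
rewrite nth_sel_iota // hfr; last by lia.
by rewrite (sel_put okf szf) addKn.
Qed.

End Dilation.
End Trace.
End Elimination.

(** * A query to a circuit, as gates *)

Section QueryGates.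
Variable R : realType.
Local Notation C := R[i].
Variables (a s : nat) (c : circuit).
Hypothesis c_ok : circuit_ok a s c.
Let K := (a + s)%N.
Let W := c_width c.

(** The swaps reproduce the conventions of [purified_oracle]: the first moves the input onto fresh
    wires and leaves zeros behind; the second exchanges output and response register, which leaves
    the old response on a fresh wire. *)
Definition query_gates : seq gate :=
  (swaps (iota 0 a) (iota K a) ++ map (relabel (iota K W)) (c_gates c)) ++
  swaps (iota a s) (iota K s).

Definition circuit_oracle : seq (op R (a + s) (a + s)) :=
  oracle_ops (fun e : bits (W - s) => kraus a (circuit_mx R c) [::] e : op R s a).

Let aW : (a <= W)%N. Proof. by case/and3P: c_ok. Qed.
Let sW : (s <= W)%N. Proof. by case/and3P: c_ok. Qed.
Let gok : gates_ok W (c_gates c). Proof. by case/and3P: c_ok. Qed.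

Let ok1 : wires_ok (K + W) (iota 0 a ++ iota K a).
Proof. by apply: wires_ok_cat_iota; rewrite /K; have := aW; lia. Qed.

Let ok2 : wires_ok (K + W) (iota a s ++ iota K s).
Proof. by apply: wires_ok_cat_iota; rewrite /K; have := sW; lia. Qed.

Let okK : wires_ok (K + W) (iota K W).
Proof. exact: wires_ok_iota. Qed.

Let g1 : gates_ok (K + W) (swaps (iota 0 a) (iota K a)).
Proof. by apply: gates_ok_swaps; rewrite ?size_iota. Qed.

Let g2 : gates_ok (K + W) (swaps (iota a s) (iota K s)).
Proof. by apply: gates_ok_swaps; rewrite ?size_iota. Qed.

Lemma query_gates_ok : gates_ok (K + W) query_gates.
Proof.
rewrite /gates_ok !all_cat; apply/andP; split => //; apply/andP; split => //.
by apply: gates_ok_relabel gok; rewrite ?size_iota.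
Qed.

Lemma size_query_gates : (size query_gates <= size (c_gates c) + 3 * (a + s))%N.
Proof.
rewrite !size_cat size_map; have := size_swaps (iota 0 a) (iota K a).
by have := size_swaps (iota a s) (iota K s); rewrite !size_iota; lia.
Qed.

Lemma circuit_oracle_channel : is_channel circuit_oracle.
Proof. by apply: kraus_oracle_channel => //; exact: (@gates_unitary R W (c_gates c)). Qed.

Let p1 (z : bits (K + W)) i : nth false (bact (swaps (iota 0 a) (iota K a)) z) i =
  if (i < a)%N then nth false z (K + i)
  else if (K <= i < K + a)%N then nth false z (i - K) else nth false z i.
Proof.
rewrite nth_bact // cact_swaps ?size_iota //; last by case/andP: ok1.
rewrite !mem_iota /= !add0n; case: ltnP => hi.
  by rewrite index_iotaE // subn0 nth_iota.
by case: ifP => // h; rewrite index_iotaE // nth_iota //; lia.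
Qed.

Let p2 (z : bits (K + W)) i : nth false (bact (swaps (iota a s) (iota K s)) z) i =
  if (a <= i < K)%N then nth false z (K + (i - a))
  else if (K <= i < K + s)%N then nth false z (a + (i - K)) else nth false z i.
Proof.
rewrite nth_bact // cact_swaps ?size_iota //; last by case/andP: ok2.
rewrite !mem_iota -/K; case: ifP => hi.
  by rewrite index_iotaE // nth_iota //; move: hi; rewrite /K; lia.
by case: ifP => // h; rewrite index_iotaE // nth_iota //; lia.
Qed.

Let p2K : involutive (@bact (K + W) (swaps (iota a s) (iota K s))).
Proof.
move=> z; apply: bits_eqP => i hi; rewrite p2; case: ifP => h1.
  rewrite p2.
  have -> : (a <= K + (i - a) < K)%N = false by lia.
  have -> : (K <= K + (i - a) < K + s)%N by move: h1; rewrite /K; lia.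
  by congr (nth false z _); lia.
case: ifP => h2; rewrite p2 ?h1 ?h2 //.
have -> : (a <= a + (i - K) < K)%N by move: h2; rewrite /K; lia.
by congr (nth false z _); lia.
Qed.

Let ent_query (Y : bits (K + W)) (x : bits (a + s)) :
  ent (gates_mx R (K + W) query_gates) Y (pad (K + W) x) =
  ent (lift_op (K + W) (iota K W) (circuit_mx R c)) (bact (swaps (iota a s) (iota K s)) Y)
    (bact (swaps (iota 0 a) (iota K a)) (pad (K + W) x)).
Proof.
rewrite /query_gates !gates_mx_cat (gates_mx_relabel _ okK (size_iota _ _) gok).
rewrite mulmxA ent_mul_perm ?swaps_classical // ent_perm_mul ?swaps_classical //.
under eq_bigr => z _ do rewrite -(inj_eq (inv_inj p2K)) p2K.
exact: sum_delta.
Qed.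

Let selK (x : bits (a + s)) :
  sel (iota K W) W (bact (swaps (iota 0 a) (iota K a)) (pad (K + W) x)) = pad W (pad a x).
Proof.
apply: bits_eqP => i hi; rewrite nth_sel_iota // p1 [RHS]nth_pad hi andTb.
have -> : (K + i < a)%N = false by rewrite /K; lia.
case: ifP => h; rewrite !nth_pad.
  have -> : (K + i - K < K + W)%N by lia.
  have -> : (i < a)%N by lia.
  by rewrite addKn.
have -> : (i < a)%N = false by lia.
by rewrite nth_bits_ge ?andbF // leq_addr.
Qed.

(** This is the hypothesis of [ptrace_dilation] for [query_gates]. The second swap is an involution,
    by which the sum over the final string is re-indexed. *)
Lemma query_dilation (y x y' x' : bits (a + s)) :
  out_choi (gates_mx R (K + W) query_gates) y (pad (K + W) x) y' (pad (K + W) x') =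
  choi circuit_oracle y x y' x'.
Proof.
rewrite choi_oracle_ops kraus_choi // !cat0s /out_choi.
rewrite (reindex_inj (inv_inj p2K)).
under eq_bigr => Z _ do rewrite !ent_query p2K.
set X1 := bact (swaps (iota 0 a) (iota K a)) (pad (K + W) x).
set X1' := bact (swaps (iota 0 a) (iota K a)) (pad (K + W) x').
set tau := bact (swaps (iota a s) (iota K s)).
have X1E z i : (i < K)%N ->
    nth false (bact (swaps (iota 0 a) (iota K a)) (pad (K + W) (z : bits (a + s)))) i =
    (a <= i)%N && nth false z i.
  move=> hi; rewrite p1; case: ltnP => h /=.
    rewrite nth_pad nth_bits_ge ?andbF // /K; clia.
  have -> : (K <= i < K + a)%N = false by clia.
  by rewrite nth_pad; have -> // : (i < K + W)%N by clia.
have nthp (Zw : bits W) i : nth false (put (iota K W) X1 Zw) i =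
    if (i < K)%N then (a <= i)%N && nth false x i else nth false Zw (i - K).
  rewrite nth_put mem_iota; case: (ltnP i (K + W)) => h /=.
    case: ltnP => h2; first exact: X1E.
    by rewrite index_iotaE // h2.
  have -> : (i < K)%N = false by clia.
  by rewrite nth_bits_ge //; clia.
transitivity (\sum_(Zw : bits W) if sel (iota 0 K) K (tau (put (iota K W) X1 Zw)) == y then
    ent (circuit_mx R c) Zw (pad W (pad a x)) *
    (ent (lift_op (K + W) (iota K W) (circuit_mx R c))
       (tau (put (iota 0 K) (tau (put (iota K W) X1 Zw)) y')) X1')^* else 0).
  rewrite -(sel_put okK (size_iota _ _) X1 (pad W (pad a x))).
  transitivity (\sum_(Z | agree (iota K W) Z X1)
    if sel (iota 0 K) K (tau Z) == y then
    ent (circuit_mx R c) (sel (iota K W) W Z) (sel (iota K W) W X1) *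
    (ent (lift_op (K + W) (iota K W) (circuit_mx R c))
       (tau (put (iota 0 K) (tau Z) y')) X1')^* else 0).
    rewrite big_mkcond [RHS]big_mkcond; apply: eq_bigr => Z _ /=.
    rewrite -/tau ent_lift; case: ifP => // _; last by rewrite if_same.
    by case: ifP => // _; rewrite mul0r.
  rewrite (sum_agree okK (size_iota _ _)); apply: eq_bigr => Zw _.
  by rewrite !(sel_put okK (size_iota _ _)) selK.
have tauE (Zw : bits W) i : (i < K)%N ->
   nth false (tau (put (iota K W) X1 Zw)) i = (a <= i)%N && nth false Zw (i - a).
  move=> hi; rewrite p2 hi andbT; case: (leqP a i) => h /=.
    rewrite nthp; have -> : (K + (i - a) < K)%N = false by clia.
    by rewrite addKn.
  have -> : (K <= i < K + s)%N = false by clia.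
  by rewrite nthp hi leqNgt h.
(* After the final swap the oracle wires hold zeros and then the output of [c]: both conditions of
   [choi_oracle_ops] on [y] come from here, those on [y'], [x] and [x'] from [agE]. *)
have condE (Zw : bits W) : (sel (iota 0 K) K (tau (put (iota K W) X1 Zw)) == y) =
   (take a y == nseq a false) && (sel (iota 0 s) s Zw == pad s (drop a y)).
  apply/eqP/andP => [<-|[/eqP hy /eqP hz]].
    split; apply/eqP.
      apply: (@eq_from_nth _ false); rewrite size_take_tuple ?size_nseq //.
      move=> i hi.
      have hK : (i < K)%N by rewrite /K; clia.
      by rewrite nth_take // nth_nseq hi nth_sel_iota // tauE // leqNgt hi.
    apply: bits_eqP => i hi; rewrite nth_sel_iota // nth_pad hi nth_drop.
    have hK : (a + i < K)%N by rewrite /K; clia.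
    by rewrite nth_sel_iota // !add0n tauE // leq_addr addKn.
  apply: bits_eqP => i hi; rewrite nth_sel_iota // tauE //.
  case: (leqP a i) => h /=.
    have hs : (i - a < s)%N by move: hi; rewrite /K; clia.
    have := congr1 (fun t : bits s => nth false t (i - a)) hz.
    by rewrite nth_sel_iota // nth_pad hs nth_drop subnKC.
  by rewrite -(nth_take false h y) hy nth_nseq if_same.
have nthq (Zw : bits W) i : nth false (tau (put (iota 0 K) (tau (put (iota K W) X1 Zw)) y')) i =
   if (i < a)%N then nth false y' i else if (i < K)%N then nth false x i
   else if (i < K + s)%N then nth false y' (a + (i - K)) else nth false Zw (i - K).
  have pK j : nth false (put (iota 0 K) (tau (put (iota K W) X1 Zw)) y') j =
     if (j < K)%N then nth false y' j else nth false (tau (put (iota K W) X1 Zw)) j.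
    rewrite nth_put mem_iota add0n leq0n andTb.
    case: (ltnP j (K + W)) => hW; case: (ltnP j K) => h //.
    - by rewrite index_iotaE // subn0.
    - by move: hW; rewrite leqNgt ltn_addr.
    - by rewrite nth_bits_ge.
  rewrite p2; case: (ltnP i a) => h1; rewrite ?andFb ?andTb.
    have -> : (K <= i < K + s)%N = false by rewrite /K; clia.
    by rewrite pK; have -> // : (i < K)%N by rewrite /K; clia.
  case: (ltnP i K) => h2; rewrite ?andFb ?andTb.
    rewrite pK; have -> : (K + (i - a) < K)%N = false by clia.
    rewrite p2.
    have -> : (a <= K + (i - a) < K)%N = false by clia.
    have -> : (K <= K + (i - a) < K + s)%N by move: h2; rewrite /K; clia.
    have -> : (a + (K + (i - a) - K) = i)%N by clia.
    by rewrite nthp h2 h1.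
  case: (ltnP i (K + s)) => h3; rewrite ?andbF ?andbT ?andTb.
    by rewrite pK; have -> // : (a + (i - K) < K)%N by move: h3; rewrite /K; clia.
  have iK : (i < K)%N = false by clia.
  rewrite pK iK p2 iK andbF.
  have -> : (K <= i < K + s)%N = false by clia.
  by rewrite nthp iK.
have agE (Zw : bits W) : agree (iota K W) (tau (put (iota 0 K) (tau (put (iota K W) X1 Zw)) y')) X1' =
   (take a y' == nseq a false) && (drop a x == drop a x' :> seq bool).
  apply/agreeP/andP => [h|[/eqP hy /eqP hx] i].
    split; apply/eqP; apply: (@eq_from_nth _ false).
    - by rewrite size_take_tuple size_nseq.
    - rewrite size_take_tuple => i hi.
      have hK : (i < K)%N by rewrite /K; clia.
      rewrite nth_take // nth_nseq hi; have := h i; rewrite mem_iota nthq hi X1E // (_ : (a <= i)%N = false); last by clia.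
      by apply; rewrite negb_and -ltnNge hK.
    - by rewrite !size_drop !size_tuple.
    - rewrite size_drop size_tuple => i hi; rewrite !nth_drop.
      have hK : (a + i < K)%N by rewrite /K; clia.
      have := h (a + i)%N; rewrite mem_iota nthq hK X1E // leq_addr (_ : (a + i < a)%N = false); last by clia.
      by apply; rewrite negb_and -ltnNge hK.
  rewrite mem_iota => hi; rewrite nthq.
  case: (ltnP i K) => hK; last first.
    have hKW : (K + W <= i)%N by move: hi; rewrite negb_and; clia.
    have -> : (i < a)%N = false by clia.
    have -> : (i < K + s)%N = false by have := sW; clia.
    by rewrite !nth_bits_ge //; clia.
  rewrite X1E //; case: (ltnP i a) => h /=.
    by rewrite -(nth_take false h y') hy nth_nseq if_same.
  by rewrite -(subnKC h) -!nth_drop hx.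
rewrite (eq_bigr (fun Zw : bits W => if [&& take a y == nseq a false, take a y' == nseq a false
      & drop a x == drop a x' :> seq bool] && (sel (iota 0 s) s Zw == pad s (drop a y)) then
   ent (circuit_mx R c) Zw (pad W (pad a x)) *
   (ent (circuit_mx R c) (put (iota 0 s) Zw (pad s (drop a y'))) (pad W (pad a x')))^* else 0)).
  case: ifP => _; first by rewrite -big_mkcond.
  by rewrite big1.
move=> Zw _; rewrite condE ent_lift agE selK.
case: (take a y == _) => //=; case: (sel _ _ _ == _); last by rewrite andbF.
rewrite andbT; case: ifP => _; last by rewrite conjC0 mulr0.
congr (_ * (ent _ _ _)^*); apply: bits_eqP => i hi.
rewrite nth_sel_iota // nthq nth_put hi mem_iota /= add0n.
have -> : (K + i < a)%N = false by rewrite /K; clia.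
have -> : (K + i < K)%N = false by clia.
rewrite ltn_add2l addKn; case: ltnP => h //.
by rewrite index_iotaE // subn0 nth_pad h nth_drop.
Qed.

End QueryGates.

(** * Compiling an oracle algorithm into an oracle-free one *)

Section Compile.
Variables (R : realType) (Ch : challenger R) (l : nat).
Variables (cs : nat -> circuit) (aw st : nat -> nat).
Hypothesis cs_ok : forall k, circuit_ok (aw k) (st k) (cs k).
Let p := ch_priv Ch l.

Definition circuits_oracle : oracle R (fun k => aw k + st k)%N :=
  fun k => circuit_oracle R (aw k) (st k) (cs k).

Definition instr_fresh (i : instr) : nat :=
  if i is Query k _ then c_width (cs k) else 0.

Definition code_fresh (code : seq instr) : nat := \sum_(i <- code) instr_fresh i.

Fixpoint compile (f : nat) (code : seq instr) : seq instr :=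
  match code with
  | [::] => [::]
  | Query k ws :: code' =>
      map Gate (map (relabel (ws ++ iota f (c_width (cs k))))
        (query_gates (aw k) (st k) (cs k))) ++ compile (f + c_width (cs k)) code'
  | i :: code' => i :: compile f code'
  end.

Definition compiled (A : algo) : algo :=
  Algo (a_width A + code_fresh (a_code A)) (compile (a_width A) (a_code A)).

Definition instr_ok (N : nat) (c : instr) : bool :=
  match c with
  | Gate g => wires_ok N (gate_wires g)
  | Send => true
  | Query k ws => (size ws == aw k + st k)%N && wires_ok N ws
  end.

Lemma wires_ok_fresh N M f W ws : wires_ok N ws -> (N <= f)%N -> (f + W <= M)%N ->
  wires_ok M (ws ++ iota f W).
Proof.
move=> /andP[u h] Nf fM; rewrite /wires_ok cat_uniq iota_uniq u all_cat andbT.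
apply/and3P; split.
- apply/hasPn => v; rewrite mem_iota => hv; apply/negP => /(allP h); lia.
- apply: sub_all h => v; lia.
- by apply/allP => v; rewrite mem_iota; lia.
Qed.

Lemma app_channel1 n (A : op R n n) rho : app_channel [:: A] rho = A *m rho *m A^t*.
Proof. by rewrite /app_channel big_seq1. Qed.

Lemma app_channel1_mul n (A B : op R n n) rho :
  app_channel [:: A] (app_channel [:: B] rho) = app_channel [:: A *m B] rho.
Proof. by rewrite !app_channel1 trmx_mul map_mxM /= !mulmxA. Qed.

Lemma exec_gates (ar : nat -> nat) (O : oracle R ar) N gs rho i :
  foldl (exec_instr (Ch := Ch) (l := l) O (N := N)) (rho, i) (map Gate gs) =
  (app_channel [:: gates_mx R (N + p) gs] rho, i).
Proof.
elim: gs rho => [|g gs IH] rho /=.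
  rewrite app_channel1 mul1mx /gates_mx /=.
  suff -> : (1%:M : op R (N + p) (N + p))^t* = 1%:M by rewrite mulmx1.
  by apply: ent_eqP => y x; rewrite ent_adj !ent1 conjC_nat eq_sym.
by rewrite IH app_channel1_mul gates_mx_cons.
Qed.

Section Simulation.
Variables (N N' : nat).
Let n := (N + p)%N.
Let n' := (N' + p)%N.
Let sys := iota 0 N ++ iota N' p.
Hypothesis NN' : (N <= N')%N.

Let oks : wires_ok n' sys.
Proof. by apply: wires_ok_cat_iota. Qed.

Let szs : size sys = n. Proof. by rewrite size_cat !size_iota. Qed.

Let nth_sys i : (i < N)%N -> nth 0%N sys i = i.
Proof. by move=> h; rewrite nth_cat size_iota h nth_iota. Qed.

Let map_sys ws : all (fun w => w < N)%N ws -> [seq nth 0%N sys v | v <- ws] = ws.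
Proof.
move=> /allP h; rewrite -[RHS]map_id; apply/eq_in_map => i /h; exact: nth_sys.
Qed.

Let gate_sys g : wires_ok N (gate_wires g) ->
  gate_mx R n' g = lift_op n' sys (gate_mx R n g).
Proof.
move=> ok; rewrite -(gate_mx_relabel R oks szs); last first.
  case/andP: ok => u /allP h; rewrite /wires_ok u; apply/allP => i /h; rewrite /n; lia.
congr (gate_mx _ _ _); case: g ok => [i|i|i j|i j k] /= /andP[_] /=.
- by rewrite andbT => h; rewrite nth_sys.
- by rewrite andbT => h; rewrite nth_sys.
- by rewrite andbT => /andP[h1 h2]; rewrite !nth_sys.
- by rewrite andbT => /and3P[h1 h2 h3]; rewrite !nth_sys.
Qed.

Let mem_sys j : (N <= j < N')%N -> j \notin sys.
Proof. by move=> h; rewrite mem_cat !mem_iota; lia. Qed.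

Variables (ar' : nat -> nat) (O' : oracle R ar').
Hypothesis msgN : (ch_msg Ch l <= N)%N.

(** The invariant has two halves: tracing out the added wires gives the state of the original
    execution, and the wires from [f] on are still zero. The private qubits of the challenger follow
    those of the algorithm, hence they move from [N] to [N'], as recorded by [sys]. *)
Lemma compileP code f rho rho' i : all (instr_ok N) code ->
  (N <= f)%N -> (f + code_fresh code <= N')%N ->
  ptrace n sys rho' = rho -> zero_on (fun j => f <= j < N')%N rho' ->
  ptrace n sys (foldl (exec_instr (Ch := Ch) (l := l) O' (N := N')) (rho', i) (compile f code)).1 =
  (foldl (exec_instr (Ch := Ch) (l := l) circuits_oracle (N := N)) (rho, i) code).1.
Proof.
elim: code f rho rho' i => [|c code IH] f rho rho' i //= /andP[okc okcode] Nf.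
rewrite /code_fresh big_cons -/(code_fresh code) => fN' tr z.
have dsys j : (f <= j < N')%N -> j \notin sys.
  by move=> h; apply: mem_sys; lia.
case: c okc fN' => [g| |k ws] /=.
- move=> okg fN'; apply: IH => //.
    rewrite (gate_sys okg) -[[:: _]]/(map (fun K => lift_op n' sys K) [:: gate_mx R n g]).
    by rewrite (ptrace_sys oks szs) tr.
  rewrite (gate_sys okg) -[[:: _]]/(map (fun K => lift_op n' sys K) [:: gate_mx R n g]).
  exact: zero_on_channel oks szs dsys z.
- move=> _ fN'.
  have okm : wires_ok n (iota 0 (ch_msg Ch l) ++ iota N p) by apply: wires_ok_cat_iota.
  have szm : size (iota 0 (ch_msg Ch l) ++ iota N p) = (ch_msg Ch l + p)%N.
    by rewrite size_cat !size_iota.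
  have e : [seq nth 0%N sys v | v <- iota 0 (ch_msg Ch l) ++ iota N p] =
      iota 0 (ch_msg Ch l) ++ iota N' p.
    rewrite map_cat map_sys; last by apply/allP => v; rewrite mem_iota; lia.
    congr (_ ++ _); apply: (@eq_from_nth _ 0%N); rewrite size_map !size_iota // => v hv.
    by rewrite (nth_map 0%N) ?size_iota // !nth_iota // nth_cat size_iota ltnNge leq_addr /= addKn nth_iota.
  have {}e : [seq lift_op n' (iota 0 (ch_msg Ch l) ++ iota N' p) K | K <- ch_act Ch l i] =
    map (fun K => lift_op n' sys K) [seq lift_op n (iota 0 (ch_msg Ch l) ++ iota N p) K | K <- ch_act Ch l i].
    rewrite -map_comp; apply: eq_map => K /=.
    by rewrite (lift_lift oks szs _ okm szm) e.
  apply: IH => //; rewrite e; first by rewrite (ptrace_sys oks szs) tr.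
  exact: zero_on_channel oks szs dsys z.
- move=> /andP[/eqP szw okw] fN'.
  have hW : (f + c_width (cs k) <= N')%N by lia.
  have fw : all (fun w => w < N)%N ws by case/andP: okw.
  have okwn : wires_ok n ws.
    case/andP: okw => u _; rewrite /wires_ok u; apply: sub_all fw => w; rewrite /n; lia.
  have okq : wires_ok n' (ws ++ iota f (c_width (cs k))).
    by apply: wires_ok_fresh okw Nf _; rewrite /n'; lia.
  have szq : size (ws ++ iota f (c_width (cs k))) = (aw k + st k + c_width (cs k))%N.
    by rewrite size_cat size_iota szw.
  rewrite foldl_cat exec_gates.
  rewrite (gates_mx_relabel R okq szq (query_gates_ok (cs_ok k))).
  apply: IH => //; [lia|lia| |].
    have hz : zero_on (mem (iota f (c_width (cs k)))) rho'.
      by move=> z1 z2 j; rewrite inE mem_iota => hj; apply: z; lia.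
    have := @ptrace_dilation R n n' sys oks szs ws (iota f (c_width (cs k))) (aw k + st k)
      (c_width (cs k)) (gates_mx R _ (query_gates (aw k) (st k) (cs k)))
      (circuit_oracle R (aw k) (st k) (cs k)) okwn szw (size_iota _ _).
    rewrite (map_sys fw) => -> //; first by rewrite tr.
      by move=> j; rewrite mem_iota => hj; apply: dsys; lia.
    by move=> y x y' x'; apply: query_dilation.
  rewrite -[[:: _]]/(map (fun K => lift_op n' (ws ++ iota f (c_width (cs k))) K) [:: _]).
  apply: (zero_on_channel _ okq szq) => [j hj|z1 z2 j hj]; last by apply: z; lia.
  rewrite mem_cat mem_iota negb_or; apply/andP; split; last lia.
  by apply/negP => /(allP fw); lia.
Qed.

End Simulation.

Lemma compiled_win (A : algo) : algo_ok (ch_msg Ch l) (fun k => aw k + st k)%N A ->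
  win_prob Ch (no_oracle R) l (compiled A) = win_prob Ch circuits_oracle l A.
Proof.
move=> /andP[msgN okA]; rewrite /win_prob [a_width (compiled A)]/=.
set N := a_width A; set N' := (N + code_fresh (a_code A))%N.
set rho0 : op R (N + p) (N + p) := opmx _.
set rho0' : op R (N' + p) (N' + p) := opmx _.
have NN' : (N <= N')%N by rewrite leq_addr.
pose sys := iota 0 N ++ iota N' p.
have szs : size sys = (N + p)%N by rewrite size_cat !size_iota.
have oks : wires_ok (N' + p) sys by apply: wires_ok_cat_iota.
have p0 k i : nth false (pad k [::]) i = false by rewrite nth_pad nth_nil andbF.
have tr : ptrace (N + p) sys rho0' = rho0.
  apply: ent_eqP => y y'; rewrite !ent_opmx.
  transitivity (\sum_(z : bits (N' + p)) (z == pad (N' + p) [::])%:R * (((sel sys (N + p) z == y) &&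
      (put sys z y' == pad (N' + p) [::]))%:R : R[i])).
    rewrite big_mkcond /=; apply: eq_bigr => z _; rewrite ent_opmx.
    by case: (sel _ _ _ == y); rewrite /= ?mulr0 // -natrM mulnb.
  rewrite (sum_permutation (fun=> pad (N' + p) [::]) _ (pad (N' + p) [::])).
  congr (_%:R); congr nat_of_bool; congr (_ && _).
    rewrite eq_sym; congr (_ == _); apply: bits_eqP => i hi.
    by rewrite nth_sel // !p0 andbF.
  apply/eqP/eqP => [h|->].
    rewrite -(sel_put oks szs (pad (N' + p) [::]) y') h; apply: bits_eqP => i hi.
    by rewrite nth_sel // !p0 andbF.
  by apply: bits_eqP => i hi; rewrite nth_put !p0 if_same andbF.
have z0 : zero_on (fun j => N <= j < N')%N rho0'.
  move=> z z' j _ hj; rewrite ent_opmx; case: eqP => // hz; case: eqP => //= hz'.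
  by move: hj; rewrite hz hz' !p0.
have := @compileP N N' NN' _ (no_oracle R) msgN (a_code A) N rho0 rho0' 0 okA (leqnn _) (leqnn _) tr z0.
set rho' := (foldl _ _ _).1; set rho := (foldl _ _ _).1 => e.
rewrite -[in RHS]e.
have oE (y : bits (N + p)) : outcome (ptrace (N + p) sys rho') y =
    \sum_(z : bits (N' + p) | sel sys (N + p) z == y) outcome rho' z.
  rewrite /outcome ent_opmx Re_sum.
  by apply: eq_bigr => z /eqP <-; rewrite (put_sel szs).
under [RHS]eq_bigr => y _ do rewrite oE.
have drop_sys (z : bits (N' + p)) : pad p (drop N (sel sys (N + p) z)) = pad p (drop N' z).
  apply: bits_eqP => i hi.
  rewrite !nth_pad hi !nth_drop nth_sel // ltn_add2l hi /= nth_cat size_iota.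
  by rewrite ltnNge leq_addr /= addKn nth_iota.
rewrite (partition_big (fun z : bits (N' + p) => sel sys (N + p) z)
  (fun y : bits (N + p) => ch_win (pad p (drop N y)))) /=; last first.
  by move=> z; rewrite drop_sys.
apply: eq_bigr => y hy; apply: eq_bigl => z.
case: eqP => [hz|_]; rewrite ?andbF // andbT -[RHS]hy -hz.
by rewrite drop_sys.
Qed.

Lemma compiled_ok (A : algo) : algo_ok (ch_msg Ch l) (fun k => aw k + st k)%N A ->
  algo_ok (ch_msg Ch l) (fun=> 0) (compiled A) && oracle_free (compiled A).
Proof.
move=> /andP[msgN okA]; set N := a_width A; set N' := (N + code_fresh (a_code A))%N.
pose simple c := match c with
  | Gate g => wires_ok N' (gate_wires g) | Send => true | Query _ _ => false end.
have main code f : all (instr_ok N) code -> (N <= f)%N -> (f + code_fresh code <= N')%N ->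
    all simple (compile f code).
  elim: code f => [|c code IH] f //= /andP[okc okcode] Nf.
  rewrite /code_fresh big_cons -/(code_fresh code) => fN'.
  case: c okc fN' => [g| |k ws] /=.
  - move=> /andP[u h] fN'; rewrite IH // /wires_ok u !andbT; apply: sub_all h => w; lia.
  - by move=> _ fN'; exact: IH.
  - move=> /andP[/eqP szw okw] fN'.
    rewrite all_cat IH ?andbT //; try lia.
    rewrite all_map -[X in is_true X]/(gates_ok N' _).
    have szq : size (ws ++ iota f (c_width (cs k))) = (aw k + st k + c_width (cs k))%N.
      by rewrite size_cat size_iota szw.
    apply: (@gates_ok_relabel N' _ _ _ _ szq (query_gates_ok (cs_ok k))).
    by apply: wires_ok_fresh okw Nf _; lia.
have h := main (a_code A) N okA (leqnn _) (leqnn _).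
rewrite /algo_ok /oracle_free /= (leq_trans msgN) ?leq_addr //=.
by rewrite !(sub_all _ h) // => -[].
Qed.

(** The cost of a query counts its wires, which pays for the three gates per swapped wire; the
    factor [M] pays for the circuit. *)
Lemma size_compiled (A : algo) M : algo_ok (ch_msg Ch l) (fun k => aw k + st k)%N A ->
  (forall k ws, List.In (Query k ws) (a_code A) -> size (c_gates (cs k)) <= M)%N ->
  (algo_size (compiled A) <= algo_size A * (M + 4))%N.
Proof.
move=> /andP[_ okA]; rewrite /algo_size /=.
suff main N code f : all (instr_ok N) code ->
    (forall k ws, List.In (Query k ws) code -> size (c_gates (cs k)) <= M)%N ->
    (\sum_(c <- compile f code) instr_cost c <= (\sum_(c <- code) instr_cost c) * (M + 4))%N.
  exact: main okA.
elim: code f => [|c code IH] f //=; first by rewrite !big_nil.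
move=> /andP[okc okcode] hM; rewrite big_cons mulnDl.
have h := IH f okcode (fun k ws h => hM k ws (or_intror h)).
have h1 : (1 <= M + 4)%N by rewrite addn4.
case: c okc hM h => [g| |k ws] /= okc hM h.
- by rewrite big_cons /= mul1n; apply: leq_add.
- by rewrite big_cons /= mul1n; apply: leq_add.
case/andP: okc => /eqP szw _; rewrite big_cat /= big_map /=.
rewrite sum1_size size_map; apply: leq_add; last by apply: IH => // k' ws' h'; apply: (hM k' ws'); right.
have hk := hM k ws (or_introl erefl).
have hq := size_query_gates (cs_ok k); rewrite -szw in hq.
rewrite mulSn mulnDr; set u := (_ * M)%N; lia.
Qed.

End Compile.

(** * Tabulation hashing of random keys *)

Section Tabulation.
Variables (B w msg : nat).
Local Notation key := (bits (B * w)).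
Local Notation val_t := (bits msg).
Local Notation tab := ({ffun 'I_B * bits w -> val_t}).

Definition bxor (u v : val_t) : val_t := [tuple tnth u i (+) tnth v i | i < msg].

Lemma bxorK u v : bxor (bxor u v) v = u.
Proof. by apply: eq_from_tnth => i; rewrite !tnth_mktuple addbK. Qed.

Lemma bxorC : commutative bxor.
Proof. by move=> u v; apply: eq_from_tnth => i; rewrite !tnth_mktuple addbC. Qed.

Definition block (r : key) (b : 'I_B) : bits w := [tuple nth false r (b * w + j) | j < w].

Definition hash (T : tab) (r : key) : val_t :=
  [tuple \big[addb/false]_(b < B) tnth (T (b, block r b)) i | i < msg].

Definition separated n (rs : n.-tuple key) (i : 'I_n) (b : 'I_B) : bool :=
  [forall i' : 'I_n, (i' != i) ==> (block (tnth rs i') b != block (tnth rs i) b)].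

(** Sufficient for independent hashes: each key reads a table cell that no other key of the tuple
    reads. *)
Definition good n (rs : n.-tuple key) : bool :=
  [forall i, [exists b, separated rs i b]].

Lemma card_bits k : #|{: bits k}| = (2 ^ k)%N.
Proof. by rewrite card_tuple card_bool. Qed.

(* Changing a table at the blocks [b i] of the keys [tnth rs i] shifts their
   hashes by an arbitrary tuple. *)
Lemma sum_hash_good (V : nmodType) n (rs : n.-tuple key) (Psi : n.-tuple val_t -> V) :
  good rs ->
  (\sum_(T : tab) Psi [tuple hash T (tnth rs i) | i < n]) *+ #|{: n.-tuple val_t}| =
  (\sum_(vs : n.-tuple val_t) Psi vs) *+ #|{: tab}|.
Proof.
move=> /forallP hg.
have /choice[b hb] : forall i : 'I_n, exists b : 'I_B, separated rs i b.
  by move=> i; apply/existsP.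
pose pos i := (b i, block (tnth rs i) (b i)).
have posI i i' : block (tnth rs i') (b i) = block (tnth rs i) (b i) -> i' = i.
  move=> e; apply: contraTeq (hb i) => ni; rewrite negb_forall; apply/existsP; exists i'.
  by rewrite negb_imply ni e eqxx.
pose zero : val_t := [tuple false | i < msg].
pose delta (y : n.-tuple val_t) p : val_t := if [pick i | pos i == p] is Some i then tnth y i else zero.
pose shift (y : n.-tuple val_t) (T : tab) : tab := [ffun p => bxor (T p) (delta y p)].
have shiftK y : involutive (shift y).
  by move=> T; apply/ffunP => p; rewrite !ffunE bxorK.
have hs y T i : hash (shift y T) (tnth rs i) = bxor (hash T (tnth rs i)) (tnth y i).
  apply: eq_from_tnth => m; rewrite !tnth_mktuple.
  under eq_bigr => b' _ do rewrite ffunE tnth_mktuple.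
  rewrite big_split /=; congr (_ (+) _).
  rewrite (bigD1 (b i)) //= big1 ?addbF.
    rewrite /delta; case: pickP => [i'|/(_ i)]; last by rewrite /pos eqxx.
    rewrite xpair_eqE => /andP[/eqP eb /eqP ebl]; by rewrite eb in ebl; rewrite (posI i i' ebl).
  move=> b' nb; rewrite /delta; case: pickP => [i'|_]; last by rewrite tnth_mktuple.
  rewrite xpair_eqE => /andP[/eqP eb /eqP ebl]; move: nb; rewrite -eb.
  have -> : i = i' by apply: posI; rewrite ebl eb.
  by rewrite eqxx.
(* The multiplicity becomes a sum over shifts [y]. Each [shift y] permutes the tables, and for a
   fixed table the shifted hashes run once through all tuples. *)
rewrite -[LHS]sumr_const.
transitivity (\sum_(y : n.-tuple val_t) \sum_(T : tab)
   Psi [tuple bxor (hash T (tnth rs i)) (tnth y i) | i < n]).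
  apply: eq_bigr => y _; rewrite [LHS](reindex_inj (inv_inj (shiftK y))) /=.
  apply: eq_bigr => T _; congr Psi; apply: eq_from_tnth => i; rewrite !tnth_mktuple.
  exact: hs.
rewrite exchange_big /= -[RHS]sumr_const; apply: eq_bigr => T _.
pose tx (y : n.-tuple val_t) : n.-tuple val_t := [tuple bxor (hash T (tnth rs i)) (tnth y i) | i < n].
rewrite [RHS](reindex_inj (h := tx)) //.
move=> y y' e; apply: eq_from_tnth => i.
have := congr1 (fun t : n.-tuple val_t => tnth t i) e; rewrite !tnth_mktuple => h.
by rewrite -[LHS](bxorK _ (hash T (tnth rs i))) [bxor (tnth y i) _]bxorC h
  [bxor _ (tnth y' i)]bxorC bxorK.
Qed.

(** On the collision set the value at [i'] is redundant, so overwriting it by an arbitrary element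
    is injective. *)
Lemma card_collision (X : finType) n (i i' : 'I_n) : i != i' ->
  (#|X| * #|[set c : {ffun 'I_n -> X} | c i' == c i]| <= #|X| ^ n)%N.
Proof.
move=> ne; set S := [set _ | _].
have -> : (#|X| ^ n = #|{: {ffun 'I_n -> X}}|)%N by rewrite card_ffun card_ord.
rewrite -[#|X|]cardsT -cardsX.
pose h (p : X * {ffun 'I_n -> X}) : {ffun 'I_n -> X} := [ffun k => if k == i' then p.1 else p.2 k].
rewrite -[X in (_ <= X)%N]cardsT -(card_in_imset (f := h)); first exact/subset_leq_card/finset.subsetT.
move=> [x c] [x' c']; rewrite !inE /= => /eqP hc /eqP hc' /ffunP e.
have ex : x = x' by have := e i'; rewrite !ffunE eqxx.
congr (_, _) => //; apply/ffunP => k.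
have [->|nk] := eqVneq k i'.
  by rewrite hc hc'; have := e i; rewrite !ffunE (negbTE ne).
by have := e k; rewrite !ffunE (negbTE nk).
Qed.

(** For a bad tuple some key collides in every one of the [B] block columns. The columns are
    independent and each collision has frequency at most n / 2^w, hence the power [B]; the extra
    factor n is the choice of the key. *)
Lemma card_bad n :
  (#|[set rs : n.-tuple key | ~~ good rs]| * 2 ^ (w * B) <= n ^ B.+1 * 2 ^ (B * w * n))%N.
Proof.
(* The array of blocks is transposed, so that badness of a key becomes a condition on each column
   separately. *)
pose col (rs : n.-tuple key) : {ffun 'I_B -> {ffun 'I_n -> bits w}} :=
  [ffun b => [ffun i => block (tnth rs i) b]].
have colI : injective col.
  move=> rs rs' /ffunP e; apply: eq_from_tnth => i; apply: eq_from_tnth => m.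
  have w0 : (0 < w)%N by case: w m => //; rewrite muln0 => -[].
  have hb : (m %/ w < B)%N by rewrite ltn_divLR.
  have /ffunP/(_ i) := e (Ordinal hb); rewrite !ffunE => /(congr1 (fun t : bits w => nth false t (m %% w))).
  have hm : (m %% w < w)%N by rewrite ltn_mod.
  rewrite -[(m %% w)%N]/(val (Ordinal hm)) -!tnth_nth !tnth_mktuple /=.
  by rewrite -divn_eq -!tnth_nth.
pose badcol (i : 'I_n) := [set c : {ffun 'I_n -> bits w} | [exists i' : 'I_n, (i' != i) && (c i' == c i)]].
have cbad i : (#|badcol i| * 2 ^ w <= n * 2 ^ (w * n))%N.
  have : (#|badcol i| <= \sum_(i' : 'I_n | i' != i) #|[set c : {ffun 'I_n -> bits w} | c i' == c i]|)%N.
    have -> : badcol i = \bigcup_(i' : 'I_n | i' != i) [set c : {ffun 'I_n -> bits w} | c i' == c i].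
      apply/setP => c; rewrite inE; apply/existsP/bigcupP => [[i' /andP[h1 h2]]|[i' h1]].
        by exists i' => //; rewrite inE.
      by rewrite inE => h2; exists i'; rewrite h1.
    elim/big_rec2 : _ => [|i' k S _ IH]; first by rewrite cards0.
    by rewrite (leq_trans (leq_card_setU _ _)) // leq_add2l.
  move=> h; apply: (leq_trans (leq_mul h (leqnn _))).
  rewrite big_distrl /= expnM.
  apply: (@leq_trans (\sum_(i' : 'I_n | i' != i) (2 ^ w) ^ n)).
    apply: leq_sum => i' ni; rewrite mulnC -card_bits; apply: card_collision.
    by rewrite eq_sym.
  rewrite sum_nat_const leq_mul2r; apply/orP; right.
  by rewrite -[X in (_ <= X)%N]card_ord; apply: max_card.
have sub : (#|[set rs : n.-tuple key | ~~ good rs]| <= \sum_(i < n) #|badcol i| ^ B)%N.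
  apply: (@leq_trans #|\bigcup_(i : 'I_n) [set rs : n.-tuple key | [forall b, col rs b \in badcol i]]|).
    apply/subset_leq_card/fintype.subsetP => rs; rewrite inE negb_forall => /existsP[i hi].
    apply/bigcupP; exists i => //; rewrite inE; apply/forallP => b.
    move: hi; rewrite negb_exists => /forallP/(_ b); rewrite negb_forall => /existsP[i'].
    rewrite negb_imply negbK => /andP[h1 h2]; rewrite inE; apply/existsP; exists i'.
    by rewrite h1 !ffunE.
  have fam i : (#|[set rs : n.-tuple key | [forall b, col rs b \in badcol i]]| <= #|badcol i| ^ B)%N.
    rewrite -[B in (_ ^ B)%N]card_ord -card_ffun_on -(card_imset _ colI).
    apply/subset_leq_card/fintype.subsetP => c /imsetP[rs]; rewrite inE => /forallP h ->.
    by apply/ffun_onP.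
  elim/big_rec2 : _ => [|i k S _ IH]; first by rewrite cards0.
  by rewrite (leq_trans (leq_card_setU _ _)) // leq_add.
apply: (leq_trans (leq_mul sub (leqnn _))).
rewrite big_distrl /=.
apply: (@leq_trans (\sum_(i < n) (n ^ B * 2 ^ (B * w * n)))%N); last first.
  by rewrite sum_nat_const card_ord expnS mulnA.
apply: leq_sum => i _; rewrite expnM -expnMn.
have -> : (n ^ B * 2 ^ (B * w * n) = (n * 2 ^ (w * n)) ^ B)%N.
  by rewrite expnMn -expnM; congr (_ * 2 ^ _)%N; lia.
by case: (B) => [|B0]; rewrite ?expn0 ?leq_exp2r.
Qed.

End Tabulation.

Section TupleSums.
Variables (X : finType) (V : nmodType).

Lemma sum_tuple_cat m n (F : seq X -> V) :
  \sum_(t : (m + n).-tuple X) F t = \sum_(a : m.-tuple X) \sum_(b : n.-tuple X) F (a ++ b).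
Proof.
rewrite pair_big /=.
pose h (p : m.-tuple X * n.-tuple X) : (m + n).-tuple X := [tuple of p.1 ++ p.2].
rewrite (reindex h) //.
have s1 (t : (m + n).-tuple X) : size (take m t) == m by rewrite size_take_tuple.
have s2 (t : (m + n).-tuple X) : size (drop m t) == n by rewrite size_drop_tuple.
exists (fun t => (Tuple (s1 t), Tuple (s2 t))) => [[a b] _|t _]; last first.
  by apply: val_inj; rewrite /= cat_take_drop.
congr (_, _); apply: val_inj => /=.
  by rewrite take_size_cat ?size_tuple.
by rewrite drop_size_cat ?size_tuple.
Qed.

Lemma sum_tuple_cons n (F : seq X -> V) :
  \sum_(t : n.+1.-tuple X) F t = \sum_(x : X) \sum_(t : n.-tuple X) F (x :: t).
Proof.
rewrite (@sum_tuple_cat 1 n) (reindex (fun x : X => [tuple x])) //.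
exists (@thead 0 X) => [x _|t _]; first by [].
by case/tupleP: t => x t; rewrite theadE; apply: val_inj; rewrite /= (tuple0 t).
Qed.

Lemma sum_tuple0 (F : seq X -> V) : \sum_(t : 0.-tuple X) F t = F [::].
Proof.
by rewrite (bigD1 [tuple]) //= big1 ?addr0 // => t /negP[]; apply/eqP; apply: tuple0.
Qed.

End TupleSums.

(** * Mean and second moment over random tables *)

Section Concentration.
Variables (R : realType) (B w msg : nat).
Local Notation key := (bits (B * w)).
Local Notation val_t := (bits msg).
Local Notation tab := {ffun 'I_B * bits w -> val_t}.

Definition bad_bound n : R := n%:R ^+ B.+1 / 2%:R ^+ (w * B).

Lemma bad_bound_ge0 n : 0 <= bad_bound n.
Proof. by rewrite divr_ge0 ?exprn_ge0. Qed.

Lemma bad_bound_mono m n : (m <= n)%N -> bad_bound m <= bad_bound n.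
Proof.
move=> mn; rewrite ler_wpM2r ?invr_ge0 ?exprn_ge0 //.
by rewrite lerXn2r ?nnegrE ?ler_nat.
Qed.

Definition hashed_avg n (Psi : seq key -> seq val_t -> R) (T : tab) : R :=
  (\sum_(rs : n.-tuple key) Psi rs [seq hash T r | r <- rs]) / #|{: n.-tuple key}|%:R.

Definition uniform_avg n (Psi : seq key -> seq val_t -> R) : R :=
  (\sum_(rs : n.-tuple key) \sum_(vs : n.-tuple val_t) Psi rs vs) /
    (#|{: n.-tuple key}|%:R * #|{: n.-tuple val_t}|%:R).

Let tabn : R := #|{: tab}|%:R.

Lemma card_gt0 (X : finType) (x : X) : 0 < #|X|%:R :> R.
Proof. by rewrite ltr0n; apply/card_gt0P; exists x. Qed.

Let tab0 : 0 < tabn.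
Proof. exact: (card_gt0 ([ffun=> pad msg [::]] : tab)). Qed.

Let keyn0 n : 0 < #|{: n.-tuple key}|%:R :> R.
Proof. exact: (card_gt0 [tuple pad (B * w) [::] | i < n]). Qed.

Let valn0 n : 0 < #|{: n.-tuple val_t}|%:R :> R.
Proof. exact: (card_gt0 [tuple pad msg [::] | i < n]). Qed.

Lemma mean_itv01 (X : finType) (x : X) (f : X -> R) : (forall x, 0 <= f x <= 1) ->
  0 <= (\sum_x f x) / #|X|%:R <= 1.
Proof.
move=> hf; apply/andP; split.
  by apply: divr_ge0; [apply: sumr_ge0 => y _; case/andP: (hf y)|exact: ler0n].
rewrite ler_pdivrMr ?(card_gt0 x) // mul1r -sumr_const.
by apply: ler_sum => y _; case/andP: (hf y).
Qed.

(** On good tuples the average over tables is exactly the uniform one, and on the others the gap is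
    at most 1: only the proportion of bad tuples counts. *)
Lemma hashed_avg_mean n (Psi : seq key -> seq val_t -> R) :
  (forall (rs : n.-tuple key) (vs : n.-tuple val_t), 0 <= Psi rs vs <= 1) ->
  `|(\sum_(T : tab) hashed_avg n Psi T) / tabn - uniform_avg n Psi| <= bad_bound n.
Proof.
move=> hPsi.
pose d (rs : n.-tuple key) : R :=
  (\sum_(T : tab) Psi rs [seq hash T r | r <- rs]) / tabn -
  (\sum_(vs : n.-tuple val_t) Psi rs vs) / #|{: n.-tuple val_t}|%:R.
have mt T (rs : n.-tuple key) : [seq hash T r | r <- rs] = [tuple hash T (tnth rs i) | i < n].
  apply: (@eq_from_nth _ (hash T (pad _ [::]))); rewrite size_map ?size_tuple // => i hi.
  rewrite (nth_map (pad _ [::])) ?size_tuple //.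
  rewrite -[i in RHS]/(val (Ordinal hi)) -tnth_nth tnth_mktuple.
  by rewrite (tnth_nth (pad _ [::])).
have -> : (\sum_(T : tab) hashed_avg n Psi T) / tabn - uniform_avg n Psi =
    (\sum_(rs : n.-tuple key) d rs) / #|{: n.-tuple key}|%:R.
  rewrite /hashed_avg /uniform_avg /d -mulr_suml exchange_big /= sumrB mulrBl.
  rewrite -!mulr_suml; congr (_ - _); first by rewrite mulrAC.
  by rewrite invfM mulrA mulrAC.
have dgood rs : good rs -> d rs = 0.
  move=> /(sum_hash_good (fun vs : n.-tuple val_t => Psi rs vs)) h.
  apply/eqP; rewrite subr_eq0 eqr_div; [|by rewrite gt_eqF|by rewrite gt_eqF].
  rewrite !mulr_natr; apply/eqP; rewrite -h; congr (_ *+ _).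
  by apply: eq_bigr => T _; rewrite mt.
have d1 rs : `|d rs| <= 1.
  have h1 : 0 <= (\sum_(T : tab) Psi rs [seq hash T r | r <- rs]) / tabn <= 1.
    by apply: (mean_itv01 [ffun=> pad msg [::]]) => T; rewrite mt.
  have h2 : 0 <= (\sum_(vs : n.-tuple val_t) Psi rs vs) / #|{: n.-tuple val_t}|%:R <= 1.
    by apply: (mean_itv01 [tuple pad msg [::] | i < n]).
  rewrite /d ler_norml; move: h1 h2; lra.
rewrite normrM [`|_^-1|]gtr0_norm ?invr_gt0 // ler_pdivrMr //.
apply: (le_trans (ler_norm_sum _ _ _)).
rewrite (bigID (fun rs => good rs)) /= big1 ?add0r; last by move=> rs /dgood ->; rewrite normr0.
apply: (@le_trans _ _ (#|[set rs : n.-tuple key | ~~ good rs]|%:R)).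
  rewrite -sum1_card natr_sum; under [leRHS]eq_bigl => rs do rewrite inE.
  by apply: ler_sum => rs _; exact: d1.
rewrite /bad_bound -mulrAC ler_pdivlMr ?exprn_gt0 ?ltr0n //.
rewrite -!natrX -!natrM ler_nat [#|{: n.-tuple key}|]card_tuple card_bits -expnM.
by rewrite (leq_trans (card_bad B w n)) // mulnC mulnC.
Qed.

(** The square of [hashed_avg] is a [hashed_avg] on twice as many keys with the same tables, so
    [hashed_avg_mean] at [n + n] bounds it. Expanding the square costs one error for the quadratic
    term and two for the cross term: hence 3. *)
Lemma hashed_avg_second_moment n (Phi : seq key -> seq val_t -> R) :
  (forall (rs : n.-tuple key) (vs : n.-tuple val_t), 0 <= Phi rs vs <= 1) ->
  (\sum_(T : tab) (hashed_avg n Phi T - uniform_avg n Phi) ^+ 2) / tabn <=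
  3%:R * bad_bound (n + n).
Proof.
move=> hPhi; set U := uniform_avg n Phi; set beta := bad_bound (n + n).
have tak (X : finType) (t : (n + n).-tuple X) : size (take n t) == n.
  by rewrite size_take_tuple.
have drp (X : finType) (t : (n + n).-tuple X) : size (drop n t) == n.
  by rewrite size_drop_tuple.
pose Psi (rs : seq key) (vs : seq val_t) : R :=
  Phi (take n rs) (take n vs) * Phi (drop n rs) (drop n vs).
have hPsi (rs : (n + n).-tuple key) (vs : (n + n).-tuple val_t) : 0 <= Psi rs vs <= 1.
  have /andP[a1 a2] := hPhi (Tuple (tak _ rs)) (Tuple (tak _ vs)).
  have /andP[b1 b2] := hPhi (Tuple (drp _ rs)) (Tuple (drp _ vs)).
  by rewrite mulr_ge0 //= mulr_ile1.
have tcat (X : finType) (a b : n.-tuple X) : take n (a ++ b) = a.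
  by rewrite take_size_cat ?size_tuple.
have dcat (X : finType) (a b : n.-tuple X) : drop n (a ++ b) = b.
  by rewrite drop_size_cat ?size_tuple.
have cardD (X : finType) : #|{: (n + n).-tuple X}|%:R = #|{: n.-tuple X}|%:R * #|{: n.-tuple X}|%:R :> R.
  by rewrite !card_tuple expnD natrM.
have sq T : hashed_avg n Phi T ^+ 2 = hashed_avg (n + n) Psi T.
  rewrite /hashed_avg expr2 mulf_div -cardD; congr (_ / _).
  rewrite (sum_tuple_cat n n (fun rs => Psi rs [seq hash T r | r <- rs])) big_distrlr /=.
  apply: eq_bigr => a _; apply: eq_bigr => b _.
  rewrite /Psi map_cat tcat dcat take_size_cat ?size_map ?size_tuple //.
  by rewrite drop_size_cat ?size_map ?size_tuple.
have sqU : U ^+ 2 = uniform_avg (n + n) Psi.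
  rewrite /U /uniform_avg expr2 mulf_div !cardD mulrACA; congr (_ / _).
  rewrite (sum_tuple_cat n n (fun rs => \sum_(vs : (n + n).-tuple val_t) Psi rs vs)) big_distrlr /=.
  apply: eq_bigr => a _; apply: eq_bigr => b _.
  rewrite (sum_tuple_cat n n (fun vs => Psi (a ++ b) vs)) big_distrlr /=.
  apply: eq_bigr => u _; apply: eq_bigr => v _.
  by rewrite /Psi !tcat !dcat.
have U01 : 0 <= U <= 1.
  rewrite /U /uniform_avg pair_big /= -natrM -card_prod.
  exact: (mean_itv01 ([tuple pad _ [::] | i < n], [tuple pad _ [::] | i < n]) (fun p => hPhi p.1 p.2)).
have m1 := hashed_avg_mean hPhi; have m2 := hashed_avg_mean hPsi.
have b1 : bad_bound n <= beta by apply: bad_bound_mono; rewrite leq_addr.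
have -> : (\sum_(T : tab) (hashed_avg n Phi T - U) ^+ 2) / tabn =
    (\sum_(T : tab) hashed_avg (n + n) Psi T) / tabn -
    2%:R * U * ((\sum_(T : tab) hashed_avg n Phi T) / tabn) + U ^+ 2.
  under eq_bigr => T _ do rewrite sqrrB sq.
  rewrite big_split /= sumrB sumr_const [LHS]mulrDl mulrBl; congr (_ - _ + _).
    rewrite [RHS]mulrA; congr (_ / _); rewrite mulr_sumr; apply: eq_bigr => T _.
    by rewrite -mulr_natl; ring.
  by rewrite -mulr_natr -/tabn mulfK // gt_eqF.
move: m1 m2; rewrite -sqU -/U -/beta.
set x := _ / tabn; set y := _ / tabn; set bb := bad_bound n.
rewrite !ler_norml => /andP[m1 _] /andP[_ m2].
have b0 := bad_bound_ge0 n.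
move/andP: U01 => [u0 u1].
(* Only the lower bound on the first moment is needed here, and only the upper bound on the
   second. *)
have h : U * (U - x) <= beta.
  apply: (@le_trans _ _ (U * beta)); first by rewrite ler_wpM2l //; move: b1; rewrite -/bb; lra.
  by rewrite ler_piMl // (le_trans b0).
move: m2 h; rewrite expr2 mulrBr; set ux := U * x; set uu := U * U.
have -> : 2%:R * U * x = 2%:R * ux by rewrite /ux mulrA.
lra.
Qed.

(** If every table failed for some [l], the sum over [l] of the squared deviations would exceed
    [eps ^+ 2] for every table, hence also on average, against the second moment bound. *)
Lemma exists_table (M : nat) (P : pred nat) (L : nat -> nat)
    (Phi : nat -> seq key -> seq val_t -> R) (eps : R) :
  (forall l (rs : (L l).-tuple key) (vs : (L l).-tuple val_t), 0 <= Phi l rs vs <= 1) ->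
  0 < eps ->
  (forall l, (l < M)%N -> P l -> 3%:R * bad_bound (L l + L l) * M%:R <= eps ^+ 2) ->
  exists T : tab, forall l, (l < M)%N -> P l ->
    hashed_avg (L l) (Phi l) T <= uniform_avg (L l) (Phi l) + eps.
Proof.
move=> hPhi eps0 hb; apply: contrapT => hno.
pose dev l T := (hashed_avg (L l) (Phi l) T - uniform_avg (L l) (Phi l)) ^+ 2.
have big T : eps ^+ 2 < \sum_(l < M | P l) dev l T.
  have /existsNP[l /not_implyP[lM /not_implyP[Pl /negP]]] : ~ (forall l, (l < M)%N -> P l ->
    hashed_avg (L l) (Phi l) T <= uniform_avg (L l) (Phi l) + eps).
    by move=> h; apply: hno; exists T.
  rewrite -ltNge -ltrBrDl => hl.
  rewrite (bigD1 (Ordinal lM)) //= ltr_wpDr //; last first.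
    by rewrite /dev ltr_pXn2r // nnegrE ltW // (lt_trans eps0).
  by apply: sumr_ge0 => i _; apply: sqr_ge0.
have M0 : (0 < M)%N.
  rewrite lt0n; apply/negP => /eqP M0; have := big [ffun=> pad msg [::]].
  by rewrite big1 => [|i _]; [rewrite ltNge sqr_ge0|have := ltn_ord i; rewrite [X in (_ < X)%N]M0].
have : eps ^+ 2 * tabn < \sum_(T : tab) \sum_(l < M | P l) dev l T.
  rewrite mulr_natr -sumr_const.
  apply: ltr_sum => [|T _]; last exact: big.
  by apply/hasP; exists [ffun=> pad msg [::]]; rewrite ?mem_index_enum.
rewrite exchange_big /= ltNge => /negP; apply.
apply: (@le_trans _ _ (\sum_(l < M | P l) (eps ^+ 2 / M%:R * tabn))).
  apply: ler_sum => l Pl; rewrite -ler_pdivrMr //.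
  apply: (le_trans (hashed_avg_second_moment (hPhi l))).
  by rewrite ler_pdivlMr ?ltr0n //; apply: hb.
apply: (@le_trans _ _ (\sum_(l < M) (eps ^+ 2 / M%:R * tabn))).
  rewrite [leRHS](bigID (fun l : 'I_M => P l)) /= lerDl sumr_ge0 // => l _.
  by rewrite mulr_ge0 ?(ltW tab0) // divr_ge0 ?sqr_ge0 ?ler0n.
rewrite sumr_const card_ord -[_ *+ M]mulr_natr [_ * tabn * _]mulrAC divfK //.
by rewrite pnatr_eq0 -lt0n.
Qed.

End Concentration.

(** * Executions with random oracles *)

Section States.
Variable R : realType.
Local Notation C := R[i].

Definition is_state n (rho : op R n n) : Prop :=
  (forall v : 'cV[C]_#|{: bits n}|, 0 <= (v^t* *m rho *m v) 0 0) /\ \tr rho = 1.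

Lemma is_state_channel n (Ks : seq (op R n n)) rho :
  is_channel Ks -> is_state rho -> is_state (app_channel Ks rho).
Proof.
move=> hK [h1 h2]; split=> [v|].
  rewrite /app_channel mulmx_sumr mulmx_suml summxE sumr_ge0 // => K _.
  have := h1 (K^t* *m v).
  by rewrite trmx_mul map_mxM /= trmxCK !mulmxA.
rewrite -h2 -[in RHS](mul1mx rho) -hK /app_channel mulmx_suml !raddf_sum /=.
by apply: eq_bigr => K _; rewrite mxtrace_mulC mulmxA.
Qed.

Lemma is_state_event n (rho : op R n n) (P : pred (bits n)) :
  is_state rho -> 0 <= \sum_(x | P x) outcome rho x <= 1.
Proof.
move=> [h1 h2].
have o0 x : 0 <= outcome rho x.
  have := h1 (delta_mx (enum_rank x) 0).
  rewrite -mulmxA mxE (bigD1 (enum_rank x)) //= big1 ?addr0; last first.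
    by move=> j /negbTE nj; rewrite !mxE nj /= conjC0 mul0r.
  rewrite !mxE !eqxx conjC1 mul1r (bigD1 (enum_rank x)) //= big1 ?addr0; last first.
    by move=> j /negbTE nj; rewrite !mxE nj /= mulr0.
  rewrite !mxE !eqxx mulr1 /outcome /ent lecE => /andP[_]; exact.
rewrite sumr_ge0 //= (@le_trans _ _ (\sum_(x : bits n) outcome rho x)) //.
  by rewrite [leRHS](bigID P) /= lerDl sumr_ge0.
have -> : \sum_(x : bits n) outcome rho x = complex.Re (\tr rho).
  rewrite /mxtrace Re_sum [RHS](reindex (@enum_rank _)) //=.
  by exists enum_val => i _; rewrite ?enum_rankK ?enum_valK.
by rewrite h2.
Qed.

Lemma unitary_channel n (U : op R n n) : U \is unitarymx -> is_channel [:: U].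
Proof.
by rewrite -trmxC_unitary => /unitarymxP; rewrite trmxCK /is_channel big_seq1.
Qed.

Lemma app_channel_sum n (Ks : seq (op R n n)) (I : finType) a (rho : I -> op R n n) :
  app_channel Ks (a *: \sum_i rho i) = a *: \sum_i app_channel Ks (rho i).
Proof.
rewrite /app_channel exchange_big [RHS]scaler_sumr; apply: eq_bigr => K _ /=.
by rewrite -scalemxAr -scalemxAl mulmx_sumr mulmx_suml.
Qed.

Lemma initial_state n : is_state
  (opmx (fun y x => ((y == pad n [::]) && (x == pad n [::]))%:R) : op R n n).
Proof.
set rho0 := opmx _.
have -> : rho0 = delta_mx (enum_rank (pad n [::])) (enum_rank (pad n [::])).
  by apply: ent_eqP => y x; rewrite ent_opmx /ent mxE !(inj_eq enum_rank_inj).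
set i := enum_rank _; split=> [v|].
  have -> : delta_mx i i = delta_mx i 0 *m (delta_mx i (0 : 'I_1))^t* :> op R n n.
    by rewrite trmx_delta map_delta_mx mul_delta_mx.
  rewrite mulmxA -mulmxA mxE big_ord1; set w := v^t* *m _.
  have -> : (delta_mx i (0 : 'I_1))^t* *m v = w^t*.
    by rewrite /w trmx_mul map_mxM /= trmxCK.
  clearbody w; have -> : w^t* 0 0 = (w 0 0)^* :> C by rewrite !mxE.
  exact: mul_conjC_ge0.
rewrite /mxtrace (bigD1 i) //= mxE eqxx big1 ?addr0 // => j /negbTE nj.
by rewrite mxE nj.
Qed.

Section Execution.
Variables (Ch : challenger R) (l : nat) (aw st : nat -> nat) (N : nat).
Hypothesis msgN : (ch_msg Ch l <= N)%N.
Let p := ch_priv Ch l.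
Local Notation ora := (oracle R (fun k => aw k + st k)%N).
Local Notation state := (op R (N + p) (N + p) * nat)%type.
Local Notation step O := (exec_instr (Ch := Ch) (l := l) (O : ora) (N := N)).

Definition oracle_channel (O : ora) : Prop := forall k, is_channel (O k).

Let okm : wires_ok (N + p) (iota 0 (ch_msg Ch l) ++ iota N p).
Proof. exact: wires_ok_cat_iota. Qed.

Let szm : size (iota 0 (ch_msg Ch l) ++ iota N p) = (ch_msg Ch l + p)%N.
Proof. by rewrite size_cat !size_iota. Qed.

Let widen ws : wires_ok N ws -> wires_ok (N + p) ws.
Proof. by case/andP => u h; rewrite /wires_ok u; apply: sub_all h => w; lia. Qed.

Lemma step_state (O : ora) (s : state) c : oracle_channel O -> instr_ok aw st N c ->
  is_state s.1 -> is_state (step O s c).1.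
Proof.
move=> hO; case: c => [g| |k ws] /= hc hs; apply: is_state_channel => //.
- exact/unitary_channel/gate_unitary/widen.
- by apply: lift_channel => //; exact: ch_channel.
- by case/andP: hc => /eqP sz okw; apply: lift_channel => //; exact: widen.
Qed.

Section Randomized.
Variables (Omega : finType) (O0 : ora) (Kf : Omega -> ora).
Hypothesis omega0 : (0 < #|Omega|)%N.
Hypothesis mix : forall k y x y' x',
  choi (O0 k) y x y' x' = #|Omega|%:R^-1 * \sum_omega choi (Kf omega k) y x y' x'.

(** One sample is consumed per instruction, query or not, so that the number of samples is the
    length of the code; at the other instructions the average over the sample is trivial. *)
Fixpoint run_random (code : seq instr) (ws : seq Omega) (s : state) : state :=
  match code, ws with
  | c :: code', w :: ws' => run_random code' ws' (step (Kf w) s c)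
  | _, _ => s
  end.

Lemma run_random_state code ws s : (forall w, oracle_channel (Kf w)) ->
  all (instr_ok aw st N) code -> is_state s.1 -> is_state (run_random code ws s).1.
Proof.
move=> hK; elim: code ws s => [|c code IH] [|w ws] s //= /andP[hc hcode] hs.
by apply: IH => //; apply: step_state.
Qed.

Lemma step_snd (O O' : ora) s s' c : s.2 = s'.2 -> (step O s c).2 = (step O' s' c).2.
Proof. by case: c => [g| |k ws] /= e; rewrite ?e. Qed.

Lemma step_sum (O : ora) a (I : finType) (rho : I -> op R (N + p) (N + p)) i c :
  (step O (a *: \sum_j rho j, i) c).1 = a *: \sum_j (step O (rho j, i) c).1.
Proof. by case: c => [g| |k ws]; rewrite /= app_channel_sum. Qed.

Lemma run_sum (O : ora) a (I : finType) (rho : I -> op R (N + p) (N + p)) i code :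
  (foldl (step O) (a *: \sum_j rho j, i) code).1 = a *: \sum_j (foldl (step O) (rho j, i) code).1.
Proof.
elim: code rho i => [|c code IH] rho i //=.
have e (s : state) : s = (s.1, s.2) by case: s.
rewrite [X in foldl _ X]e step_sum IH; congr (_ *: _); apply: eq_bigr => j _.
by rewrite [X in _ = (foldl _ X _).1]e (step_snd O O (s' := (rho j, i))).
Qed.

Lemma step_mix rho i c :
  (step O0 (rho, i) c).1 = #|Omega|%:R^-1 *: \sum_w (step (Kf w) (rho, i) c).1.
Proof.
have cst (A : op R (N + p) (N + p)) : A = #|Omega|%:R^-1 *: \sum_(w : Omega) A.
  by rewrite sumr_const -[A *+ _]scaler_nat scalerA mulVf ?scale1r // pnatr_eq0 -lt0n.
case: c => [g| |k ws] /=; [exact: cst|exact: cst|].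
apply: ent_eqP => y y'; rewrite ent_channel.
rewrite /ent mxE summxE -/(ent _ _ _).
under [in RHS]eq_bigr => w _ do rewrite -/(ent _ y y') ent_channel.
rewrite [in RHS]exchange_big /= [RHS]mulr_sumr; apply: eq_bigr => x _.
rewrite [in RHS]exchange_big /= [RHS]mulr_sumr; apply: eq_bigr => x' _.
rewrite -mulr_suml mulrA; congr (_ * _); rewrite choi_lift.
under [in RHS]eq_bigr => w _ do rewrite choi_lift.
by case: ifP => _; [exact: mix|rewrite big1 // mulr0].
Qed.

(** Fresh randomness at each query may be drawn in advance: executions are linear in the state, so
    the mixtures can be pulled out one step at a time. *)
Lemma run_mix code rho i :
  (foldl (step O0) (rho, i) code).1 =
  #|{: (size code).-tuple Omega}|%:R^-1 *:
    \sum_(ws : (size code).-tuple Omega) (run_random code ws (rho, i)).1.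
Proof.
elim: code rho i => [|c code IH] rho i /=.
  by rewrite card_tuple expn0 invr1 scale1r sum_tuple0.
have e (s : state) : s = (s.1, s.2) by case: s.
rewrite [X in foldl _ X]e step_mix run_sum.
rewrite (sum_tuple_cons _ (fun ws => (run_random (c :: code) ws (rho, i)).1)) /=.
rewrite !card_tuple expnS natrM invfM -scalerA; congr (_ *: _).
rewrite scaler_sumr; apply: eq_bigr => w _.
by rewrite IH card_tuple -(step_snd (Kf w) O0 (s := (rho, i))) // -e.
Qed.

End Randomized.
End Execution.
End States.

(** * Hiding one security parameter *)

Section TuplePairs.

Lemma sum_tuple_pair (X Y : finType) (V : nmodType) n (F : seq (X * Y) -> V) :
  \sum_(t : n.-tuple (X * Y)) F t =
  \sum_(a : n.-tuple X) \sum_(b : n.-tuple Y) F (zip a b).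
Proof.
elim: n F => [|n IH] F.
  rewrite sum_tuple0 (sum_tuple0 (fun a => \sum_(b : 0.-tuple Y) F (zip a b))).
  by rewrite (sum_tuple0 (fun b => F (zip [::] b))).
rewrite sum_tuple_cons (sum_tuple_cons _ (fun a => \sum_(b : n.+1.-tuple Y) F (zip a b))).
rewrite (eq_bigr (fun p => \sum_(t : n.-tuple (X * Y)) F ((p.1, p.2) :: t))); last by case.
rewrite -(pair_big predT predT (fun x y => \sum_(t : n.-tuple (X * Y)) F ((x, y) :: t))) /=.
apply: eq_bigr => x _.
under eq_bigr => y _ do rewrite (IH (fun t => F ((x, y) :: t))).
rewrite exchange_big /=; apply: eq_bigr => a _.
by rewrite (sum_tuple_cons _ (fun b => F (zip (x :: a) b))).
Qed.

End TuplePairs.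

Section Hybrids.
Variables (R : realType) (Ch : challenger R).
Variables (pk ct sk msg w : nat -> nat) (dec : nat -> circuit).
Variable fsk : nat -> seq bool -> nat -> bool.
Hypothesis dec_ok : forall k, circuit_ok (sk k + ct k) (msg k) (dec k).
Local Notation C := R[i].

Definition in_len k := (pk k + ct k)%N.
Definition out_len k := (k * w k + msg k)%N.
Local Notation ora := (oracle R (fun k => in_len k + out_len k)%N).
Local Notation tables := (nat -> seq bool -> nat -> bool).

Definition real_circuit (T : tables) k : circuit :=
  encrypting_circuit (pk k) (ct k) (sk k) (msg k) k (w k) (dec k) (fsk k) T.

(** Circuits of hybrid [j]: the attacker at parameters below [j], coin flips from [j] on. *)
Definition hybrid (F : nat -> tables) (j k : nat) : circuit :=
  if (k < j)%N then real_circuit (F k) k else uniform_circuit (in_len k) (out_len k).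

(** Random tables live in a finite type, where they can be counted, while circuits take total
    functions; outside of the range the value is [false]. *)
Definition table_fun (B v m : nat) (T : {ffun 'I_B * bits v -> bits m}) : tables :=
  fun b s i => if insub b is Some b' then nth false (T (b', pad v s)) i else false.

Lemma mask_hash B v m (T : {ffun 'I_B * bits v -> bits m}) (r : bits (B * v)) :
  mask_bits m B v (table_fun T) r = hash T r.
Proof.
apply: eq_from_tnth => i; rewrite !tnth_mktuple -[B in iota 0 B]subn0.
rewrite -/(index_iota 0 B) big_mkord; apply: eq_bigr => b _; rewrite /table_fun valK (tnth_nth false).
congr (nth false (T (b, _)) i); apply: bits_eqP => j hj.
rewrite nth_pad hj (nth_map 0%N) ?size_iota // nth_iota //.
by rewrite -[j in RHS]/(val (Ordinal hj)) -tnth_nth tnth_mktuple.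
Qed.

Lemma hybrid_ok F j k : circuit_ok (in_len k) (out_len k) (hybrid F j k).
Proof.
rewrite /hybrid; case: ifP => _; last exact: uniform_circuit_ok.
exact: encrypting_circuit_ok.
Qed.

Lemma choi_circuit_oracle (Omega : finType) (E : finType) a s c (q : C)
    (K : Omega -> E -> op R s a) : circuit_ok a s c ->
  (forall y x y' x', out_choi (circuit_mx R c) y (pad (c_width c) (x : bits a)) y' (pad (c_width c) (x' : bits a)) =
     q * \sum_omega \sum_e ent (K omega e) y x * (ent (K omega e) y' x')^*) ->
  forall y x y' x', choi (circuit_oracle R a s c) y x y' x' =
    q * \sum_omega choi (oracle_ops (K omega)) y x y' x'.
Proof.
move=> /and3P[_ sc _] h y x y' x'; rewrite choi_oracle_ops kraus_choi // !cat0s h.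
under [in RHS]eq_bigr => o _ do rewrite choi_oracle_ops.
by case: ifP => // _; rewrite big1 ?mulr0.
Qed.

Definition enc_ops k (r : seq bool) (v : seq bool) :=
  oracle_ops (@enc_kraus R (pk k) (ct k) (sk k) (msg k) k (w k) (dec k) (fsk k)
                (pad _ r) (pad _ v)).

Section Step.
Variables (j : nat) (F : nat -> tables).
Local Notation key := (bits (j * w j)).
Local Notation val_t := (bits (msg j)).
Variable T : {ffun 'I_j * bits (w j) -> val_t}.

Definition update_tables : nat -> tables := fun k => if k == j then table_fun T else F k.

Definition fixed_oracle (rv : key * val_t) : ora := fun k =>
  if k == j then enc_ops k rv.1 rv.2 else circuits_oracle R (hybrid F j) in_len out_len k.

Lemma pad_id n (x : bits n) : pad n x = x.
Proof. by apply: bits_eqP => i hi; rewrite nth_pad hi. Qed.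

Lemma fixed_oracle_channel rv : oracle_channel (fixed_oracle rv).
Proof.
move=> k; rewrite /fixed_oracle; case: ifP => _.
  by apply: oracle_ops_channel => x x'; apply: enc_kraus_channel.
exact/circuit_oracle_channel/hybrid_ok.
Qed.

Lemma natC_exp k : (2%:R ^- k : C) = (2 ^ k)%:R^-1.
Proof. by rewrite natrX. Qed.

(** Hybrids [j] and [j.+1] are mixtures of the same family [fixed_oracle]: here over the pairs of a
    key and its hash, in [hybrid_mix] over all pairs of a key and a mask. *)
Lemma hybridS_mix k y x y' x' :
  choi (circuits_oracle R (hybrid update_tables j.+1) in_len out_len k) y x y' x' =
  #|{: key}|%:R^-1 * \sum_(r : key) choi (fixed_oracle (r, hash T r) k) y x y' x'.
Proof.
rewrite /fixed_oracle; case: (eqVneq k j) y x y' x' => [->|nk] y x y' x'; last first.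
  rewrite sumr_const -[choi _ _ _ _ _ *+ _]mulr_natl mulrA mulVf ?mul1r; last by rewrite card_bits pnatr_eq0 expn_eq0.
  rewrite /circuits_oracle /hybrid /update_tables (negbTE nk) ltnS leq_eqVlt (negbTE nk) /=.
  by case: ifP.
rewrite /circuits_oracle /hybrid ltnSn /update_tables eqxx card_bits -natC_exp.
pose K (r : key) := @enc_kraus R (pk j) (ct j) (sk j) (msg j) j (w j) (dec j) (fsk j) r (hash T r).
rewrite (@choi_circuit_oracle _ _ _ _ _ (2%:R ^- (j * w j)) K).
- by congr (_ * _); apply: eq_bigr => r _; rewrite /enc_ops !pad_id.
- exact: encrypting_circuit_ok.
move=> y0 x0 y0' x0'; rewrite encrypting_choi //; congr (_ * _).
by apply: eq_bigr => r _; rewrite mask_hash.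
Qed.

Lemma hybrid_mix k y x y' x' :
  choi (circuits_oracle R (hybrid F j) in_len out_len k) y x y' x' =
  #|{: key * val_t}|%:R^-1 * \sum_(rv : key * val_t) choi (fixed_oracle rv k) y x y' x'.
Proof.
rewrite /fixed_oracle; case: (eqVneq k j) y x y' x' => [->|nk] y x y' x'; last first.
  rewrite sumr_const -[choi _ _ _ _ _ *+ _]mulr_natl mulrA mulVf ?mul1r //.
  by rewrite card_prod !card_bits pnatr_eq0 muln_eq0 !expn_eq0.
rewrite /circuits_oracle /hybrid ltnn card_prod !card_bits -expnD -natC_exp.
pose K (rv : key * val_t) := @enc_kraus R (pk j) (ct j) (sk j) (msg j) j (w j) (dec j) (fsk j) rv.1 rv.2.
rewrite (@choi_circuit_oracle _ _ _ _ _ (2%:R ^- (j * w j + msg j)) K).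
- by congr (_ * _); apply: eq_bigr => r _; rewrite /enc_ops !pad_id.
- exact: uniform_circuit_ok.
move=> y0 x0 y0' x0'; rewrite uniform_choi mulrC; congr (_ * _).
rewrite -(pair_big predT predT (fun r v => \sum_e ent (K (r, v) e) y0 x0 * (ent (K (r, v) e) y0' x0')^*)) /=.
by rewrite enc_kraus_average.
Qed.

End Step.

Lemma run_random_map l N (O1 O2 : finType) (K : O2 -> ora) (h : O1 -> O2) code ws s :
  run_random (Ch := Ch) (l := l) (N := N) (fun o => K (h o)) code ws s =
  run_random (Ch := Ch) (l := l) (N := N) K code (map h ws) s.
Proof. by elim: code ws s => [|c code IH] [|o ws] s //=. Qed.

Section Win.
Variables (l : nat) (A : algo).
Hypothesis A_ok : algo_ok (ch_msg Ch l) (fun k => in_len k + out_len k)%N A.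
Let N := a_width A.
Let code := a_code A.
Let L := size code.
Let rho0 : op R (N + ch_priv Ch l) (N + ch_priv Ch l) :=
  opmx (fun y x => ((y == pad _ [::]) && (x == pad _ [::]))%:R).

Definition final_win (rho : op R (N + ch_priv Ch l) (N + ch_priv Ch l)) : R :=
  \sum_(x : bits (N + ch_priv Ch l) | ch_win (pad (ch_priv Ch l) (drop N x))) outcome rho x.

Lemma final_win_scale_sum n (I : finType) (rho : I -> op R (N + ch_priv Ch l) (N + ch_priv Ch l)) :
  final_win (n%:R^-1 *: \sum_i rho i) = (\sum_i final_win (rho i)) / n%:R.
Proof.
rewrite /final_win exchange_big mulr_suml; apply: eq_bigr => x _ /=.
rewrite /outcome /ent mxE summxE.
by rewrite Re_natVM Re_sum mulrC.
Qed.

Definition fixed_win j (F : nat -> tables) (rs : seq (bits (j * w j))) (vs : seq (bits (msg j))) : R :=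
  final_win (run_random (fixed_oracle (j := j) F) code (zip rs vs) (rho0, 0)).1.
Arguments fixed_win : clear implicits.

Lemma fixed_win_bounds j F rs vs : 0 <= fixed_win j F rs vs <= 1.
Proof.
have /andP[msgN okA] := A_ok.
apply: is_state_event; apply: run_random_state okA _ => //; first exact: fixed_oracle_channel.
exact: initial_state.
Qed.

(** The winning probability of a hybrid takes the form required by [exists_table], with the final
    event of the challenger as test function. *)
Lemma win_hybridS j F T :
  win_prob Ch (circuits_oracle R (hybrid (update_tables F T) j.+1) in_len out_len) l A =
  hashed_avg L (fixed_win j F) T.
Proof.
have c0 : (0 < #|{: bits (j * w j)}|)%N by rewrite card_bits expn_gt0.
rewrite /win_prob -/N -/rho0 -/(final_win _) (run_mix c0 (hybridS_mix F T)) final_win_scale_sum.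
rewrite /hashed_avg; congr (_ / _); apply: eq_bigr => rs _.
rewrite /fixed_win (run_random_map (fixed_oracle (j := j) F) (fun r => (r, hash T r))).
congr (final_win (run_random _ _ _ _).1).
by elim: (tval rs) => //= r rs' ->.
Qed.

Lemma win_hybrid j F :
  win_prob Ch (circuits_oracle R (hybrid F j) in_len out_len) l A =
  uniform_avg L (fixed_win j F).
Proof.
have c0 : (0 < #|{: bits (j * w j) * bits (msg j)}|)%N.
  by rewrite card_prod !card_bits muln_gt0 !expn_gt0.
rewrite /win_prob -/N -/rho0 -/(final_win _) (run_mix c0 (hybrid_mix j F)) final_win_scale_sum.
rewrite /uniform_avg; congr (_ / _).
  exact: (sum_tuple_pair _ (fun ws => final_win (run_random (fixed_oracle (j := j) F) code ws (rho0, 0)).1)).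
by rewrite card_tuple card_prod expnMn natrM; congr (_%:R * _%:R); rewrite [RHS]card_tuple.
Qed.

End Win.

(** One table serves all the [l] selected by [P] below [M]. An upper bound suffices: the reduction
    must not win more often with the attacker than with coin flips. *)
Lemma hide_one (Red : nat -> algo) j F M (P : pred nat) (eps : R) :
  (forall l, algo_ok (ch_msg Ch l) (fun k => in_len k + out_len k)%N (Red l)) ->
  0 < eps ->
  (forall l, (l < M)%N -> P l ->
     3%:R * bad_bound R j (w j) (size (a_code (Red l)) + size (a_code (Red l))) * M%:R <= eps ^+ 2) ->
  exists T : tables, forall l, (l < M)%N -> P l ->
    win_prob Ch (circuits_oracle R (hybrid (fun k => if k == j then T else F k) j.+1) in_len out_len) l (Red l)
    <= win_prob Ch (circuits_oracle R (hybrid F j) in_len out_len) l (Red l) + eps.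
Proof.
move=> ok eps0 hb.
have [|T hT] := @exists_table R j (w j) (msg j) M P (fun l => size (a_code (Red l)))
  (fun l => @fixed_win l (Red l) j F) eps _ eps0 hb.
  by move=> l rs vs; apply: fixed_win_bounds.
exists (table_fun T) => l lM Pl.
by have := hT l lM Pl; rewrite -win_hybridS -win_hybrid.
Qed.

End Hybrids.

(** * Polynomial bounds *)

(** A base of at least 2 at every [n] absorbs sums and constants into the exponent, so the closure
    properties become short. *)
Lemma poly_boundedP (g : nat -> nat) :
  poly_bounded g <-> exists k, forall n, (g n <= (n + 2) ^ k)%N.
Proof.
split=> [[k h]|[k h]].
  exists k.+1 => n; apply: (leq_trans (h n)).
  have h1 : (n ^ k <= (n + 2) ^ k)%N by case: k {h} => // k; rewrite leq_exp2r // leq_addr.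
  have h2 : (k <= (n + 2) ^ k)%N by rewrite ltnW // ltn_expl // addn2.
  rewrite expnS; apply: (leq_trans (leq_add h1 h2)).
  by rewrite addnn -mul2n leq_mul2r leq_addl orbT.
exists (2 * k + 3 ^ k)%N => n; apply: (leq_trans (h n)).
have [n2|n1] := leqP 2 n.
  have h1 : (n + 2 <= n ^ 2)%N by rewrite expnS expn1; nia.
  have h2 : ((n + 2) ^ k <= n ^ (2 * k))%N.
    by rewrite expnM; case: k {h} => // k; rewrite leq_exp2r.
  apply: (leq_trans h2); apply: leq_trans (leq_addr _ _).
  by rewrite leq_pexp2l ?leq_addr // ltnW.
have : ((n + 2) ^ k <= 3 ^ k)%N.
  by case: k {h} => // k; rewrite leq_exp2r //; lia.
by move=> h3; rewrite (leq_trans h3) // addnA leq_addl.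
Qed.

Lemma poly_bounded_le f g : (forall n, f n <= g n)%N -> poly_bounded g -> poly_bounded f.
Proof. by move=> h [k hk]; exists k => n; apply: leq_trans (hk n). Qed.

Lemma poly_bounded_id : poly_bounded id.
Proof. by exists 1%N => n; rewrite expn1 leq_addr. Qed.

Lemma poly_bounded_const c : poly_bounded (fun=> c).
Proof. by exists c => n; rewrite leq_addl. Qed.

Lemma poly_bounded_add f g : poly_bounded f -> poly_bounded g ->
  poly_bounded (fun n => f n + g n)%N.
Proof.
move=> /poly_boundedP[a ha] /poly_boundedP[b hb]; apply/poly_boundedP.
exists (a + b).+1 => n; rewrite expnS.
have h1 : (f n <= (n + 2) ^ (a + b))%N.
  by rewrite (leq_trans (ha n)) // leq_pexp2l ?leq_addr // addn2.
have h2 : (g n <= (n + 2) ^ (a + b))%N.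
  by rewrite (leq_trans (hb n)) // leq_pexp2l ?leq_addl // addn2.
rewrite (leq_trans (leq_add h1 h2)) // addnn -mul2n leq_mul2r leq_addl orbT //.
Qed.

Lemma poly_bounded_mul f g : poly_bounded f -> poly_bounded g ->
  poly_bounded (fun n => f n * g n)%N.
Proof.
move=> /poly_boundedP[a ha] /poly_boundedP[b hb]; apply/poly_boundedP.
by exists (a + b)%N => n; rewrite expnD leq_mul.
Qed.

Lemma poly_bounded_exp f e : poly_bounded f -> poly_bounded (fun n => f n ^ e)%N.
Proof.
move=> hf; elim: e => [|e IH]; first exact: poly_bounded_const.
by apply: poly_bounded_le (poly_bounded_mul hf IH) => n; rewrite expnS.
Qed.

Lemma size_tm_step (M : turing_machine) (c : tm_conf M) :
  (size (tm_step c).2 <= size c.2 + 2)%N.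
Proof.
case: c => [[q lt] r] /=; case: ifP => _ /=; first by rewrite leq_addr.
by case: (tm_delta _ _) => [[q' a] [[]|]] /=; rewrite size_behead; lia.
Qed.

Lemma size_tm_output (M : turing_machine) n (c : tm_conf M) :
  (size (tm_output (iter n (@tm_step M) c)) <= size c.2 + 2 * n)%N.
Proof.
have h : (size (iter n (@tm_step M) c).2 <= size c.2 + 2 * n)%N.
  elim: n => [|n IH] /=; first by rewrite leq_addr.
  by have := size_tm_step (iter n (@tm_step M) c); lia.
apply: leq_trans h; case: (iter _ _ _) => [[q lt] r] /=.
rewrite size_pmap (leq_trans (count_size _ _)) // size_take.
by case: ltnP => // _; rewrite index_size.
Qed.

Lemma size_encode_nats s : size (encode_nats s) = (sumn s + size s)%N.
Proof.
rewrite /encode_nats; elim: s => //= n s IH.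
rewrite size_cat size_rcons size_nseq IH; lia.
Qed.

(** A machine cannot write more than its running time allows, and [encode_nats] is unary: so both
    the numbers and their quantity are bounded. *)
Lemma uniform_poly_bound (F : nat -> seq nat) : uniform_poly_time F ->
  exists2 q, poly_bounded q & forall l, (sumn (F l) + size (F l) <= q l)%N.
Proof.
move=> [f [M [p hp hM]] hf]; exists (fun l => l + 2 * p l)%N.
  apply: poly_bounded_add; first exact: poly_bounded_id.
  by apply: poly_bounded_mul => //; exact: poly_bounded_const.
move=> l; rewrite -size_encode_nats -hf.
have [_ <-] := hM (nseq l true); rewrite size_nseq.
by apply: (leq_trans (size_tm_output _ _)); rewrite /= size_map size_nseq.
Qed.

Lemma size_encode_circuit c :
  (c_width c <= sumn (encode_circuit c))%N /\ (size (c_gates c) <= size (encode_circuit c))%N.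
Proof.
rewrite /encode_circuit /=; split; first by rewrite leq_addr.
elim: (c_gates c) => //= g gs IH; rewrite size_cat /=; lia.
Qed.

Section Negligible.
Variable R : realType.
Implicit Types f g : nat -> R.

Lemma negligible_boundP f : Defs.negligible f <->
  forall d, exists n0, forall n, (n0 <= n)%N -> `|f n| <= n%:R ^- d.
Proof.
split=> h d; have := h d.
  by move=> [n0 _ hn]; exists n0 => n hn0; apply: hn.
by move=> [n0 hn]; exists n0.
Qed.

(** Both functions are taken at exponent [d.+1]; the spare factor 1/n absorbs the 2 once n is at
    least 2. *)
Lemma negligible_add f g : Defs.negligible f -> Defs.negligible g -> Defs.negligible (fun n => f n + g n).
Proof.
move=> /negligible_boundP hf /negligible_boundP hg; apply/negligible_boundP => d.
have [n1 h1] := hf d.+1; have [n2 h2] := hg d.+1.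
exists (maxn 2 (maxn n1 n2)) => n; rewrite !geq_max => /and3P[n2' hn1 hn2].
apply: (le_trans (ler_normD _ _)); apply: (le_trans (lerD (h1 n hn1) (h2 n hn2))).
have n0 : 0 < n%:R :> R by rewrite ltr0n; lia.
rewrite exprS invfM -mulrDl ler_piMl ?invr_ge0 ?exprn_ge0 // ?ler0n //.
have : n%:R^-1 <= 2%:R^-1 :> R by rewrite lef_pV2 ?posrE ?ler_nat // ltr0n.
by move=> h; lra.
Qed.

Lemma negligible_eventually f g : (exists n0, forall n, (n0 <= n)%N -> f n = g n) ->
  Defs.negligible g -> Defs.negligible f.
Proof.
move=> [n0 h] /negligible_boundP hg; apply/negligible_boundP => d; have [n1 h1] := hg d.
by exists (maxn n0 n1) => n; rewrite geq_max => /andP[h2 h3]; rewrite h // h1.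
Qed.

End Negligible.

(** * Winning the everlasting game *)

Section Outcomes.
Variable R : realType.
Local Notation C := R[i].

Lemma ent_run_on n k m (U : op R n n) pre (rho : op R k k) y y' : (m <= n)%N ->
  ent (run_on m U pre rho) y y' =
  \sum_(x : bits k) \sum_(x' : bits k)
    out_choi U y (pad n (pre ++ x)) y' (pad n (pre ++ x')) * ent rho x x'.
Proof.
move=> mn.
rewrite /run_on ent_sum.
under eq_bigr => e _.
  rewrite ent_mul.
  under eq_bigr => z _ do rewrite ent_mul ent_adj mulr_suml.
  rewrite exchange_big /=.
  over.
rewrite exchange_big /=; apply: eq_bigr => x _.
rewrite exchange_big /=; apply: eq_bigr => x' _.
rewrite -kraus_choi // mulr_suml; apply: eq_bigr => e _.
by rewrite mulrAC.
Qed.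

Lemma outcome_run_classical_ge0 n m (U : op R n n) pre y :
  0 <= outcome (run_classical m U pre) y.
Proof.
rewrite /outcome /run_classical /run_on ent_sum Re_sum sumr_ge0 // => e _.
rewrite mulmx1 ent_mul Re_sum sumr_ge0 // => x _; rewrite ent_adj.
by have := mul_conjC_ge0 (ent (kraus 0 U pre e) y x); rewrite lecE => /andP[].
Qed.

Section Unmask.
Variables (pk ct sk msg B w : nat) (cd : circuit).
Variables (f : seq bool -> nat -> bool) (T : nat -> seq bool -> nat -> bool).
Hypothesis cd_ok : circuit_ok (sk + ct) msg cd.
Let Wd := c_width cd.

Definition unmask (y : bits (B * w + msg)) : bits msg :=
  [tuple nth false y (B * w + i) (+) nth false (mask_bits msg B w T (pad (B * w) y)) i | i < msg].

(** The probability that decrypting [rho] under the tabulated key leaves the whole register in [z];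
    the adversary and the honest decryption are compared through it. *)
Let weight (p : bits pk) (rho : op R ct ct) (z : bits Wd) : R :=
  complex.Re (\sum_(x : bits ct) \sum_(x' : bits ct)
    ent (circuit_mx R cd) z (pad Wd ([seq f p i | i <- iota 0 sk] ++ x)) *
    (ent (circuit_mx R cd) z (pad Wd ([seq f p i | i <- iota 0 sk] ++ x')))^* * ent rho x x').

Let outcome_encrypting (p : bits pk) (rho : op R ct ct) (y : bits (B * w + msg)) :
  outcome (run_on (B * w + msg) (circuit_mx R (encrypting_circuit pk ct sk msg B w cd f T)) p rho) y =
  2%:R ^- (B * w) * \sum_(r : bits (B * w)) \sum_(z : bits Wd)
     (y == masked r (mask_bits msg B w T r) z)%:R * weight p rho z.
Proof.
have /and3P[_ sn _] := @encrypting_circuit_ok pk ct sk msg B w cd f T cd_ok.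
rewrite /outcome ent_run_on //.
pose pc (x : bits ct) : bits (pk + ct) := [tuple of p ++ x].
have tp x : take pk (pc x) = p by rewrite /= take_size_cat ?size_tuple.
have di x : dec_input sk cd f (pc x) = pad Wd ([seq f p i | i <- iota 0 sk] ++ x).
  by rewrite /dec_input tp /= drop_size_cat ?size_tuple.
rewrite (eq_bigr (fun x : bits ct => \sum_(x' : bits ct) (2 ^ (B * w))%:R^-1 *
   \sum_(r : bits (B * w)) \sum_(z : bits Wd)
   (y == masked r (mask_bits msg B w T r) z)%:R *
   (ent (circuit_mx R cd) z (pad Wd ([seq f p i | i <- iota 0 sk] ++ x)) *
    (ent (circuit_mx R cd) z (pad Wd ([seq f p i | i <- iota 0 sk] ++ x')))^* * ent rho x x'))); last first.
  move=> x _; apply: eq_bigr => x' _.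
  rewrite -[p ++ x]/(tval (pc x)) -[p ++ x']/(tval (pc x')) (encrypting_choi R f T cd_ok).
  rewrite natrX -mulrA; congr (_ * _); rewrite mulr_suml; apply: eq_bigr => r _.
  rewrite enc_kraus_choi // eqxx mul1r mulr_suml; apply: eq_bigr => z _.
  by rewrite !di !tp eqxx mul1r -[LHS]mulrA.
under eq_bigr => x _ do rewrite -mulr_sumr.
rewrite -mulr_sumr Re_natVM natrX; congr (_ * _).
under eq_bigr => x _ do rewrite exchange_big /=.
rewrite exchange_big /= Re_sum; apply: eq_bigr => r _.
under eq_bigr => x _ do rewrite exchange_big /=.
rewrite exchange_big /= Re_sum; apply: eq_bigr => z _.
under eq_bigr => x _ do rewrite -mulr_sumr.
rewrite -mulr_sumr /weight.
by case: (y == _); rewrite ?mul1r // !mul0r.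
Qed.

Let outcome_dec (p : bits pk) (s : bits sk) (rho : op R ct ct) (m : bits msg) :
  (forall i, (i < sk)%N -> nth false s i = f p i) ->
  outcome (run_on msg (circuit_mx R cd) s rho) m =
  \sum_(z : bits Wd | sel (iota 0 msg) msg z == m) weight p rho z.
Proof.
move=> hs; have /and3P[sn mn _] := cd_ok.
have es : tval s = [seq f p i | i <- iota 0 sk].
  apply: (@eq_from_nth _ false); rewrite ?size_map ?size_iota size_tuple // => i hi.
  by rewrite (nth_map 0%N) ?size_iota // nth_iota // hs.
rewrite /outcome ent_run_on // -Re_sum; congr complex.Re.
rewrite [RHS]exchange_big /=; apply: eq_bigr => x _.
rewrite [RHS]exchange_big /=; apply: eq_bigr => x' _.
rewrite /out_choi mulr_suml; apply: eq_bigr => z /eqP <-.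
by rewrite put_sel ?size_iota // es.
Qed.

Let unmask_masked r z :
  unmask (masked r (mask_bits msg B w T r) z) = sel (iota 0 msg) msg (z : bits Wd).
Proof.
have /and3P[_ mn _] := cd_ok.
have nm i : (i < B * w + msg)%N -> nth false (masked r (mask_bits msg B w T r) z) i =
    if (i < B * w)%N then nth false r i
    else nth false z (i - B * w) (+) nth false (mask_bits msg B w T r) (i - B * w).
  move=> hi; rewrite nth_pad hi andTb nth_cat size_tuple; case: ltnP => // h.
  have hm : (i - B * w < msg)%N by rewrite ltn_subLR.
  by rewrite (nth_map 0%N) ?size_iota // nth_iota.
have -> : unmask (masked r (mask_bits msg B w T r) z) =
   [tuple nth false (masked r (mask_bits msg B w T r) z) (B * w + i) (+)
          nth false (mask_bits msg B w T r) i | i < msg].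
  rewrite /unmask; have -> // : pad (B * w) (masked r (mask_bits msg B w T r) z) = r.
  apply: bits_eqP => i hi; rewrite nth_pad hi andTb nm ?hi //.
  exact: leq_trans hi (leq_addr _ _).
apply: bits_eqP => i hi; rewrite nth_sel_iota // add0n.
rewrite -[i in LHS]/(val (Ordinal hi)) -tnth_nth tnth_mktuple nm ?ltn_add2l //.
by rewrite ltnNge leq_addr /= addKn addbK.
Qed.

(** Masking and unmasking cancel for each [r], so both stages together return exactly what
    decryption under the tabulated key returns. *)
Lemma unmask_outcome (p : bits pk) (s : bits sk) (rho : op R ct ct) (m : bits msg) :
  (forall i, (i < sk)%N -> nth false s i = f p i) ->
  \sum_(y : bits (B * w + msg))
    outcome (run_on (B * w + msg) (circuit_mx R (encrypting_circuit pk ct sk msg B w cd f T)) p rho) y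
      * (unmask y == m)%:R =
  outcome (run_on msg (circuit_mx R cd) s rho) m.
Proof.
move=> hs; rewrite (outcome_dec _ _ hs).
under eq_bigr => y _ do rewrite outcome_encrypting -mulrA mulr_suml.
rewrite -mulr_sumr exchange_big /=.
transitivity (2%:R ^- (B * w) * \sum_(r : bits (B * w))
   \sum_(z : bits Wd | sel (iota 0 msg) msg z == m) weight p rho z).
  congr (_ * _); apply: eq_bigr => r _.
  under eq_bigr => y _ do rewrite mulr_suml.
  rewrite exchange_big [RHS]big_mkcond /=; apply: eq_bigr => z _.
  under eq_bigr => y _ do rewrite -mulrA.
  rewrite (eq_bigr (fun y => (masked r (mask_bits msg B w T r) z == y)%:R *
    (weight p rho z * (unmask y == m)%:R))); last by move=> y _; rewrite eq_sym.
  rewrite sum_delta.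
  by rewrite unmask_masked; case: eqP; rewrite ?mulr1 ?mulr0.
rewrite sumr_const card_bits; move: (\sum_(z | _) _) => X.
rewrite -[X *+ _]mulr_natl natrX mulrA mulVf ?mul1r //.
Qed.

End Unmask.
End Outcomes.

Lemma win_prob_ext (R : realType) (Ch : challenger R) ar (O O' : oracle R ar) l A :
  (forall k ws, List.In (Query k ws) (a_code A) -> O k = O' k) ->
  win_prob Ch O l A = win_prob Ch O' l A.
Proof.
move=> h; rewrite /win_prob; set s0 := (_, _).
suff -> : foldl (exec_instr O (N := a_width A)) s0 (a_code A) =
          foldl (exec_instr O' (N := a_width A)) s0 (a_code A) by [].
elim: (a_code A) s0 h => //= c code IH s0 h.
have -> : exec_instr O s0 c = exec_instr O' s0 c.
  by case: c h => // k ws h /=; rewrite (h k ws) //; left.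
by apply: IH => k ws hk; apply: (h k ws); right.
Qed.

(** An efficient algorithm thus queries only polynomially bounded parameters and response
    lengths. *)
Lemma query_cost A k ws : List.In (Query k ws) (a_code A) -> (k + size ws < algo_size A)%N.
Proof.
rewrite /algo_size; elim: (a_code A) => //= c code IH [->|/IH h]; rewrite big_cons /=.
  by rewrite ltnS leq_addr.
exact: leq_trans h (leq_addl _ _).
Qed.

Lemma size_code A : (size (a_code A) <= algo_size A)%N.
Proof.
rewrite /algo_size; elim: (a_code A) => //= c code IH.
by rewrite big_cons -add1n leq_add //; case: c.
Qed.

Lemma query_size A msg ar k ws : algo_ok msg ar A ->
  List.In (Query k ws) (a_code A) -> size ws = ar k.
Proof.
move=> /andP[_]; elim: (a_code A) => //= c code IH /andP[hc hcode] [e|]; last exact: IH.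
by move: hc; rewrite e => /andP[/eqP].
Qed.

(** * The attack and its success probability *)

Section Everlasting.
Variables (R : realType) (S : utpke) (w : nat -> nat).
Hypothesis S_ok : forall l : nat,
    [/\ circuit_ok 0 (pk_len S l + sk_len S l) (gen S l),
        circuit_ok (pk_len S l + msg_len S l) (ct_len S l) (enc S l)
      & circuit_ok (sk_len S l + ct_len S l) (msg_len S l) (dec S l)].

Lemma dec_circuit_ok k : circuit_ok (sk_len S k + ct_len S k) (msg_len S k) (dec S k).
Proof. by have [] := S_ok k. Qed.

Definition key_value k (p : bits (pk_len S k)) (s : bits (sk_len S k)) : R :=
  \sum_(m : bits (msg_len S k)) dec_prob s (enc_state R p m) m.

(** The first stage does not see the sampled secret key. For each public key it uses one that
    maximizes the decryption success summed over all messages, hence at least as good as the sampled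
    one. *)
Definition best_key k (p : bits (pk_len S k)) : bits (sk_len S k) :=
  [arg max_(s > pad (sk_len S k) [::]) key_value p s]%O.

Lemma best_keyP k (p : bits (pk_len S k)) s : key_value p s <= key_value p (best_key p).
Proof. by rewrite /best_key; case: Order.TotalTheory.arg_maxP => //= i _; apply. Qed.

Definition key_table k (q : seq bool) (i : nat) : bool :=
  nth false (best_key (pad (pk_len S k) q)) i.

Definition attack_circuit (F : nat -> nat -> seq bool -> nat -> bool) k : circuit :=
  real_circuit (pk_len S) (ct_len S) (sk_len S) (msg_len S) w (dec S) key_table (F k) k.

Variable F : nat -> nat -> seq bool -> nat -> bool.

Lemma attack_circuit_ok k :
  circuit_ok (pk_len S k + ct_len S k) (out_len (msg_len S) w k) (attack_circuit F k).
Proof. exact/encrypting_circuit_ok/dec_circuit_ok. Qed.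

Lemma attack_unitary k : circuit_mx R (attack_circuit F k) \is unitarymx.
Proof.
have /and3P[_ _ h] := attack_circuit_ok k.
exact: (@gates_unitary R _ (c_gates (attack_circuit F k)) h).
Qed.

Definition attackerA : adversaryA R S :=
  @AdversaryA R S (out_len (msg_len S) w) _ _ attack_unitary
    (fun k => let: And3 h _ _ := and3P (attack_circuit_ok k) in h)
    (fun k => let: And3 _ h _ := and3P (attack_circuit_ok k) in h).

Definition attackB_prob k (st : bits (out_len (msg_len S) w k)) (sk : bits (sk_len S k))
    (m : bits (msg_len S k)) : R := (unmask (F k) st == m)%:R.

Lemma attackB_ge0 k st sk m : 0 <= @attackB_prob k st sk m.
Proof. exact: ler0n. Qed.

Lemma attackB_sum1 k st sk : \sum_m @attackB_prob k st sk m = 1.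
Proof.
rewrite /attackB_prob (bigD1 (unmask (F k) st)) //= eqxx big1 ?addr0 // => m nm.
by rewrite eq_sym (negbTE nm).
Qed.

Definition attackerB : adversaryB R S (st_len attackerA) :=
  @AdversaryB R S (st_len attackerA) attackB_prob attackB_ge0 attackB_sum1.

Lemma everlasting_attack (nu : nat -> R) k :
  (forall m : bits (msg_len S k),
    1 - nu k <=
    \sum_(p : bits (pk_len S k)) \sum_(s : bits (sk_len S k))
      gen_prob R p s * dec_prob s (enc_state R p m) m) ->
  1 - nu k <= everlasting_ow_prob attackerB k.
Proof.
move=> hm; have mu0 : 0 < 2%:R ^- msg_len S k :> R by rewrite invr_gt0 exprn_gt0.
have -> : everlasting_ow_prob attackerB k =
    2%:R ^- msg_len S k * \sum_(p : bits (pk_len S k)) \sum_(s : bits (sk_len S k))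
      gen_prob R p s * key_value p (best_key p).
  rewrite /everlasting_ow_prob mulr_sumr; apply: eq_bigr => p _.
  rewrite mulr_sumr; apply: eq_bigr => s _.
  rewrite mulrCA /key_value mulrA mulr_sumr; apply: eq_bigr => m _.
  transitivity (gen_prob R p s * 2%:R ^- msg_len S k *
    \sum_(y : bits (k * w k + msg_len S k))
      outcome (run_on (k * w k + msg_len S k) (circuit_mx R (attack_circuit F k)) p (enc_state R p m)) y
        * (unmask (F k) y == m)%:R).
    by rewrite mulr_sumr; apply: eq_bigr => y _; rewrite /= /attackB_prob mulrA.
  have hk i : (i < sk_len S k)%N -> nth false (best_key p) i = key_table k p i.
    by move=> hi; rewrite /key_table pad_id.
  have E := @unmask_outcome R _ _ _ _ k (w k) (dec S k) (key_table k) (F k) (dec_circuit_ok k) p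
    (best_key p) (enc_state R p m) m hk.
  rewrite -[circuit_mx R (attack_circuit F k)]/(circuit_mx R (encrypting_circuit
    (pk_len S k) (ct_len S k) (sk_len S k) (msg_len S k) k (w k) (dec S k) (key_table k) (F k))).
  by rewrite E.
(* The best key is replaced by the sampled one, for which the correctness bound, averaged over the
   message, applies. *)
apply: (@le_trans _ _ (2%:R ^- msg_len S k * \sum_(p : bits (pk_len S k)) \sum_(s : bits (sk_len S k))
      gen_prob R p s * key_value p s)); last first.
  rewrite ler_pM2l //; apply: ler_sum => p _; apply: ler_sum => s _.
  by rewrite ler_wpM2l ?best_keyP //; exact: outcome_run_classical_ge0.
apply: (@le_trans _ _ (2%:R ^- msg_len S k * \sum_(m : bits (msg_len S k)) (1 - nu k))).
  rewrite sumr_const card_bits -[(1 - nu k) *+ _]mulr_natl natrX mulrA mulVf ?mul1r //.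
rewrite ler_pM2l //.
have -> : \sum_(p : bits (pk_len S k)) \sum_(s : bits (sk_len S k)) gen_prob R p s * key_value p s =
    \sum_(m : bits (msg_len S k)) \sum_(p : bits (pk_len S k)) \sum_(s : bits (sk_len S k))
      gen_prob R p s * dec_prob s (enc_state R p m) m.
  rewrite [RHS]exchange_big; apply: eq_bigr => p _; rewrite [RHS]exchange_big; apply: eq_bigr => s _ /=.
  by rewrite /key_value mulr_sumr.
by apply: ler_sum.
Qed.

Lemma attack_not_negligible (nu : nat -> R) : Defs.negligible nu ->
  (forall k (m : bits (msg_len S k)),
    1 - nu k <=
    \sum_(p : bits (pk_len S k)) \sum_(s : bits (sk_len S k))
      gen_prob R p s * dec_prob s (enc_state R p m) m) ->
  ~ Defs.negligible (everlasting_ow_prob attackerB).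
Proof.
move=> /negligible_boundP hnu hm /negligible_boundP hn.
have [n1 h1] := hnu 1%N; have [n2 h2] := hn 1%N.
(* At n >= 3 both functions are at most 1/3, whereas their sum is at least 1. *)
pose n := maxn 3 (maxn n1 n2).
have : (n <= n)%N by []; rewrite {1}/n !geq_max => /and3P[n3 hn1 hn2].
have := h1 n hn1; have := h2 n hn2; rewrite !expr1 => a b.
have := everlasting_attack (hm n); have : n%:R^-1 <= 3%:R^-1 :> R.
  by rewrite lef_pV2 ?posrE ?ler_nat // ltr0n //; lia.
have := ler_norm (nu n); have := ler_norm (everlasting_ow_prob attackerB n).
have : (3%:R : R)^-1 * 3%:R = 1 by rewrite mulVf // pnatr_eq0.
lra.
Qed.

End Everlasting.

(** * Impossibility *)

(** Applied with [x] = 2^w(k) and [p] = 2^pk: it bounds the expression of [size_encrypting_circuit],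
    whose summands have coefficients adding up to at most 22. *)
Lemma cubic_size_bound x p k w s c m :
  (p <= x -> k < x -> w < x -> s < x -> c < x -> m < x -> 0 < p ->
  6 + k * w + p * (s + 2) + c + k * (x * (m + 2)) + 4 * (k * w + m) <= 22 * x ^ 3)%N.
Proof.
move=> px kx wx sx cx mx p0.
have x2 : (x <= x ^ 2)%N by rewrite expnS expn1; nia.
have x3 : (x ^ 2 <= x ^ 3)%N by rewrite leq_pexp2l //; lia.
have h1 : (k * w <= x ^ 2)%N by rewrite expnS expn1 leq_mul // ltnW.
have h2 : (p * (s + 2) <= x * (2 * x))%N by rewrite leq_mul //; lia.
have h3 : (k * (x * (m + 2)) <= x * (x * (2 * x)))%N.
  by rewrite leq_mul ?(ltnW kx) // leq_mul //; lia.
have e2 : (x ^ 2 = x * x)%N by rewrite expnS expn1.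
have e3 : (x ^ 3 = x * (x * x))%N by rewrite !expnS expn0 muln1.
move: h1 h2 h3 x2 x3; rewrite e2 e3 !(mulnCA _ 2).
set a := (k * w)%N; set b := (p * _)%N; set d := (k * (_ * _))%N; lia.
Qed.

Section Bounds.
Variable R : realType.

(** With w = 4 v, n <= 2^(2v) keys and fewer than 2^(4v) values of l, the variance bound times that
    number is at most 2^(2 + 6v - 2vj), where 3 is rounded up to 4. This is the square root. *)
Definition hiding_error (v j : nat) : R := 2%:R ^+ (1 + 3 * v) / 2%:R ^+ (v * j).

Lemma hiding_error_gt0 v j : 0 < hiding_error v j.
Proof. by rewrite divr_gt0 ?exprn_gt0. Qed.

Lemma bad_bound_hiding v j n : (n ^ 2 <= 2 ^ (4 * v))%N ->
  3%:R * bad_bound R j (4 * v) n * (2 ^ (4 * v))%:R <= hiding_error v j ^+ 2.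
Proof.
move=> hn; have {}hn : (n <= 2 ^ (2 * v))%N.
  by rewrite -(@leq_exp2r _ _ 2) // -expnM (_ : 2 * v * 2 = 4 * v)%N //; lia.
rewrite /bad_bound /hiding_error expr_div_n -!exprM !mulrA mulrAC ler_pdivrMr ?exprn_gt0 //.
rewrite [leRHS]mulrAC ler_pdivlMr ?exprn_gt0 // -!natrX -!natrM ler_nat.
apply: (@leq_trans (2 ^ 2 * (2 ^ (2 * v)) ^ j.+1 * 2 ^ (4 * v) * 2 ^ (v * j * 2))).
  rewrite !leq_mul2r; apply/orP; right; apply/orP; right.
  by rewrite leq_mul // leq_exp2r.
rewrite -expnM -!expnD leq_exp2l //; nia.
Qed.

(** In exponents of 2 the claim follows from 1 + 3v + 4vm <= vj, and 1 + 3v <= 4v. *)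
Lemma hiding_error_small v j l m : (0 < v)%N -> (0 < l < 2 ^ (4 * v))%N -> (4 * m + 4 <= j)%N ->
  hiding_error v j <= l%:R ^- m.
Proof.
move=> v0 /andP[l0 hl] hj.
rewrite /hiding_error ler_pdivrMr ?exprn_gt0 // mulrC ler_pdivlMr ?exprn_gt0 ?ltr0n //.
rewrite -!natrX -natrM ler_nat.
apply: (@leq_trans (2 ^ (1 + 3 * v) * (2 ^ (4 * v)) ^ m)).
  by rewrite leq_mul2l; apply/orP; right; case: m {hj} => // m; rewrite leq_exp2r // ltnW.
rewrite -expnM -expnD leq_exp2l //; nia.
Qed.

End Bounds.

Theorem corollary5p16 (R : realType) (delta : R)
  (delta_gt0 : 0 < delta) (delta_lt1 : delta < 1)
  (owf : pq_owf_exist delta)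
  (S : utpke) (S_qpt : utpke_qpt S) (S_correct : utpke_correct R S)
  (Ch : challenger R) (c : R) (c_ge0 : 0 <= c) (c_lt1 : c < 1) :
  (exists Red : reduction, black_box_proof S Ch c Red) ->
  ~ assumption_holds Ch c.
Proof.
move=> [Red [eff bb]] assumption.
have [S_ok [gen_poly _ dec_poly]] := S_qpt.
have [q1 pq1 hq1] := uniform_poly_bound gen_poly.
have [q3 pq3 hq3] := uniform_poly_bound dec_poly.
have /poly_boundedP[d hd] := poly_bounded_add pq1 pq3.
(* [v] dominates every length of the scheme, so that 2^w also pays for the key table with its 2^pk
   entries. The exponent [d.+1] instead of [d] gives [k < v k], hence [w] is unbounded. *)
pose v k := ((k + 2) ^ d.+1)%N; pose w k := (4 * v k)%N.
have len_v k : [/\ pk_len S k <= v k, sk_len S k <= v k, msg_len S k <= v k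
    & size (c_gates (dec S k)) <= v k]%N.
  have vd : ((k + 2) ^ d <= v k)%N by rewrite leq_pexp2l // addn2.
  have h1 := hq1 k; have h3 := hq3 k; have hk := leq_trans (hd k) vd.
  have [_ hg] := size_encode_circuit (dec S k).
  move: h1 h3 hk hg; rewrite /=; move: (size (flatten _)) (sumn (flatten _)) => x y; clear; split; lia.
have v_mono k k' : (k <= k')%N -> (v k <= v k')%N by move=> h; rewrite leq_exp2r // leq_add2r.
have v_ge k : (k < v k)%N.
  rewrite /v expnS; have : (0 < (k + 2) ^ d)%N by rewrite expn_gt0 addn2.
  nia.
pose inl := in_len (pk_len S) (ct_len S).
pose st := out_len (msg_len S) w.
have poly_v : poly_bounded v by apply/poly_boundedP; exists d.+1.
have poly_st : poly_bounded st.
  apply: poly_bounded_add; last first.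
    by apply: poly_bounded_le poly_v => k; have [] := len_v k.
  apply: poly_bounded_mul; first exact: poly_bounded_id.
  by apply: poly_bounded_mul => //; exact: poly_bounded_const.
(* The response lengths [st] are known before any table, so the program [Red st l] is the same in
   all hybrids. *)
have [Red_ok /(_ poly_st) poly_size] := eff st.
have /poly_boundedP[a ha] := poly_size.
(* The code has length at most (l + 2)^a <= l^(2a) for l >= 2; twice that is at most l^(2a + 1),
   whose square is l^K, as [bad_bound_hiding] requires. *)
pose K := (4 * a + 2)%N.
pose A l := Red st l.
have A_ok l : algo_ok (ch_msg Ch l) (fun k => inl k + st k)%N (A l) by exact: Red_ok.
have size_K l : (2 <= l)%N -> ((size (a_code (A l)) + size (a_code (A l))) ^ 2 <= l ^ K)%N.
  move=> l2.
  have h1 : (l + 2 <= l ^ 2)%N by rewrite expnS expn1; nia.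
  have h2 : (size (a_code (A l)) <= l ^ (2 * a))%N.
    apply: (leq_trans (size_code _)); apply: (leq_trans (ha l)).
    by rewrite expnM; case: (a) => // a'; rewrite leq_exp2r.
  have h3 : (size (a_code (A l)) + size (a_code (A l)) <= l ^ (2 * a).+1)%N.
    by rewrite addnn -mul2n expnS leq_mul.
  rewrite (_ : K = (2 * a).+1 * 2)%N; last by rewrite /K; lia.
  by rewrite expnM leq_exp2r.
pose tables := nat -> seq bool -> nat -> bool.
pose hyb (F : nat -> tables) := hybrid (pk_len S) (ct_len S) (sk_len S) (msg_len S) w (dec S)
  (@key_table R S) F.
pose win cs l := win_prob Ch (circuits_oracle R cs inl st) l (A l).
pose eps j := hiding_error R (v j) j.
have dec_ok := dec_circuit_ok S_ok.
(* The table chosen at [p.1] depends on the family [p.2] fixed so far. The relevant [l] satisfy l <=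
   l^K < 2^w, so the union bound ranges over fewer than 2^w values. *)
have /choice[G hG] (p : nat * (nat -> tables)) : exists T : tables,
    forall l, (l < 2 ^ w p.1)%N -> (2 <= l)%N && (l ^ K < 2 ^ w p.1)%N ->
    win (hyb (fun k => if k == p.1 then T else p.2 k) p.1.+1) l <= win (hyb p.2 p.1) l + eps p.1.
  apply: (@hide_one R Ch _ _ _ _ w _ _ dec_ok A p.1 p.2 (2 ^ w p.1)
    (fun l => (2 <= l)%N && (l ^ K < 2 ^ w p.1)%N)) => //.
    exact: hiding_error_gt0.
  move=> l _ /andP[l2 lK]; apply: bad_bound_hiding.
  exact: leq_trans (size_K l l2) (ltnW lK).
(* [Fs j] is the family after the tables below [j] have been chosen; later choices do not change
   earlier ones, so the diagonal [F] agrees with [Fs j] below [j]. *)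
pose Fs := fix Fs (j : nat) : nat -> tables :=
  if j is j'.+1 then fun k => if k == j' then G (j', Fs j') else Fs j' k
  else fun _ _ _ _ => false.
pose F k := Fs k.+1 k.
have FsE j k : (k < j)%N -> Fs j k = F k.
  elim: j => // j IH; rewrite ltnS leq_eqVlt => /orP[/eqP -> //|kj] /=.
  by rewrite (ltn_eqF kj) IH.
have hybE j : hyb (Fs j) j = hyb F j.
  by apply/funext => k; rewrite /hyb /hybrid; case: ifP => // /FsE ->.
have win_step j l : (2 <= l)%N -> (l ^ K < 2 ^ w j)%N ->
    win (hyb F j.+1) l <= win (hyb F j) l + eps j.
  move=> l2 lK; rewrite -!hybE; apply: (hG (j, Fs j)); rewrite /= ?l2 //.
  apply: leq_ltn_trans lK; rewrite -[X in (X <= _)%N]expn1 leq_pexp2l //; last by rewrite /K; lia.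
  exact: ltnW.
have exJ l : exists j, (l ^ K < 2 ^ w j)%N.
  exists (l ^ K)%N; apply: (leq_trans (ltn_expl _ (ltnSn 1))).
  by rewrite leq_exp2l // /w; have := v_ge (l ^ K)%N; lia.
(* The threshold: below [J0 l] the tables have size polynomial in [l] and are kept, and from [J0 l]
   on they are hidden by coin flips. *)
pose J0 l := ex_minn (exJ l).
have J0P l j : (l ^ K < 2 ^ w j)%N = (J0 l <= j)%N.
  rewrite /J0; case: ex_minnP => m hm hmin; apply/idP/idP => [|mj]; first exact: hmin.
  apply: (leq_trans hm); rewrite leq_exp2l // /w.
  by have := v_mono _ _ mj; lia.
(* Every queried parameter is below [algo_size (A l)], so hybrid [J l] is the attacker itself as far
   as [A l] can see. *)
pose J l := maxn (J0 l) (algo_size (A l)).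
pose err l := \sum_(J0 l <= j < J l) eps j.
have win_hyb l : (2 <= l)%N -> win (hyb F (J l)) l <= win (hyb F (J0 l)) l + err l.
  move=> l2; rewrite /err; have : (J0 l <= J l)%N by rewrite leq_maxl.
  move: (J l); elim=> [|j IH]; first by rewrite leqn0 => /eqP ->; rewrite big_geq ?addr0.
  rewrite leq_eqVlt => /orP[/eqP <-|]; first by rewrite big_geq ?addr0.
  rewrite ltnS => hj; rewrite big_nat_recr //= addrA.
  by apply: (le_trans (win_step j l l2 _)); [rewrite J0P|rewrite lerD2r IH].
have err_negl : Defs.negligible err.
  apply/negligible_boundP => e.
  (* At most [algo_size (A l)] <= l^(2a) errors are added, each at most l^(-m), which leaves l^(-e).
     The threshold on [l] below forces [J0 l] to be at least 4 m + 4. *)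
  pose m := (e + 2 * a)%N.
  exists ((2 ^ w (4 * m + 4)%N).+2)%N => l hl.
  have l2 : (2 <= l)%N by lia.
  have hJ0 : (4 * m + 4 <= J0 l)%N.
    rewrite leqNgt; apply/negP => h; have := leqnn (J0 l); rewrite -J0P.
    have := v_mono _ _ (ltnW h) => hv.
    have h1 : (2 ^ w (J0 l) <= 2 ^ w (4 * m + 4))%N by rewrite leq_exp2l // /w; lia.
    have h2 : (l <= l ^ K)%N.
      by rewrite -[X in (X <= _)%N]expn1 leq_pexp2l // /K; lia.
    by move=> h3; lia.
  have l0 : 0 < l%:R :> R by rewrite ltr0n; lia.
  rewrite ger0_norm; last by apply: sumr_ge0 => j _; apply/ltW/hiding_error_gt0.
  apply: (@le_trans _ _ (\sum_(J0 l <= j < J l) l%:R ^- m)).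
    rewrite /err !big_nat; apply: ler_sum => j /andP[hj _].
    apply: hiding_error_small; last exact: leq_trans hj.
      by apply: leq_trans (v_ge j).
    apply/andP; split; first lia.
    have : (l ^ K < 2 ^ w j)%N by rewrite J0P.
    apply: leq_ltn_trans; rewrite -[X in (X <= _)%N]expn1 leq_pexp2l //; rewrite /K; lia.
  rewrite sumr_const_nat -[_ *+ _]mulr_natl ler_pdivrMr ?exprn_gt0 //.
  rewrite mulrC /m exprD mulrAC mulfV ?mul1r; last by rewrite expf_neq0 // gt_eqF.
  rewrite -natrX ler_nat; apply: (@leq_trans (algo_size (A l))).
    by rewrite /J maxnE; lia.
  apply: (leq_trans (ha l)); rewrite expnM; case: (a) => // a'; rewrite leq_exp2r //.
  by rewrite expnS expn1; nia.
(* The efficient algorithm without oracle: the reduction with hybrid [J0 l] built in. The tables are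
   its non-uniform advice. *)
pose B l := compiled (hyb F (J0 l)) inl st (A l).
have hyb_ok j k : circuit_ok (inl k) (st k) (hyb F j k) by apply: hybrid_ok.
have : within_bound c (fun l => win_prob Ch (no_oracle R) l (B l)).
  apply: assumption => [l|]; first exact: compiled_ok.
  (* The first term bounds the attacker at parameters with 2^w(k) <= l^K, the second the coin flips,
     whose number is below the cost of the query itself. *)
  pose M l := (22 * (l ^ K) ^ 3 + 5 * algo_size (A l))%N.
  apply: (@poly_bounded_le _ (fun l => algo_size (A l) * (M l + 4))%N).
    move=> l; apply: (size_compiled (hyb_ok _) (A_ok l)) => k ws hin.
    have := query_cost hin; rewrite (query_size (A_ok l) hin) => hk.
    rewrite /hyb /hybrid ltnNge -J0P; case: ltnP => [_|xK].
      apply: (leq_trans (size_uniform_circuit _ _)); rewrite /M -/(st k).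
      by apply: leq_trans (leq_addl _ _); rewrite leq_mul2l /=; lia.
    rewrite /real_circuit; apply: (leq_trans (size_encrypting_circuit R _ _ _ _ _ (dec_ok k))).
    apply: leq_trans (leq_addr _ _).
    have [h1 h2 h3 h4] := len_v k; have hv := v_ge k.
    have wx : (w k < 2 ^ w k)%N by rewrite ltn_expl.
    have px : (2 ^ pk_len S k <= 2 ^ w k)%N by rewrite leq_exp2l // /w; lia.
    have vw : (v k <= w k)%N by rewrite /w; lia.
    apply: (@leq_trans (22 * (2 ^ w k) ^ 3)%N); last by rewrite leq_mul2l leq_exp2r.
    by apply: cubic_size_bound; lia.
  apply: poly_bounded_mul => //; apply: poly_bounded_add; last exact: poly_bounded_const.
  apply: poly_bounded_add; apply: poly_bounded_mul => //; try exact: poly_bounded_const.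
  by do 2!apply: poly_bounded_exp; exact: poly_bounded_id.
move=> [nu nu_negl hnu].
have [nu' nu'_negl hnu'] := S_correct.
have {}bb := bb (attackerA R w S_ok F) (attackerB R w S_ok F)
  (attack_not_negligible nu'_negl hnu').
apply: bb.
have real_win l : win_prob Ch (purified_oracle (attackerA R w S_ok F)) l (A l) = win (hyb F (J l)) l.
  apply: win_prob_ext => k ws /query_cost hk.
  have kJ : (k < J l)%N by rewrite /J leq_max; apply/orP; right; lia.
  by rewrite /circuits_oracle /hyb /hybrid kJ.
(* The estimates start at l = 2; below, the value makes the bound an equality, which does not affect
   negligibility. *)
exists (fun l => if (l < 2)%N then win (hyb F (J l)) l - c else nu l + err l).
  apply: negligible_eventually (negligible_add nu_negl err_negl).
  by exists 2%N => l l2; rewrite [(l < 2)%N]ltnNge l2.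
move=> l; change (win_prob Ch (purified_oracle (attackerA R w S_ok F)) l (A l) <= 
  c + (if (l < 2)%N then win (hyb F (J l)) l - c else nu l + err l)).
rewrite real_win; case: ltnP => l2; first by rewrite addrC subrK.
apply: (le_trans (win_hyb l l2)); rewrite addrA lerD2r.
by have := hnu l; rewrite (compiled_win (hyb_ok _) (A_ok l)).
Qed.
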